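(* For each $w\in\mathbb{C}$, the reproducing kernel $K(w,\cdot)$ of the Hilbert space $\mathcal{H}=\mathcal{B}_2(\pi,\mu)$ is given by $$K(w,z)=f(\overline{w},z)+c(\overline{w})\,g(z)+d(\overline{w})\,h(z)\qquad (z\in\mathbb{C}),$$ where, for $w\neq\pm\frac{1}{\pi\sqrt2}$, $$c(w)=\frac{\cos(\pi w)-\pi w\sin(\pi w)}{(1-2\pi^2w^2)\big(\cos(2^{-1/2})-2^{-1/2}\sin(2^{-1/2})\big)},\qquad d(w)=\frac{2\pi w\cos(\pi w)}{(1-2\pi^2w^2)\,2^{1/2}\cos(2^{-1/2})},$$ $$f(w,z)=\frac{2\pi^2w^2}{2\pi^2w^2-1}\,\frac{\sin\pi(z-w)}{\pi(z-w)},$$ $$g(z)=\frac{2^{1/2}\sin(2^{-1/2})\cos(\pi z)-2\pi z\cos(2^{-1/2})\sin(\pi z)}{1-2\pi^2z^2},$$ $$h(z)=\frac{2\pi z\sin(2^{-1/2})\cos(\pi z)-2^{1/2}\cos(2^{-1/2})\sin(\pi z)}{1-2\pi^2z^2}.$$ At the points $w=\pm\frac{1}{\pi\sqrt2}$ the formula for $K(w,z)$ is to be interpreted in terms of the appropriate limit.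
   Context: Let $d\mu(x)=\left\{1-\left(\frac{\sin\pi x}{\pi x}\right)^2\right\}dx$ on $\mathbb{R}$. $\mathcal{B}_2(\pi,\mu)$ denotes the space of entire functions $f$ of exponential type at most $\pi$ with $\int_{-\infty}^\infty|f(x)|^2\,d\mu(x)<\infty$. With inner product $\langle f_1,f_2\rangle_{\mathcal{H}}=\int_{-\infty}^\infty f_1(x)\overline{f_2(x)}\,d\mu(x)$ it is a Hilbert space $\mathcal{H}$ on which every point evaluation $F\mapsto F(w)$, $w\in\mathbb{C}$, is continuous. The reproducing kernel is the unique family $K(w,\cdot)\in\mathcal{H}$ with $$F(w)=\langle F,K(w,\cdot)\rangle_{\mathcal{H}}=\int_{-\infty}^\infty F(x)\overline{K(w,x)}\,d\mu(x)\qquad\text{for all }F\in\mathcal{H},\ w\in\mathbb{C}.$$ Removable singularities in $z$ (at $z=w$ for $f(w,z)$ and at $z=\pm\frac1{\pi\sqrt2}$ for $g,h$) are filled in by continuity. *)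

(* Defs.v *)
(* The complex numbers are R[i]; their norm topology is that of R[i]^o. *)
From HB Require Import structures.
From mathcomp Require Import all_boot all_order all_algebra.
From mathcomp Require Import complex.
From mathcomp Require Import all_classical all_reals all_analysis.
From mathcomp Require Import measurable_realfun.

Set Implicit Arguments.
Unset Strict Implicit.
Unset Printing Implicit Defensive.

Import Order.TTheory GRing.Theory Num.Theory.
Import numFieldNormedType.Exports.

Local Open Scope classical_set_scope.
Local Open Scope ring_scope.
Local Open Scope complex_scope.

Section Measure.
Context {R : realType}.
Implicit Types x : R.

Definition sinc x : R := if x == 0 then 1 else sin x / x.

Definition mu_density x : R := 1 - sinc (pi * x) ^+ 2.

Lemma measurable_sinc : measurable_fun [set: R] sinc.
Proof.
rewrite -(setUv [set 0 : R]).
apply/measurable_funU => //; first exact: measurableC.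
split.
  exact: measurable_fun_set1.
apply: (eq_measurable_fun (fun x => sin x / x)).
  move=> x; rewrite inE /= => /eqP x0.
  by rewrite /sinc (negbTE x0).
apply: open_continuous_measurable_fun.
  exact/closed_openC/closed_eq.
move=> x; rewrite inE /= => /eqP x0.
apply: cvgM; first exact: continuous_sin.
exact: cvgV.
Qed.

Lemma measurable_mu_density : measurable_fun [set: R] mu_density.
Proof.
apply: measurable_funB => //; apply: measurable_funX.
by apply: (measurableT_comp measurable_sinc); exact: measurable_funM.
Qed.

Let sin_le x : 0 < x -> `|sin x| <= x.
Proof.
move=> x0.
have [|c _] := @MVT R sin cos 0 x x0 (fun x _ => is_derive_sin x).
  exact/continuous_subspaceT/continuous_sin.
rewrite sin0 !subr0 => ->.
by rewrite normrM (gtr0_norm x0) ler_piMl ?cos_max// ltW.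
Qed.

Lemma mu_density_ge0 x : 0 <= mu_density x.
Proof.
rewrite /mu_density subr_ge0 /sinc; case: eqVneq => [_|].
  by rewrite expr1n.
move: (pi * x) => y y0; rewrite -real_normK ?num_real// expr_le1//.
rewrite normrM normfV ler_pdivrMr ?normr_gt0// mul1r.
have [yp|yn|y0'] := ltgtP 0 y; last by rewrite -y0' eqxx in y0.
  by rewrite (gtr0_norm yp) sin_le.
by rewrite (ltr0_norm yn) -normrN -sinN sin_le ?oppr_gt0.
Qed.

End Measure.

(* The measure {1 - (sin (pi x) / (pi x))^2} dx on the real line. *)
Definition mu {R : realType} : set (measurableTypeR R) -> \bar R :=
  fun A => (\int[lebesgue_measure]_(x in A) (mu_density x)%:E)%E.

Section MuMeasure.
Context {R : realType}.

Let mu0 : @mu R set0 = 0%E.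
Proof. exact: integral_set0. Qed.

Let mu_ge0 A : (0 <= @mu R A)%E.
Proof. by apply: integral_ge0 => x _; rewrite lee_fin mu_density_ge0. Qed.

Let mu_sigma_additive : semi_sigma_additive (@mu R).
Proof.
move=> A mA tA mUA; rewrite /mu ge0_integral_bigcup//=; last 2 first.
- by apply/measurable_EFinP/measurable_funTS; exact: measurable_mu_density.
- by move=> x _; rewrite lee_fin mu_density_ge0.
by apply: is_cvg_ereal_nneg_natsum_cond => n _ _; exact: mu_ge0.
Qed.

HB.instance Definition _ := isMeasure.Build _ _ _
  (@mu R) mu0 mu_ge0 mu_sigma_additive.

End MuMeasure.

Section Complex.
Context {R : realType}.
Notation C := R[i].
Implicit Types (w z : C) (F G : C -> C).

Definition Cexp z : C :=
  (expR (complex.Re z))%:C * (cos (complex.Im z) +i* sin (complex.Im z)).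

Definition Ccos z : C := (Cexp ('i * z) + Cexp (- ('i * z))) / 2.

Definition Csin z : C := (Cexp ('i * z) - Cexp (- ('i * z))) / (2 * 'i).

Definition entire F : Prop := forall z, derivable (F : C^o -> C^o) (z : C^o) 1.

Definition exponential_type_le (tau : R) F : Prop :=
  forall e : R, 0 < e -> exists A : R, forall z,
    ComplexField.Normc.normc (F z) <=
    A * expR ((tau + e) * ComplexField.Normc.normc z).

Definition Cintegral (nu : {measure set (measurableTypeR R) -> \bar R})
    (f : R -> C) : C :=
  (\int[nu]_x complex.Re (f x)) +i* (\int[nu]_x complex.Im (f x)).

Definition B2 (tau : R) (nu : {measure set (measurableTypeR R) -> \bar R}) :
    set (C -> C) :=
  [set F | [/\ entire F, exponential_type_le tau F &
    (\int[nu]_x ((ComplexField.Normc.normc (F x%:C)) ^+ 2)%:E < +oo)%E]].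

Definition B2_inner (nu : {measure set (measurableTypeR R) -> \bar R}) F G : C :=
  Cintegral nu (fun x => F x%:C * (G x%:C)^*).

Definition is_reproducing_kernel (tau : R)
    (nu : {measure set (measurableTypeR R) -> \bar R}) (K : C -> C -> C) : Prop :=
  (forall w, B2 tau nu (K w)) /\
  (forall F, B2 tau nu F -> forall w, F w = B2_inner nu F (K w)).

Definition exceptional w : bool :=
  (w == ((pi * Num.sqrt 2)^-1)%:C) || (w == - ((pi * Num.sqrt 2)^-1)%:C).

Definition fill_removable F z : C :=
  if exceptional z then lim ((F u : C^o) @[u --> (z : C^o)^']) else F z.

(* Value at 0 filled in by continuity. *)
Definition csinc z : C := if z == 0 then 1 else Csin z / z.

Local Notation Cpi := (pi%:C).
Local Notation r2 := (Num.sqrt 2 : R).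

Definition kernel_c w : C :=
  (Ccos (Cpi * w) - Cpi * w * Csin (Cpi * w)) /
  ((1 - 2 * Cpi ^+ 2 * w ^+ 2) * (cos r2^-1 - r2^-1 * sin r2^-1)%:C).

Definition kernel_d w : C :=
  (2 * Cpi * w * Ccos (Cpi * w)) /
  ((1 - 2 * Cpi ^+ 2 * w ^+ 2) * (r2 * cos r2^-1)%:C).

Definition kernel_f w z : C :=
  (2 * Cpi ^+ 2 * w ^+ 2) / (2 * Cpi ^+ 2 * w ^+ 2 - 1) * csinc (Cpi * (z - w)).

Definition kernel_g : C -> C := fill_removable (fun z =>
  ((r2 * sin r2^-1)%:C * Ccos (Cpi * z)
   - 2 * Cpi * z * (cos r2^-1)%:C * Csin (Cpi * z)) /
  (1 - 2 * Cpi ^+ 2 * z ^+ 2)).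

Definition kernel_h : C -> C := fill_removable (fun z =>
  (2 * Cpi * z * (sin r2^-1)%:C * Ccos (Cpi * z)
   - (r2 * cos r2^-1)%:C * Csin (Cpi * z)) /
  (1 - 2 * Cpi ^+ 2 * z ^+ 2)).

(* The conjugate is already applied to w; at exceptional w the value is a
   junk one (division by 0) and only the limit in w is meaningful. *)
Definition kernel_formula w z : C :=
  kernel_f w^* z + kernel_c w^* * kernel_g z + kernel_d w^* * kernel_h z.

End Complex.

(* Main.v *)
Require Import Defs.
From HB Require Import structures.
From mathcomp Require Import all_boot all_order all_algebra.
From mathcomp Require Import complex.
From mathcomp Require Import all_classical all_reals all_analysis.
From mathcomp Require Import measurable_realfun.
From mathcomp Require Import ring lra.
Set Implicit Arguments.
Unset Strict Implicit.
Unset Printing Implicit Defensive.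
Import Order.TTheory GRing.Theory Num.Theory.
Import numFieldNormedType.Exports.
Local Open Scope classical_set_scope.
Local Open Scope ring_scope.
Local Open Scope complex_scope.

(** Write [S_u (z) = sin (pi (z - u)) / (pi (z - u))], and let [a] be the positive
    root of [2 pi^2 a^2 = 1]. Everything follows from one pairing formula: for [F]
    entire of type at most [pi] and square integrable on the line, and every [b],
    [[
      2 pi^2 b^2 * integral of F(x) S_b(x) (1 - S_0(x)^2) dx
        = F(b) (2 pi^2 b^2 - 1) + F(0) cos (pi b)
          + b (F'(0) cos (pi b) - pi F(0) sin (pi b)).
    ]]
    At [b = a] and [b = - a] the value [F(b)] drops out, so [F(0)] and [F'(0)] are
    combinations of the pairings of [F] with [S_a] and [S_(- a)]; inserted in the
    formula for [b = w], this presents [F(w)] as the pairing of [F] with a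
    combination of [S_w], [S_a] and [S_(- a)] ([representation]). Over the common
    denominator [1 - 2 pi^2 z^2], the half sum and the half difference of [S_a] and
    [S_(- a)] are the functions [g] and [h] of the statement, and the coefficients
    are [c] and [d] ([kernel_formulaE]). At [w = a] and [w = - a] the formula
    cannot be solved for [F(w)], but its derivative in [b] can
    ([representation_exceptional]), so a kernel exists there too.

    Uniqueness and the limit at the exceptional points come from Hermitian
    symmetry: two kernels satisfy [K w z = conj (K' z w)] ([point_kernel_sym]).
    Thus they coincide, and near an exceptional [w] the formula in [v] is the
    conjugate of [K z v], which is continuous in [v] since [K z] is entire.

    The pairing formula ([pairing]) is a residue computation. Take first the
    kernels dilated by [p > pi] instead of [pi]. Expanding the sines into
    exponentials splits [z^2 (z - b)] times the integrand into [U + V], with [U]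
    small on the positive imaginary axis and [V] on the negative one, and the
    integral is [2 pi i] times the sum of the residues of [U / (z^2 (z - b))]
    ([residue_formula]); then [p] tends to [pi] by dominated convergence. To avoid
    poles on the line, [U] and [V] are first corrected by interpolation terms, so
    that the quotients are entire and integrate to 0 by Cauchy's theorem for the
    half plane ([half_plane]); the corrections contribute a multiple of
    [(1 - cos x) / x^2], whose integral is [pi] ([integral_versine]).

    These contour arguments only use Goursat's theorem for rectangles ([Goursat]),
    applied in the logarithmic coordinate [z = e^zeta], in which quadrants, half
    planes and circles are all rectangles. In particular the mean over a circle
    gives Cauchy's formula for the derivative ([Cauchy_derivative]), hence the
    closure of functions of exponential type under differentiation and divided
    differences. The passage from [mu] to Lebesgue measure is harmless because the
    weight is at least 1/2 at distance 1 or more from the origin ([B2_PW]). *)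

(** * The modulus and complex differentiation *)

(** The real-valued modulus: the norm of [R[i]] takes its values in [R[i]], where
    real inequalities cannot be chained. *)
Definition nrm {R : realType} (z : R[i]) : R := ComplexField.Normc.normc z.
Arguments nrm : simpl never.
Arguments Cexp : simpl never.
Arguments Ccos : simpl never.
Arguments Csin : simpl never.
Arguments csinc : simpl never.

Section Norm.
Context {R : realType}.
Implicit Types z w : R[i].

Lemma nrm_def z : nrm z = Num.sqrt (complex.Re z ^+ 2 + complex.Im z ^+ 2) :> R.
Proof. by case: z. Qed.

Lemma nrm_ge0 z : 0 <= nrm z.
Proof. by rewrite nrm_def sqrtr_ge0. Qed.

Lemma nrmB z w : nrm (z - w) = nrm (w - z).
Proof. by rewrite /nrm -normcN opprB. Qed.

Lemma nrmD z w : nrm (z + w) <= nrm z + nrm w.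
Proof. exact: le_normcD. Qed.

Lemma nrmM z w : nrm (z * w) = nrm z * nrm w.
Proof. exact: ComplexField.Normc.normcM. Qed.

Lemma nrmV z : nrm z^-1 = (nrm z)^-1.
Proof. exact: ComplexField.Normc.normcV. Qed.

Lemma nrm0 : nrm (0 : R[i]) = 0.
Proof. exact: ComplexField.Normc.normc0. Qed.

Lemma nrm1 : nrm (1 : R[i]) = 1.
Proof. exact: ComplexField.Normc.normc1. Qed.

Lemma nrmN z : nrm (- z) = nrm z.
Proof. exact: normcN. Qed.

Lemma nrm_sub z w : nrm (z - w) <= nrm z + nrm w.
Proof. by rewrite -(nrmN w) nrmD. Qed.

Lemma nrm_eq0 z : (nrm z == 0) = (z == 0).
Proof.
apply/eqP/eqP => [|->]; last exact: nrm0.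
exact: ComplexField.Normc.eq0_normc.
Qed.

Lemma nrm_gt0 z : (0 < nrm z) = (z != 0).
Proof. by rewrite lt_neqAle nrm_ge0 andbT eq_sym nrm_eq0. Qed.

Lemma nrmC (x : R) : nrm x%:C = `|x|.
Proof. by rewrite nrm_def /= expr0n addr0 sqrtr_sqr. Qed.

Lemma nrmi : nrm ('i%C : R[i]) = 1.
Proof. by rewrite nrm_def /= expr0n add0r expr1n sqrtr1. Qed.

Lemma nrmX z n : nrm (z ^+ n) = nrm z ^+ n.
Proof. by elim: n => [|n IH]; rewrite ?expr0 ?nrm1// !exprS nrmM IH. Qed.

Lemma nrm_conj z : nrm z^* = nrm z.
Proof. by case: z => x y; rewrite !nrm_def /= sqrrN. Qed.

Lemma Re_le_nrm z : `|complex.Re z| <= nrm z.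
Proof. by rewrite nrm_def -sqrtr_sqr ler_wsqrtr// lerDl sqr_ge0. Qed.

Lemma Im_le_nrm z : `|complex.Im z| <= nrm z.
Proof. by rewrite nrm_def -sqrtr_sqr ler_wsqrtr// lerDr sqr_ge0. Qed.

Lemma nrm_leD z : nrm z <= `|complex.Re z| + `|complex.Im z|.
Proof.
by rewrite {1}[z]complexE; apply: le_trans (nrmD _ _) _; rewrite nrmM nrmi mul1r !nrmC.
Qed.

Lemma nrm_sqr z : nrm z ^+ 2 = complex.Re z ^+ 2 + complex.Im z ^+ 2.
Proof. by rewrite nrm_def sqr_sqrtr// addr_ge0// sqr_ge0. Qed.

Lemma complexP z w : complex.Re z = complex.Re w -> complex.Im z = complex.Im w -> z = w.
Proof. by case: z w => [a b] [c d] /= -> ->. Qed.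

Lemma realC_neq0 (x : R) : x != 0 -> x%:C != 0 :> R[i].
Proof. by move=> x0; rewrite eq_complex negb_and /= x0. Qed.

Lemma imul_eq0 z : 'i%C * z = 0 -> z = 0.
Proof.
case: z => a b [] ; rewrite mul0r add0r mul1r mul0r mul1r add0r.
by move=> /eqP; rewrite oppr_eq0 => /eqP -> ->.
Qed.

End Norm.

Section Deriv.
Context {R : realType}.
Notation C := R[i].
Implicit Types (F G : C -> C) (z w l m h : C).

(** Complex differentiability without a quotient: [h = 0] is allowed, so no
    estimate has to separate it. *)
Definition cderiv F z l := forall e : R, 0 < e -> exists2 d : R, 0 < d &
  forall h, nrm h < d -> nrm (F (z + h) - F z - l * h) <= e * nrm h.

Lemma normc_nrm (z : C) : `|z| = (nrm z)%:C.
Proof. by []. Qed.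

Lemma posC (e : C) : 0 < e -> exists2 r : R, 0 < r & e = r%:C.
Proof.
case: e => a b; rewrite ltcE /= => /andP[/eqP -> a0]; exists a => //.
Qed.

Lemma nrm_ltC (z : C) (r : R) : (`|z| < r%:C) = (nrm z < r).
Proof. by rewrite normc_nrm ltcR. Qed.

Lemma nrm_leC (z : C) (r : R) : (`|z| <= r%:C) = (nrm z <= r).
Proof. by rewrite normc_nrm lecR. Qed.

Lemma near_dnbhs (P : C -> Prop) z : (\forall u \near (z : C^o)^', P u) <->
  exists2 d : R, 0 < d & forall h, 0 < nrm h < d -> P (z + h).
Proof.
rewrite near_withinE; split.
  move=> /nbhs_ballP[d /posC[r r0 ->] H]; exists r => // h /andP[h0 hr].
  apply: H; first by rewrite -ball_normE /= opprD addrA subrr sub0r normrN nrm_ltC.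
  by rewrite -subr_eq0 addrC addKr -nrm_gt0.
move=> [d d0 H]; apply/nbhs_ballP; exists d%:C => /=; first by rewrite ltcR.
move=> u; rewrite -ball_normE /= distrC nrm_ltC => ud uz.
have := H (u - z); rewrite [z + _]addrC subrK; apply.
by rewrite ud nrm_gt0 subr_eq0 uz.
Qed.

Lemma cvg_dnbhs F z l : ((F u : C^o) @[u --> (z : C^o)^'] --> (l : C^o)) <->
  forall e : R, 0 < e -> exists2 d : R, 0 < d & forall h, 0 < nrm h < d -> nrm (F (z + h) - l) <= e.
Proof.
split.
  move=> /cvgrPdist_le H e e0; have e0' : 0 < e%:C :> C by rewrite ltcR.
  have /near_dnbhs[d d0 Hd] := H _ e0'; exists d => // h /Hd.
  by rewrite distrC nrm_leC.
move=> H; apply/cvgrPdist_le => e /posC[r r0 ->].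
have [d d0 Hd] := H r r0; apply/near_dnbhs; exists d => // h /Hd.
by rewrite distrC nrm_leC.
Qed.

(** Differentiability in the direction 1 over the field [R[i]], from which the
    algebraic rules are inherited. *)
Lemma cderivP F z l : cderiv F z l <-> is_derive (z : C^o) 1 (F : C^o -> C^o) l.
Proof.
have E h : h^-1 *: (F (h *: (1 : C^o) + z) - F z) = h^-1 * (F (z + h) - F z) :> C^o.
  by rewrite /GRing.scale /= mulr1 [h + z]addrC.
have quot h : h != 0 -> F (z + h) - F z - l * h = (h^-1 * (F (z + h) - F z) - l) * h.
  by move=> h0; field.
have key : cderiv F z l <->
    ((h^-1 *: (F (h *: (1 : C^o) + z) - F z) : C^o) @[h --> (0 : C^o)^'] --> (l : C^o)).
  split=> [dF|/(cvg_dnbhs (fun h => h^-1 *: (F (h *: (1 : C^o) + z) - F z))) dF e e0].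
    apply/(cvg_dnbhs (fun h => h^-1 *: (F (h *: (1 : C^o) + z) - F z))) => e e0.
    have [d d0 H] := dF e e0; exists d => // h /andP[hn hd].
    by have := H h hd; rewrite add0r E quot -?nrm_gt0// nrmM ler_pM2r.
  have [d d0 H] := dF e e0; exists d => // h hd.
  have [->|h0] := eqVneq h 0; first by rewrite addr0 subrr mulr0 subr0 nrm0 mulr0.
  have := H h; rewrite nrm_gt0 h0 hd add0r E => /(_ isT) k.
  by rewrite quot// nrmM ler_wpM2r// nrm_ge0.
split=> [/key dF|[df dl]]; last by apply/key; rewrite -dl; exact: df.
split; first by apply/cvg_ex; exists l.
exact/cvg_lim.
Qed.

Lemma cderiv_cst (c z : C) : cderiv (fun=> c) z 0.
Proof. by apply/cderivP; exact: is_derive_cst. Qed.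

Lemma cderiv_id z : cderiv id z 1.
Proof. by apply/cderivP; exact: is_derive_id. Qed.

Lemma cderivD F G z l m : cderiv F z l -> cderiv G z m ->
  cderiv (fun u => F u + G u) z (l + m).
Proof. by move=> /cderivP dF /cderivP dG; apply/cderivP; exact: is_deriveD. Qed.

Lemma cderiv_lip F z l : cderiv F z l -> exists2 d : R, 0 < d &
  forall h, nrm h < d -> nrm (F (z + h) - F z) <= (nrm l + 1) * nrm h.
Proof.
move=> /(_ 1 ltr01)[d d0 H]; exists d => // h /H hh.
rewrite (_ : F (z + h) - F z = (F (z + h) - F z - l * h) + l * h); last by ring.
by apply: le_trans (nrmD _ _) _; rewrite nrmM; lra.
Qed.

Lemma cderiv_comp F G z l m : cderiv F z l -> cderiv G (F z) m ->
  cderiv (fun u => G (F u)) z (m * l).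
Proof.
move=> hF hG e e0.
have [d1 d10 H1] := cderiv_lip hF.
pose L := nrm l + 1; pose M := nrm m + 1.
have L0 : 0 < L by rewrite /L; have := nrm_ge0 l; lra.
have M0 : 0 < M by rewrite /M; have := nrm_ge0 m; lra.
have eL : 0 < e / 2 / L by rewrite !divr_gt0.
have eM : 0 < e / 2 / M by rewrite !divr_gt0.
have [d2 d20 H2] := hG _ eL; have [d3 d30 H3] := hF _ eM.
exists (Num.min d1 (Num.min (d2 / L) d3)) => [|h].
  by rewrite !lt_min d10 d30 divr_gt0.
rewrite !lt_min => /and3P[h1 h2 h3].
set k := F (z + h) - F z.
have kh : nrm k <= L * nrm h by exact: H1.
have kd2 : nrm k < d2 by rewrite ltr_pdivlMr// mulrC in h2; lra.
have := H2 _ kd2; rewrite (_ : F z + k = F (z + h)); last by rewrite /k; ring.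
move=> {}H2; have {}H3 := H3 _ h3.
rewrite (_ : _ - _ - _ = (G (F (z + h)) - G (F z) - m * k) + m * (k - l * h)); last by ring.
apply: le_trans (nrmD _ _) _; rewrite nrmM.
have A : e / 2 / L * nrm k <= e / 2 * nrm h.
  by rewrite -mulrA ler_wpM2l//; [lra|rewrite mulrC ler_pdivrMr// mulrC].
have B : nrm m * nrm (k - l * h) <= M * (e / 2 / M * nrm h).
  by apply: ler_pM => //; rewrite ?nrm_ge0// /M; lra.
have E : M * (e / 2 / M * nrm h) = e / 2 * nrm h by field; rewrite gt_eqF.
lra.
Qed.

Lemma cderivM F G z l m : cderiv F z l -> cderiv G z m ->
  cderiv (fun u => F u * G u) z (l * G z + F z * m).
Proof.
move=> /cderivP dF /cderivP dG; apply/cderivP.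
by rewrite addrC [l * _]mulrC; exact: is_deriveM.
Qed.

Lemma cderivZ F z l c : cderiv F z l -> cderiv (fun u => c * F u) z (c * l).
Proof.
move=> hF; have := cderivM (cderiv_cst c z) hF.
by rewrite mul0r add0r.
Qed.

Lemma cderivN F z l : cderiv F z l -> cderiv (fun u => - F u) z (- l).
Proof.
move=> /(cderivZ (-1)); rewrite mulN1r.
by under [X in cderiv X]eq_fun do rewrite mulN1r.
Qed.

Lemma cderivB F G z l m : cderiv F z l -> cderiv G z m ->
  cderiv (fun u => F u - G u) z (l - m).
Proof. by move=> hF /cderivN; exact: cderivD. Qed.

Lemma cderivV z : z != 0 -> cderiv (fun u => u^-1) z (- z^-2).
Proof.
move=> z0; have [d1 d2] : is_derive (z : C^o) 1 (id : C^o -> C^o) 1 by exact: is_derive_id.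
apply/cderivP; split; first exact: (derivableV (f := (id : C^o -> C^o))).
by rewrite (deriveV (f := (id : C^o -> C^o)))// d2 /GRing.scale /= mulr1.
Qed.

Lemma cderiv_eq F G z l : (forall u, F u = G u) -> cderiv F z l -> cderiv G z l.
Proof. by move=> /funext ->. Qed.

Lemma cderiv_near F G z l (r : R) : 0 < r -> (forall h, nrm h < r -> F (z + h) = G (z + h)) ->
  cderiv F z l -> cderiv G z l.
Proof.
move=> r0 FG hF e /hF[d d0 H]; exists (Num.min r d) => [|h].
  by rewrite lt_min r0.
rewrite lt_min => /andP[hr /H]; rewrite FG//.
by have := FG 0; rewrite nrm0 addr0 => ->.
Qed.

Lemma cderiv_uniq F z l m : cderiv F z l -> cderiv F z m -> l = m.
Proof. by move=> /cderivP[_ <-] /cderivP[_ <-]. Qed.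

End Deriv.

Section ExpDeriv.
Context {R : realType}.
Notation C := R[i].
Implicit Types (z w : C).

Lemma CexpD z w : Cexp (z + w) = Cexp z * Cexp w.
Proof.
case: z w => [a b] [c d]; rewrite /Cexp /= expRD cosD sinD.
by apply: complexP => /=; ring.
Qed.

Lemma Cexp0 : Cexp 0 = 1 :> C.
Proof. by rewrite /Cexp /= expR0 cos0 sin0; apply: complexP => /=; ring. Qed.

Lemma CexpN z : Cexp (- z) = (Cexp z)^-1.
Proof.
have E : Cexp z * Cexp (- z) = 1 by rewrite -CexpD subrr Cexp0.
have z0 : Cexp z != 0 by apply: contra_eq_neq E => ->; rewrite mul0r eq_sym oner_eq0.
by apply: (mulfI z0); rewrite E divff.
Qed.

Lemma Cexp_neq0 z : Cexp z != 0.
Proof.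
have E : Cexp z * Cexp (- z) = 1 by rewrite -CexpD subrr Cexp0.
by apply: contra_eq_neq E => ->; rewrite mul0r eq_sym oner_eq0.
Qed.

Lemma nrm_Cexp z : nrm (Cexp z) = expR (complex.Re z).
Proof.
rewrite /Cexp nrmM nrmC gtr0_norm ?expR_gt0//.
by rewrite nrm_def /= cos2Dsin2 sqrtr1 mulr1.
Qed.

Lemma derive_eps (f : R -> R) (x l : R) : is_derive x 1 f l ->
  forall e : R, 0 < e -> exists2 d : R, 0 < d &
    forall h, `|h| < d -> `|f (x + h) - f x - l * h| <= e * `|h|.
Proof.
move=> [df dl] e e0.
have /cvgrPdist_le /(_ e e0) : h^-1 *: (f (h + x) - f x) @[h --> 0^'] --> l.
  by rewrite -dl; under eq_fun do rewrite -[X in f (X + _)]mulr1; exact: df.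
rewrite near_withinE /= => /nbhs_ballP[d /= d0 H].
exists d => // h hd; have [->|h0] := eqVneq h 0.
  by rewrite addr0 subrr mulr0 subr0 normr0 mulr0.
have := H h; rewrite -ball_normE /= sub0r normrN => /(_ hd h0).
have nh : 0 < `|h| by rewrite normr_gt0.
rewrite -(ler_pM2r nh).
rewrite -normrM mulrBl distrC; congr (`|_| <= _); rewrite [h + x]addrC.
by rewrite /GRing.scale /= mulrAC mulVf// mul1r.
Qed.

(** By [CexpD] only the point 0 matters, where the real derivatives of [expR],
    [cos] and [sin] control the two components of
    [Cexp (x +i* y) - 1 - (x +i* y)]. *)
Lemma cderiv_Cexp z : cderiv Cexp z (Cexp z).
Proof.
suff H : cderiv Cexp (0 : C) 1.
  have := cderivZ (Cexp z) (cderiv_comp (cderivD (cderiv_id z) (cderiv_cst (- z) z)) _).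
  move=> /(_ Cexp 1); rewrite subrr => /(_ H); rewrite addr0 !mulr1.
  by apply: cderiv_eq => u; rewrite -CexpD addrC subrK.
move=> e e0.
pose e1 : R := Num.min e 1 / 16.
have m0 : 0 < Num.min e 1 by rewrite lt_min e0 ltr01.
have me : Num.min e 1 <= e by rewrite ge_min lexx.
have m1 : Num.min e 1 <= 1 by rewrite ge_min lexx orbT.
have e10 : 0 < e1 by rewrite divr_gt0.
have ee1 : 16 * e1 <= e by rewrite /e1 mulrC divfK.
have e11 : 16 * e1 <= 1 by rewrite /e1 mulrC divfK.
have [d1 d10 H1] := derive_eps (is_derive_expR (0 : R)) e10.
have [d2 d20 H2] := derive_eps (is_derive_sin (0 : R)) e10.
have [d3 d30 H3] := derive_eps (is_derive_cos (0 : R)) e10.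
exists (Num.min e1 (Num.min d1 (Num.min d2 d3))) => [|h].
  by rewrite !lt_min e10 d10 d20.
rewrite !lt_min => /and4P[he h1 h2 h3].
rewrite add0r Cexp0 mul1r.
case: h he h1 h2 h3 => x y he h1 h2 h3.
set N : R := nrm _ in he h1 h2 h3 *.
have xN : `|x| <= N by exact: (Re_le_nrm (x +i* y)).
have yN : `|y| <= N by exact: (Im_le_nrm (x +i* y)).
have {}H1 := H1 x (le_lt_trans xN h1).
have {}H2 := H2 y (le_lt_trans yN h2).
have {}H3 := H3 y (le_lt_trans yN h3).
move: H1 H2 H3; rewrite !add0r expR0 sin0 cos0 !subr0 oppr0 mul0r subr0 !mul1r => H1 H2 H3.
apply: le_trans (nrm_leD _) _ => /=.
have N0 : 0 <= N by exact: nrm_ge0.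
set a := expR x - 1 - x in H1 *; set b := sin y - y in H2 *; set c := cos y - 1 in H3 *.
have b1 : `|a| <= e1 * N by apply: le_trans H1 _; rewrite ler_wpM2l// ltW.
have b2 : `|b| <= e1 * N by apply: le_trans H2 _; rewrite ler_wpM2l// ltW.
have b3 : `|c| <= e1 * N by apply: le_trans H3 _; rewrite ler_wpM2l// ltW.
have e1N : e1 * N <= N by rewrite ler_piMl//; lra.
rewrite (_ : _ - _ - _ = a + (1 + x + a) * c); last by rewrite /a /c; ring.
rewrite (_ : _ + _ - _ - _ = b + (x + a) * (b + y)); last by rewrite /a /b; ring.
have B1 : `|1 + x + a| <= 3.
  by apply: le_trans (ler_normD _ _) _; apply: le_trans (lerD (ler_normD _ _) (lexx _)) _; rewrite normr1; lra.
have B2 : `|x + a| <= 2 * N by apply: le_trans (ler_normD _ _) _; lra.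
have B3 : `|b + y| <= 2 * N by apply: le_trans (ler_normD _ _) _; lra.
have C1 : `|(1 + x + a) * c| <= 3 * (e1 * N) by rewrite normrM ler_pM.
have C2 : `|(x + a) * (b + y)| <= 2 * N * (2 * N) by rewrite normrM ler_pM.
have C3 : N * N <= e1 * N by rewrite ler_wpM2r// ltW.
have := ler_normD a ((1 + x + a) * c); have := ler_normD b ((x + a) * (b + y)).
have C4 : 16 * (e1 * N) <= e * N by rewrite mulrA ler_wpM2r.
rewrite (_ : 2 * N * (2 * N) = 4 * (N * N)) in C2; last by ring.
have C5 : 0 <= e1 * N by rewrite mulr_ge0// ltW.
move=> D1 D2; lra.
Qed.

End ExpDeriv.

(** From here on these constants are opaque, as unification would otherwise
    unfold them to real components; the equations unfold them on demand. *)
Lemma nrmE (R : realType) (z : R[i]) : ComplexField.Normc.normc z = nrm z.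
Proof. by []. Qed.

Lemma CexpE (R : realType) (z : R[i]) : Cexp z =
  (expR (complex.Re z))%:C * (cos (complex.Im z) +i* sin (complex.Im z)).
Proof. by []. Qed.

#[global] Opaque nrm Cexp cderiv.

(** * Integrals of complex functions of a real variable *)

Section Paths.
Context {R : realType}.
Notation C := R[i].
Implicit Types (f g : R -> C) (z w : C) (x : R).

Definition ccont f := continuous (fun x => complex.Re (f x)) /\
  continuous (fun x => complex.Im (f x)).

Lemma ccont_cst z : ccont (fun=> z).
Proof. by split=> x; exact: cvg_cst. Qed.

Lemma ccontD f g : ccont f -> ccont g -> ccont (fun x => f x + g x).
Proof.
move=> [f1 f2] [g1 g2]; split=> x.
- rewrite (_ : (fun x => complex.Re (f x + g x)) = (fun x => complex.Re (f x) + complex.Re (g x))).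
    by apply: cvgD; [exact: f1|exact: g1].
  by apply/funext => u; case: (f u) => ? ?; case: (g u).
- rewrite (_ : (fun x => complex.Im (f x + g x)) = (fun x => complex.Im (f x) + complex.Im (g x))).
    by apply: cvgD; [exact: f2|exact: g2].
  by apply/funext => u; case: (f u) => ? ?; case: (g u).
Qed.

Lemma ccontM f g : ccont f -> ccont g -> ccont (fun x => f x * g x).
Proof.
move=> [f1 f2] [g1 g2]; split=> x.
- rewrite (_ : (fun x => complex.Re (f x * g x)) = (fun x => complex.Re (f x) * complex.Re (g x) - complex.Im (f x) * complex.Im (g x))).
    by apply: cvgB; apply: cvgM; [exact: f1|exact: g1|exact: f2|exact: g2].
  by apply/funext => u; case: (f u) => ? ?; case: (g u).
- rewrite (_ : (fun x => complex.Im (f x * g x)) = (fun x => complex.Re (f x) * complex.Im (g x) + complex.Im (f x) * complex.Re (g x))).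
    by apply: cvgD; apply: cvgM; [exact: f1|exact: g2|exact: f2|exact: g1].
  by apply/funext => u; case: (f u) => ? ?; case: (g u).
Qed.

Lemma ccontN f : ccont f -> ccont (fun x => - f x).
Proof.
move=> cf; have := ccontM (ccont_cst (-1)) cf.
by under [X in ccont X]eq_fun do rewrite mulN1r.
Qed.

Lemma ccontB f g : ccont f -> ccont g -> ccont (fun x => f x - g x).
Proof. by move=> cf /ccontN; exact: ccontD. Qed.

Lemma ccont_real (r : R -> R) : continuous r -> ccont (fun x => (r x)%:C).
Proof. by move=> cr; split=> x /=; [exact: cr|exact: cvg_cst]. Qed.

Lemma ccont_eps f : (forall x e, 0 < e -> exists2 d : R, 0 < d &
   forall y, `|x - y| < d -> nrm (f y - f x) <= e) -> ccont f.
Proof.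
move=> H; split=> x; apply/cvgrPdist_le => e e0; have [d d0 Hd] := H x e e0;
  near=> y; (have yd : `|x - y| < d by near: y; exact: (@cvgr_dist_lt _ _ _ _ _ id));
  have := Hd y yd; apply: le_trans.
- have -> : complex.Re (f x) - complex.Re (f y) = - complex.Re (f y - f x).
    by case: (f x) (f y) => ? ? [? ?] /=; rewrite opprB.
  by rewrite normrN Re_le_nrm.
- have -> : complex.Im (f x) - complex.Im (f y) = - complex.Im (f y - f x).
    by case: (f x) (f y) => ? ? [? ?] /=; rewrite opprB.
  by rewrite normrN Im_le_nrm.
Unshelve. all: end_near. Qed.

Lemma ccont_eps_inv f x e : ccont f -> 0 < e -> exists2 d : R, 0 < d &
   forall y, `|x - y| < d -> nrm (f y - f x) <= e.
Proof.
move=> [f1 f2] e0.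
have e2 : 0 < e / 2 by lra.
have /cvgrPdist_le/(_ _ e2) /nbhs_ballP[d1 /= d10 H1] := f1 x.
have /cvgrPdist_le/(_ _ e2) /nbhs_ballP[d2 /= d20 H2] := f2 x.
exists (Num.min d1 d2) => [|y]; first by rewrite lt_min d10.
rewrite lt_min => /andP[/H1 /= h1 /H2 /= h2].
apply: le_trans (nrm_leD _) _.
rewrite (_ : complex.Re (f y - f x) = - (complex.Re (f x) - complex.Re (f y))); last first.
  by case: (f x) (f y) => ? ? [? ?] /=; rewrite opprB.
rewrite (_ : complex.Im (f y - f x) = - (complex.Im (f x) - complex.Im (f y))); last first.
  by case: (f x) (f y) => ? ? [? ?] /=; rewrite opprB.
rewrite !normrN; lra.
Qed.

Lemma ccont_comp (F : C -> C) (F' : C -> C) f :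
  (forall z, cderiv F z (F' z)) -> ccont f -> ccont (fun x => F (f x)).
Proof.
move=> dF cf; apply: ccont_eps => x e e0.
have [d d0 H] := cderiv_lip (dF (f x)).
set L := nrm (F' (f x)) + 1 in H.
have L0 : 0 < L by rewrite /L; have := nrm_ge0 (F' (f x)); lra.
have m0 : 0 < Num.min (d / 2) (e / L) by rewrite lt_min !divr_gt0.
have [d' d'0 H'] := ccont_eps_inv x cf m0.
exists d' => // y /H'; rewrite le_min => /andP[h1 h2].
have := H (f y - f x); rewrite [f x + _]addrC subrK.
have -> : nrm (f y - f x) < d by lra.
move=> /(_ isT) /le_trans; apply.
by rewrite mulrC -ler_pdivlMr.
Qed.

(** Both components of [F] along the line [p + q t] are real functions of [t]
    with derivative [Re (F' q)], resp. [Im (F' q)]; any real-linear functional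
    [P] bounded by the modulus would do, which is how the two cases are
    treated at once. *)
Lemma cderiv_line (F : C -> C) p q l x : cderiv F (p + q * x%:C) l ->
  is_derive x 1 (fun t : R => complex.Re (F (p + q * t%:C))) (complex.Re (l * q)) /\
  is_derive x 1 (fun t : R => complex.Im (F (p + q * t%:C))) (complex.Im (l * q)).
Proof.
move=> dF.
have key (P : C -> R) : (forall u v, P (u - v) = P u - P v) -> (forall u (t : R), P (u * t%:C) = P u * t) ->
    (forall u, `|P u| <= nrm u) ->
    is_derive x 1 (fun t : R => P (F (p + q * t%:C))) (P (l * q)).
  move=> PB PZ Pn.
  have H : h^-1 *: (P (F (p + q * (h + x)%:C)) - P (F (p + q * x%:C))) @[h --> 0^'] --> P (l * q).
    apply/cvgrPdist_le => e e0.
    have nq0 : 0 < nrm q + 1 by have := nrm_ge0 q; lra.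
    have eq0 : 0 < e / (nrm q + 1) by rewrite divr_gt0.
    have [d d0 Hd] := dF _ eq0.
    rewrite near_withinE; apply/nbhs_ballP; exists (d / (nrm q + 1)) => /=.
      by rewrite divr_gt0.
    move=> h; rewrite /ball /= sub0r normrN => hd h0.
    have nh : 0 < `|h| by rewrite normr_gt0.
    have qh : nrm (q * h%:C) < d.
      rewrite nrmM nrmC; move: hd; rewrite ltr_pdivlMr// mulrC.
      by apply: le_lt_trans; rewrite ler_wpM2r// lerDl.
    have {}Hd := Hd _ qh.
    have Pd : `|P (F (p + q * (h + x)%:C)) - P (F (p + q * x%:C)) - P (l * q) * h| <= e * `|h|.
      rewrite -PZ -!PB; apply: le_trans (Pn _) _.
      rewrite (_ : p + q * (h + x)%:C = p + q * x%:C + q * h%:C); last by rewrite rmorphD /=; ring.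
      rewrite -[l * q * _]mulrA; apply: le_trans Hd _.
      rewrite nrmM nrmC mulrA ler_wpM2r// mulrAC ler_pdivrMr// ler_wpM2l ?ltW//; lra.
    rewrite -(ler_pM2r nh) -normrM mulrBl distrC; apply: le_trans Pd.
    by rewrite /GRing.scale /= mulrAC mulVf// mul1r.
  have H2 : (fun h : R => h^-1 *: (((fun t : R => P (F (p + q * t%:C))) \o shift x) (h *: 1) - P (F (p + q * x%:C)))) =
     (fun h : R => h^-1 *: (P (F (p + q * (h + x)%:C)) - P (F (p + q * x%:C)))).
    by apply/funext => h /=; rewrite /GRing.scale /= mulr1.
  split.
    by rewrite /derivable H2; apply/cvg_ex; exists (P (l * q)).
  by rewrite /derive H2; apply/cvg_lim.
split; apply: (key (@complex.Re R)) || apply: (key (@complex.Im R)).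
- by move=> [? ?] [? ?].
- by move=> [? ?] t /=; ring.
- exact: Re_le_nrm.
- by move=> [? ?] [? ?].
- by move=> [? ?] t /=; ring.
- exact: Im_le_nrm.
Qed.

(** The real mean value theorem applied to each component; the intermediate
    points of the two components differ, whence the factor 2. *)
Lemma cderiv_mvi (F F' : C -> C) z h (M : R) : (forall w, cderiv F w (F' w)) ->
  (forall t : R, 0 <= t <= 1 -> nrm (F' (z + h * t%:C)) <= M) ->
  nrm (F (z + h) - F z) <= 2 * M * nrm h.
Proof.
move=> dF bF.
have D t := cderiv_line (dF (z + h * t%:C)).
have E1 : F (z + h) = F (z + h * 1%:C) by rewrite rmorph1 mulr1.
have E0 : F z = F (z + h * 0%:C) by rewrite rmorph0 mulr0 addr0.
have bd c : c \in `[0, 1]%R -> nrm (F' (z + h * c%:C) * h) <= M * nrm h.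
  by rewrite in_itv /= => /bF ?; rewrite nrmM ler_wpM2r ?nrm_ge0.
have [c1 c1i e1] := MVT_segment ler01 (fun t _ => (D t).1)
  (continuous_subspaceT (fun t => differentiable_continuous (iffLR (derivable1_diffP _ _) (@ex_derive _ _ _ _ _ _ _ (D t).1)))).
have [c2 c2i e2] := MVT_segment ler01 (fun t _ => (D t).2)
  (continuous_subspaceT (fun t => differentiable_continuous (iffLR (derivable1_diffP _ _) (@ex_derive _ _ _ _ _ _ _ (D t).2)))).
apply: le_trans (nrm_leD _) _.
have -> : complex.Re (F (z + h) - F z) = complex.Re (F' (z + h * c1%:C) * h).
  rewrite subr0 [RHS]mulr1 in e1; rewrite -e1 E1 E0; by case: (F _) => ? ?; case: (F _).
have -> : complex.Im (F (z + h) - F z) = complex.Im (F' (z + h * c2%:C) * h).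
  rewrite subr0 [RHS]mulr1 in e2; rewrite -e2 E1 E0; by case: (F _) => ? ?; case: (F _).
have := bd _ c1i; have := bd _ c2i.
have := Re_le_nrm (F' (z + h * c1%:C) * h).
have := Im_le_nrm (F' (z + h * c2%:C) * h); lra.
Qed.

End Paths.

Section Cint.
Context {R : realType}.
Notation C := R[i].
Notation leb := (@lebesgue_measure R).
Implicit Types (f g : R -> C) (z w : C) (x a b : R).

Definition Cint a b f : C :=
  (\int[leb]_(x in `[a, b]) complex.Re (f x)) +i*
  (\int[leb]_(x in `[a, b]) complex.Im (f x)).

Arguments Cint : simpl never.

Lemma cont_int (r : R -> R) a b : continuous r ->
  leb.-integrable `[a, b] (EFin \o r).
Proof.
move=> cr; apply: continuous_compact_integrable; first exact: segment_compact.
exact/continuous_subspaceT.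
Qed.

Lemma eq_Cint a b f g : (forall x, a <= x <= b -> f x = g x) -> Cint a b f = Cint a b g.
Proof.
by move=> fg; congr (_ +i* _); apply: eq_Rintegral => x; rewrite inE /= in_itv /= => /fg ->.
Qed.

Lemma CintD a b f g : ccont f -> ccont g ->
  Cint a b (fun x => f x + g x) = Cint a b f + Cint a b g.
Proof.
move=> [f1 f2] [g1 g2]; apply: complexP; rewrite /Cint /=.
- rewrite -RintegralD//; [|exact: cont_int..].
  by apply: eq_Rintegral => x _; case: (f x) => ? ?; case: (g x).
- rewrite -RintegralD//; [|exact: cont_int..].
  by apply: eq_Rintegral => x _; case: (f x) => ? ?; case: (g x).
Qed.

Lemma CintZ a b z f : ccont f -> Cint a b (fun x => z * f x) = z * Cint a b f.
Proof.
case: z => p q [f1 f2].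
have cM (r : R) (k : R -> R) : continuous k -> continuous (fun x => r * k x).
  by move=> ck x; apply: cvgM; [exact: cvg_cst|exact: ck].
apply: complexP; rewrite /Cint /=.
- rewrite -!RintegralZl//; [|exact: cont_int..].
  rewrite -RintegralB//; [|by apply: cont_int; exact: cM..].
  by apply: eq_Rintegral => x _; case: (f x).
- rewrite -!RintegralZl//; [|exact: cont_int..].
  rewrite -RintegralD//; [|by apply: cont_int; exact: cM..].
  by apply: eq_Rintegral => x _; case: (f x).
Qed.

Lemma CintB a b f g : ccont f -> ccont g ->
  Cint a b (fun x => f x - g x) = Cint a b f - Cint a b g.
Proof.
move=> cf cg; rewrite -mulN1r -CintZ// -CintD//; last exact: ccontM (ccont_cst _) cg.
by apply: eq_Cint => x _; rewrite mulN1r.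
Qed.

Lemma Cint_cst a b z : a <= b -> Cint a b (fun=> z) = (b - a)%:C * z.
Proof.
move=> ab; have L : fine (leb `[a, b]) = b - a.
  rewrite lebesgue_measure_itv /=; case: ifPn => //; rewrite lte_fin -leNgt => ba.
  by have /eqP -> : a == b; rewrite ?subrr// eq_le ab.
by apply: complexP; rewrite /Cint /= Rintegral_cst// L; case: z => p q /=; ring.
Qed.

Lemma Cint_chasles a b c f : ccont f -> a <= b -> b <= c ->
  Cint a c f = Cint a b f + Cint b c f.
Proof.
have key (r : R -> R) : continuous r -> a <= b -> b <= c ->
    \int[leb]_(x in `[a, c]) r x = \int[leb]_(x in `[a, b]) r x + \int[leb]_(x in `[b, c]) r x.
  move=> cr ab bc.
  have := @Rintegral_itvB R r (BLeft a) (BRight c) b (cont_int a c cr).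
  rewrite !bnd_simp => /(_ ab bc) /eqP; rewrite subr_eq => /eqP ->.
  rewrite addrC; congr (_ + _); rewrite Rintegral_itv_obnd_cbnd//.
  by apply: integrableS (cont_int b c cr) => //; exact: subset_itv_oc_cc.
by move=> [f1 f2] ab bc; apply: complexP; rewrite /Cint /=; apply: key.
Qed.

Lemma Rint_le (r : R -> R) a b M : continuous r -> a <= b ->
  (forall x, a <= x <= b -> `|r x| <= M) ->
  `|\int[leb]_(x in `[a, b]) r x| <= M * (b - a).
Proof.
move=> cr ab rM; apply: le_trans (le_normr_Rintegral _ _) _ => //; first exact: cont_int.
have L : fine (leb `[a, b]) = b - a.
  rewrite lebesgue_measure_itv /=; case: ifPn => //; rewrite lte_fin -leNgt => ba.
  by have /eqP -> : a == b; rewrite ?subrr// eq_le ab.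
rewrite -L -Rintegral_cst//; apply: le_Rintegral => //.
- by apply: cont_int => x; apply: continuous_comp; [exact: cr|exact: norm_continuous].
- by apply: cont_int => x; exact: cvg_cst.
Qed.

(** The factor 2 comes from bounding the two components separately. *)
Lemma Cint_le f a b M : ccont f -> a <= b -> (forall x, a <= x <= b -> nrm (f x) <= M) ->
  nrm (Cint a b f) <= 2 * (M * (b - a)).
Proof.
move=> [f1 f2] ab fM; apply: le_trans (nrm_leD _) _; rewrite /Cint /=.
have := @Rint_le _ a b M f1 ab (fun x h => le_trans (Re_le_nrm _) (fM x h)).
have := @Rint_le _ a b M f2 ab (fun x h => le_trans (Im_le_nrm _) (fM x h)).
lra.
Qed.

End Cint.

Lemma ccontP (R : realType) (f : R -> R[i]) : ccont f <->
  continuous (fun x => complex.Re (f x)) /\ continuous (fun x => complex.Im (f x)).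
Proof. by []. Qed.

Lemma CintE (R : realType) a b (f : R -> R[i]) : Cint a b f =
  (\int[@lebesgue_measure R]_(x in `[a, b]) complex.Re (f x)) +i*
  (\int[@lebesgue_measure R]_(x in `[a, b]) complex.Im (f x)).
Proof. by []. Qed.

#[global] Opaque ccont Cint.

(** * Goursat's theorem for rectangles *)

Section Goursat.
Context {R : realType}.
Notation C := R[i].
Implicit Types (g : C -> C) (z w l : C).

Definition hol g := forall z, exists l, cderiv g z l.

Definition cD g z : C := xget 0 [set l | cderiv g z l].

Lemma hol_cD g z : hol g -> cderiv g z (cD g z).
Proof. by move=> /(_ z)[l gl]; rewrite /cD; case: xgetP => [//|/(_ l)]. Qed.

Lemma cD_eq g z l : cderiv g z l -> cD g z = l.
Proof.
move=> gl; apply: (cderiv_uniq (F := g) (z := z)) => //.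
by rewrite /cD; case: xgetP => [//|/(_ l)].
Qed.

Lemma ccont_hol g (f : R -> C) : hol g -> ccont f -> ccont (fun x => g (f x)).
Proof. by move=> hg; apply: (ccont_comp (F' := cD g)) => z; exact: hol_cD. Qed.

Lemma ccont_horiz (y : R) : ccont (fun x => x +i* y).
Proof. by apply/ccontP; split=> x /=; [exact: cvg_id|exact: cvg_cst]. Qed.

Lemma ccont_vert (x : R) : ccont (fun y => x +i* y).
Proof. by apply/ccontP; split=> y /=; [exact: cvg_cst|exact: cvg_id]. Qed.

(** Counterclockwise along the boundary of a rectangle. *)
Definition bdry g (x1 x2 y1 y2 : R) : C :=
  Cint x1 x2 (fun x => g (x +i* y1)) - Cint x1 x2 (fun x => g (x +i* y2)) +
  'i%C * (Cint y1 y2 (fun y => g (x2 +i* y)) - Cint y1 y2 (fun y => g (x1 +i* y))).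

Arguments bdry : simpl never.

Section Fixed.
Variable g : C -> C.
Hypothesis hg : hol g.

Let ch y : ccont (fun x => g (x +i* y)).
Proof. exact: ccont_hol hg (ccont_horiz y). Qed.
Let cv x : ccont (fun y => g (x +i* y)).
Proof. exact: ccont_hol hg (ccont_vert x). Qed.

Lemma bdry_split x1 xm x2 y1 ym y2 : x1 <= xm -> xm <= x2 -> y1 <= ym -> ym <= y2 ->
  bdry g x1 x2 y1 y2 = bdry g x1 xm y1 ym + bdry g xm x2 y1 ym +
    bdry g x1 xm ym y2 + bdry g xm x2 ym y2.
Proof.
move=> h1 h2 h3 h4; rewrite /bdry.
rewrite (Cint_chasles (ch y1) h1 h2) (Cint_chasles (ch y2) h1 h2).
rewrite (Cint_chasles (cv x1) h3 h4) (Cint_chasles (cv x2) h3 h4).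
ring.
Qed.

(** The affine part of [g] at [z0] integrates to 0 along the boundary, and what
    remains is at most [e] times the size of the rectangle; integrating over a
    boundary of comparable length gives a bound quadratic in the size. *)
Lemma bdry_small z0 (e : R) : 0 < e -> exists2 d : R, 0 < d &
  forall x1 x2 y1 y2, x1 <= complex.Re z0 <= x2 -> y1 <= complex.Im z0 <= y2 ->
    x2 - x1 + (y2 - y1) < d ->
    nrm (bdry g x1 x2 y1 y2) <= 4 * e * (x2 - x1 + (y2 - y1)) ^+ 2.
Proof.
move=> e0; have [l dl] := hg z0; have [d d0 H] := dl _ e0.
exists d => // x1 x2 y1 y2 /andP[hx1 hx2] /andP[hy1 hy2] sd.
set s := x2 - x1 + (y2 - y1) in sd *.
have x12 : x1 <= x2 by lra.
have y12 : y1 <= y2 by lra.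
pose A z := g z0 + l * (z - z0); pose E z := g z - A z.
have hA : hol A.
  move=> z; exists (0 + l * (1 - 0)); apply: cderivD; first exact: cderiv_cst.
  by apply: cderivZ; apply: cderivB; [exact: cderiv_id|exact: cderiv_cst].
have Ah y : ccont (fun x => A (x +i* y)) by exact: ccont_hol hA (ccont_horiz y).
have Av x : ccont (fun y => A (x +i* y)) by exact: ccont_hol hA (ccont_vert x).
have Eh y : ccont (fun x => E (x +i* y)) by exact: ccontB.
have Ev x : ccont (fun y => E (x +i* y)) by exact: ccontB.
have A0 : bdry A x1 x2 y1 y2 = 0.
  rewrite /bdry -!CintB//.
  rewrite (@eq_Cint _ x1 x2 _ (fun=> l * ('i%C * (y1 - y2)%:C))); last first.
    move=> x _; rewrite /A [x +i* y1]complexE [x +i* y2]complexE /= rmorphB /=; ring.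
  rewrite (@eq_Cint _ y1 y2 _ (fun=> l * (x2 - x1)%:C)); last first.
    move=> y _; rewrite /A [x1 +i* y]complexE [x2 +i* y]complexE /= rmorphB /=; ring.
  rewrite !Cint_cst// !rmorphB /=; ring.
have gE : bdry g x1 x2 y1 y2 = bdry E x1 x2 y1 y2.
  rewrite -[RHS]addr0 -{1}A0 /bdry.
  rewrite (@eq_Cint _ x1 x2 (fun x => g (x +i* y1)) (fun x => E (x +i* y1) + A (x +i* y1))); last by move=> x _; rewrite /E subrK.
  rewrite (@eq_Cint _ x1 x2 (fun x => g (x +i* y2)) (fun x => E (x +i* y2) + A (x +i* y2))); last by move=> x _; rewrite /E subrK.
  rewrite (@eq_Cint _ y1 y2 (fun y => g (x1 +i* y)) (fun y => E (x1 +i* y) + A (x1 +i* y))); last by move=> x _; rewrite /E subrK.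
  rewrite (@eq_Cint _ y1 y2 (fun y => g (x2 +i* y)) (fun y => E (x2 +i* y) + A (x2 +i* y))); last by move=> x _; rewrite /E subrK.
  rewrite !(CintD _ _ (Eh _) (Ah _)) !(CintD _ _ (Ev _) (Av _)); ring.
have Ebd x y : x1 <= x <= x2 -> y1 <= y <= y2 -> nrm (E (x +i* y)) <= e * s.
  move=> /andP[hxa hxb] /andP[hya hyb].
  have ns : nrm (x +i* y - z0) <= s.
    apply: le_trans (nrm_leD _) _.
    case: z0 {H dl A E hA Ah Av Eh Ev A0 gE} hx1 hx2 hy1 hy2 => a b /= *.
    have : `|x - a| <= x2 - x1 by rewrite ler_norml; lra.
    have : `|y - b| <= y2 - y1 by rewrite ler_norml; lra.
    by rewrite /s; lra.
  have := H (x +i* y - z0) (le_lt_trans ns sd).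
  rewrite [z0 + _]addrC subrK => /[dup] _; rewrite /E /A.
  rewrite opprD addrA => /le_trans; apply.
  by rewrite ler_wpM2l// ltW.
rewrite gE /bdry.
apply: le_trans (nrmD _ _) _; rewrite nrmM nrmi mul1r.
apply: le_trans (lerD (nrm_sub _ _) (nrm_sub _ _)) _.
have := @Cint_le _ _ x1 x2 (e * s) (Eh y1) x12 (fun x hx => Ebd _ _ hx _).
have := @Cint_le _ _ x1 x2 (e * s) (Eh y2) x12 (fun x hx => Ebd _ _ hx _).
have := @Cint_le _ _ y1 y2 (e * s) (Ev x1) y12 (fun x hx => Ebd _ _ _ hx).
have := @Cint_le _ _ y1 y2 (e * s) (Ev x2) y12 (fun x hx => Ebd _ _ _ hx).
rewrite !lexx x12 y12 => /(_ isT) k1 /(_ isT) k2 /(_ isT) k3 /(_ isT) k4.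
rewrite (_ : 4 * e * s ^+ 2 = 4 * (e * s * (x2 - x1)) + 4 * (e * s * (y2 - y1))); last by rewrite /s; ring.
lra.
Qed.

End Fixed.

Lemma nested_intervals (a b : nat -> R) : (forall n, a n <= a n.+1) ->
  (forall n, b n.+1 <= b n) -> (forall n, a n <= b n) ->
  exists X, forall n, a n <= X <= b n.
Proof.
move=> aS bS ab.
have na : {homo a : m n / (m <= n)%N >-> m <= n} by apply/nondecreasing_seqP.
have nb : {homo b : m n / (m <= n)%N >-> n <= m} by apply/nonincreasing_seqP.
have amb m n : a m <= b n.
  apply: (@le_trans _ _ (a (maxn m n))); first by rewrite na// leq_maxl.
  by apply: (@le_trans _ _ (b (maxn m n))) => //; rewrite nb// leq_maxr.
have hs : has_sup (range a).
  by split; [exists (a 0%N), 0%N|exists (b 0%N) => _ [m _ <-]].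
exists (sup (range a)) => n; apply/andP; split.
  by apply: ub_le_sup; [case: hs|exists n].
by apply: ge_sup; [case: hs|move=> _ [m _ <-]].
Qed.

(** Bisection: one of the four quarters carries at least a quarter of the
    boundary integral. The nested rectangles so chosen shrink to a point, at
    which [bdry_small] beats the factor [4 ^ n]. *)
Theorem Goursat g x1 x2 y1 y2 : hol g -> x1 <= x2 -> y1 <= y2 -> bdry g x1 x2 y1 y2 = 0.
Proof.
move=> hg x12 y12.
pose w n := (x2 - x1) / 2 ^+ n; pose h n := (y2 - y1) / 2 ^+ n.
have w0 n : 0 <= w n by rewrite divr_ge0 ?subr_ge0 ?exprn_ge0.
have h0 n : 0 <= h n by rewrite divr_ge0 ?subr_ge0 ?exprn_ge0.
have wS n : w n = w n.+1 + w n.+1 by rewrite /w exprS; field; rewrite expf_neq0.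
have hS n : h n = h n.+1 + h n.+1 by rewrite /h exprS; field; rewrite expf_neq0.
pose I n (p : R * R) := nrm (bdry g p.1 (p.1 + w n) p.2 (p.2 + h n)).
have step n p : exists q : R * R, [/\ p.1 <= q.1 <= p.1 + w n.+1, p.2 <= q.2 <= p.2 + h n.+1 &
    I n p <= 4 * I n.+1 q].
  case: p => px py; apply: contrapT => no.
  have B qx qy : px <= qx <= px + w n.+1 -> py <= qy <= py + h n.+1 -> 4 * I n.+1 (qx, qy) < I n (px, py).
    by move=> ? ?; rewrite ltNge; apply/negP => ?; apply: no; exists (qx, qy).
  have xx : px <= px <= px + w n.+1 by have := w0 n.+1; lra.
  have xw : px <= px + w n.+1 <= px + w n.+1 by have := w0 n.+1; lra.
  have yy : py <= py <= py + h n.+1 by have := h0 n.+1; lra.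
  have yh : py <= py + h n.+1 <= py + h n.+1 by have := h0 n.+1; lra.
  have b1 := B _ _ xx yy; have b2 := B _ _ xw yy; have b3 := B _ _ xx yh; have b4 := B _ _ xw yh.
  have : I n (px, py) <= I n.+1 (px, py) + I n.+1 (px + w n.+1, py) +
     I n.+1 (px, py + h n.+1) + I n.+1 (px + w n.+1, py + h n.+1).
    rewrite [X in X <= _]/I /= (@bdry_split g hg px (px + w n.+1) _ py (py + h n.+1)).
    - rewrite (wS n) (hS n) [px + (_ + _)]addrA [py + (_ + _)]addrA /I /=.
      by do 3 (apply: le_trans (nrmD _ _) _; rewrite lerD2r).
    - by rewrite lerDl.
    - by rewrite (wS n) addrA lerDl.
    - by rewrite lerDl.
    - by rewrite (hS n) addrA lerDl.
  lra.
have [nx nxP] := choice (fun np : nat * (R * R) => step np.1 np.2).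
pose p := fix p n := if n is m.+1 then nx (m, p m) else (x1, y1).
have pP n : [/\ (p n).1 <= (p n.+1).1 <= (p n).1 + w n.+1,
    (p n).2 <= (p n.+1).2 <= (p n).2 + h n.+1 & I n (p n) <= 4 * I n.+1 (p n.+1)].
  exact: nxP (n, p n).
have [X XP] : exists X, forall n, (p n).1 <= X <= (p n).1 + w n.
  apply: nested_intervals => n; last by rewrite lerDl.
    by have [/andP[]] := pP n.
  by have [/andP[_ +] _ _] := pP n; rewrite (wS n); lra.
have [Y YP] : exists Y, forall n, (p n).2 <= Y <= (p n).2 + h n.
  apply: nested_intervals => n; last by rewrite lerDl.
    by have [_ /andP[]] := pP n.
  by have [_ /andP[_ +] _] := pP n; rewrite (hS n); lra.
have IP n : I 0%N (x1, y1) <= 4 ^+ n * I n (p n).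
  elim: n => [|n IH]; first by rewrite expr0 mul1r.
  have [_ _ k] := pP n; apply: le_trans IH _.
  by rewrite exprSr -mulrA ler_wpM2l// exprn_ge0.
set s := x2 - x1 + (y2 - y1).
have s0 : 0 <= s by rewrite /s; lra.
have I0 (e : R) : 0 < e -> I 0%N (x1, y1) <= 4 * e * s ^+ 2.
  move=> e0; have [d d0 H] := bdry_small hg (X +i* Y) e0.
  have [n sn] : exists n : nat, s / 2 ^+ n < d.
    exists (Num.bound (s / d)); rewrite ltr_pdivrMr ?exprn_gt0// mulrC -ltr_pdivrMr//.
    apply: lt_trans (_ : (Num.bound (s / d))%:R < _).
      by have := archi_boundP (divr_ge0 s0 (ltW d0)).
    by rewrite -natrX ltr_nat ltn_expl.
  have swh : (p n).1 + w n - (p n).1 + ((p n).2 + h n - (p n).2) = s / 2 ^+ n.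
    by rewrite /s mulrDl -/(w n) -/(h n); ring.
  have := H (p n).1 ((p n).1 + w n) (p n).2 ((p n).2 + h n) (XP n) (YP n).
  rewrite swh => /(_ sn) Hn; apply: le_trans (IP n) _.
  have : 4 ^+ n * I n (p n) <= 4 ^+ n * (4 * e * (s / 2 ^+ n) ^+ 2) by rewrite ler_wpM2l// exprn_ge0.
  move=> /le_trans; apply; rewrite le_eqVlt; apply/orP; left; apply/eqP.
  rewrite (_ : (4 : R) = 2 ^+ 2); last by ring.
  by rewrite expr_div_n -!exprM mulnC; field; rewrite expf_neq0.
have E : I 0%N (x1, y1) = nrm (bdry g x1 x2 y1 y2).
  by rewrite /I /w /h /= expr0 !divr1 !addrA ![_ + _ - _]addrAC !subrr !add0r.
apply/eqP; rewrite -nrm_eq0 -E; apply/eqP/le_anti/andP; split; last by rewrite E nrm_ge0.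
apply/ler_addgt0Pl => e e0; rewrite addr0.
have k0 : 0 < 4 * (s ^+ 2 + 1) by have := sqr_ge0 s; lra.
have [r r0 rE] : exists2 r, 0 < r & r * (4 * (s ^+ 2 + 1)) = e.
  by exists (e / (4 * (s ^+ 2 + 1))); rewrite ?divr_gt0// divfK// gt_eqF.
apply: le_trans (I0 _ r0) _; rewrite -rE; lra.
Qed.

End Goursat.

Lemma bdryE (R : realType) (g : R[i] -> R[i]) x1 x2 y1 y2 : bdry g x1 x2 y1 y2 =
  Cint x1 x2 (fun x => g (x +i* y1)) - Cint x1 x2 (fun x => g (x +i* y2)) +
  'i%C * (Cint y1 y2 (fun y => g (x2 +i* y)) - Cint y1 y2 (fun y => g (x1 +i* y))).
Proof. by []. Qed.

#[global] Opaque bdry.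

(** * Entire functions of exponential type *)

Section Cauchy.
Context {R : realType}.
Notation C := R[i].
Implicit Types (F G : C -> C) (z w h l b : C) (B : R).

Definition cis (v : R) : C := Cexp (0 +i* v).

Lemma nrm_cis v : nrm (cis v) = 1.
Proof. by rewrite /cis nrm_Cexp expR0. Qed.

Lemma hol_Cexp : hol (@Cexp R).
Proof. by move=> z; exists (Cexp z); exact: cderiv_Cexp. Qed.

Lemma hol_comp F G : hol F -> hol G -> hol (fun z => G (F z)).
Proof.
by move=> hF hG z; exists (cD G (F z) * cD F z); apply: cderiv_comp; exact: hol_cD.
Qed.

Lemma holD F G : hol F -> hol G -> hol (fun z => F z + G z).
Proof. by move=> hF hG z; exists (cD F z + cD G z); apply: cderivD; exact: hol_cD. Qed.

Lemma holB F G : hol F -> hol G -> hol (fun z => F z - G z).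
Proof. by move=> hF hG z; exists (cD F z - cD G z); apply: cderivB; exact: hol_cD. Qed.

Lemma holM F G : hol F -> hol G -> hol (fun z => F z * G z).
Proof. by move=> hF hG z; eexists; apply: cderivM; exact: hol_cD. Qed.

Lemma hol_cst c : hol (fun=> c : C).
Proof. by move=> z; exists 0; exact: cderiv_cst. Qed.

Lemma hol_id : hol (id : C -> C).
Proof. by move=> z; exists 1; exact: cderiv_id. Qed.

Lemma holN F : hol F -> hol (fun z => - F z).
Proof. by move=> hF z; exists (- cD F z); apply: cderivN; exact: hol_cD. Qed.

Lemma ccont_cis : ccont cis.
Proof. exact: ccont_hol hol_Cexp (ccont_vert 0). Qed.

(** Locked, since [pi] must not be unfolded during unification. *)
Definition tau : R := locked (2 * pi).

Lemma tauE : tau = 2 * pi.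
Proof. by rewrite /tau -lock. Qed.

Lemma avg_cst (T : R) z : 0 < T -> T%:C^-1 * Cint 0 T (fun=> z) = z.
Proof.
move=> T0; rewrite (Cint_cst _ (ltW T0)) subr0 mulKf//; apply: realC_neq0.
by rewrite gt_eqF.
Qed.

(** The Fourier coefficient of index 1 over the unit circle. *)
Definition circ (G : R -> C) : C :=
  tau%:C^-1 * Cint 0 tau (fun v => G v * cis (- v)).

Let pi2 : 0 < tau.
Proof. by rewrite tauE mulr_gt0// pi_gt0. Qed.

Lemma ccont_cisN : ccont (fun v => cis (- v)).
Proof.
apply: (ccont_hol hol_Cexp (f := fun v => 0 +i* (- v))).
by apply/ccontP; split => v /=; [exact: cvg_cst|apply: cvgN; exact: cvg_id].
Qed.

Lemma circ_le (G : R -> C) M : ccont G -> (forall v, nrm (G v) <= M) -> nrm (circ G) <= 2 * M.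
Proof.
move=> cG GM; rewrite /circ nrmM nrmV nrmC gtr0_norm// mulrC ler_pdivrMr//.
apply: le_trans (Cint_le (M := M) _ (ltW pi2) _) _.
- exact: ccontM cG ccont_cisN.
- by move=> v _; rewrite nrmM nrm_cis mulr1.
- by rewrite subr0 mulrA.
Qed.

Lemma circB (G1 G2 : R -> C) : ccont G1 -> ccont G2 -> circ (fun v => G1 v - G2 v) = circ G1 - circ G2.
Proof.
move=> c1 c2; rewrite /circ -mulrBr -CintB.
- by congr (_ * _); apply: eq_Cint => v _; rewrite mulrBl.
- exact: ccontM c1 ccont_cisN.
- exact: ccontM c2 ccont_cisN.
Qed.

Lemma circZ z (G : R -> C) : ccont G -> circ (fun v => z * G v) = z * circ G.
Proof.
move=> c1; rewrite /circ [RHS]mulrCA -(CintZ _ _ z).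
- by congr (_ * _); apply: eq_Cint => v _; rewrite mulrA.
- exact: ccontM c1 ccont_cisN.
Qed.

(** Goursat for [u |-> (F (z + e^u) - F z) e^(-u)] on the rectangle [x, 0] x [0, 2 pi]: by
    periodicity the horizontal edges cancel, so the mean over the vertical edge
    does not depend on [x], and it tends to [F' z] as [x] tends to [-oo]. *)
Theorem Cauchy_derivative F z : hol F -> cD F z = circ (fun v => F (z + cis v) - F z).
Proof.
move=> hF; pose g u := (F (z + Cexp u) - F z) * Cexp (- u).
have hg : hol g.
  apply: holM; last by apply: hol_comp hol_Cexp; apply: holN; exact: hol_id.
  apply: holB; last exact: hol_cst.
  by apply: hol_comp hF; apply: holD; [exact: hol_cst|exact: hol_Cexp].
have cg x : ccont (fun y => g (x +i* y)) by exact: ccont_hol hg (ccont_vert x).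
have J x : x <= 0 -> Cint 0 tau (fun y => g (0 +i* y)) = Cint 0 tau (fun y => g (x +i* y)).
  move=> x0; have := Goursat hg x0 (ltW pi2); rewrite bdryE.
  rewrite (@eq_Cint _ _ _ (fun x => g (x +i* tau)) (fun x => g (x +i* 0))); last first.
    move=> t _; rewrite /g !CexpN.
    suff -> : Cexp (t +i* tau) = Cexp (t +i* 0) by [].
    by rewrite !CexpE /= cos0 sin0 tauE [2 * pi]mulr_natl cos2pi sin2pi.
  by rewrite subrr add0r => /imul_eq0 /eqP; rewrite subr_eq0 => /eqP.
have E : circ (fun v => F (z + cis v) - F z) = tau%:C^-1 * Cint 0 tau (fun y => g (0 +i* y)).
  rewrite /circ; apply: f_equal; apply: eq_Cint => v _; rewrite /g /cis.
  suff -> : 0 +i* (- v) = - (0 +i* v) by [].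
  by apply: complexP => /=; rewrite ?oppr0.
apply/eqP; rewrite eq_sym -subr_eq0 -nrm_eq0; apply/eqP/le_anti; rewrite nrm_ge0 andbT.
apply/ler_addgt0Pl => e e0; rewrite addr0.
have e2 : 0 < e / 2 by rewrite divr_gt0.
have [d d0 H] := hol_cD z hF e2.
(* the abscissa is chosen so that its exponential is smaller than d *)
have x0 : - d^-1 <= 0 by rewrite oppr_le0 invr_ge0 ltW.
have xd : expR (- d^-1) < d.
  have k : d^-1 < expR d^-1.
    by apply: lt_le_trans (expR_ge1Dx (d^-1)); rewrite ltrDr ltr01.
  have k0 : 0 < expR d^-1 by exact: expR_gt0.
  by rewrite expRN -[ltRHS]invrK ltf_pV2 ?posrE ?invr_gt0.
rewrite E (J _ x0) {E}.
have -> : cD F z = tau%:C^-1 * Cint 0 tau (fun=> cD F z).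
  by rewrite avg_cst.
rewrite -mulrBr -CintB//; last exact: ccont_cst.
rewrite nrmM nrmV nrmC gtr0_norm// mulrC ler_pdivrMr//.
apply: le_trans (Cint_le (M := e / 2) _ (ltW pi2) _) _.
- by apply: ccontB => //; exact: ccont_cst.
- move=> y _; set c := Cexp (- d^-1 +i* y).
  have nc : nrm c = expR (- d^-1) by rewrite /c nrm_Cexp.
  have c0 : c != 0 by exact: Cexp_neq0.
  rewrite (_ : _ - _ = (F (z + c) - F z - cD F z * c) / c); last first.
    by rewrite /g CexpN -/c; field.
  rewrite nrmM nrmV ler_pdivrMr ?nrm_gt0//.
  by apply: H; rewrite nc.
- by rewrite subr0 le_eqVlt; apply/orP; left; apply/eqP; field.
Qed.

(** Entire functions bounded by [A exp (B |z|)], with the type [B] attained.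
    The bound is what replaces Cauchy estimates: through [Cauchy_derivative] it
    passes to the derivative with the same [B]. *)
Definition etype B F := hol F /\
  exists2 A : R, 0 <= A & forall z, nrm (F z) <= A * expR (B * nrm z).

Lemma etype_hol B F : etype B F -> hol F. Proof. by case. Qed.

Section Bounds.
Variables (B : R) (F : C -> C) (A : R).
Hypotheses (B0 : 0 <= B) (A0 : 0 <= A) (hF : hol F)
  (FA : forall z, nrm (F z) <= A * expR (B * nrm z)).

Let cF z : ccont (fun v => F (z + cis v)).
Proof. by apply: ccont_hol => //; apply: ccontD; [exact: ccont_cst|exact: ccont_cis]. Qed.

Let A1 := 4 * A * expR B.

Let A10 : 0 <= A1.
Proof. by rewrite /A1 !mulr_ge0// expR_ge0. Qed.

Lemma expR_shift z h (c : R) : nrm h <= c -> expR (B * nrm (z + h)) <= expR (B * (nrm z + c)).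
Proof.
by move=> hc; rewrite ler_expR ler_wpM2l//; apply: le_trans (nrmD _ _) _; rewrite lerD2l.
Qed.

Lemma cD_le z : nrm (cD F z) <= A1 * expR (B * nrm z).
Proof.
rewrite Cauchy_derivative//.
apply: le_trans (circ_le (M := 2 * (A * (expR B * expR (B * nrm z)))) _ _) _.
- by apply: ccontB => //; exact: ccont_cst.
- move=> v; apply: le_trans (nrm_sub _ _) _.
  have k1 : nrm (F (z + cis v)) <= A * (expR B * expR (B * nrm z)).
    apply: le_trans (FA _) _; rewrite ler_wpM2l//.
    apply: le_trans (@expR_shift _ _ 1 _) _; first by rewrite nrm_cis.
    by rewrite mulrDr mulr1 expRD mulrC.
  have k2 : nrm (F z) <= A * (expR B * expR (B * nrm z)).
    apply: le_trans (FA _) _; rewrite ler_wpM2l// ler_peMl ?expR_ge0//.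
    by rewrite -expR0 ler_expR.
  lra.
- by rewrite /A1; lra.
Qed.

Lemma F_lip z h : nrm (F (z + h) - F z) <= 2 * A1 * expR (B * (nrm z + nrm h)) * nrm h.
Proof.
rewrite -(mulrA 2); apply: (cderiv_mvi (F' := cD F)) => [w|t /andP[t0 t1]]; first exact: hol_cD.
apply: le_trans (cD_le _) _; rewrite ler_wpM2l//; apply: expR_shift.
by rewrite nrmM nrmC ger0_norm// ler_piMr ?nrm_ge0.
Qed.

Let A2 := 4 * A1 * expR B * 2.

Let A20 : 0 <= A2.
Proof. by rewrite /A2 !mulr_ge0// expR_ge0. Qed.

Lemma cD_lip z h : nrm (cD F (z + h) - cD F z) <= A2 * expR (B * (nrm z + nrm h)) * nrm h.
Proof.
have E w : ccont (fun v => F (w + cis v) - F w) by apply: ccontB => //; exact: ccont_cst.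
rewrite !Cauchy_derivative// -circB//.
set K : R := 2 * A1 * expR (B * (nrm z + nrm h)) * nrm h * expR B.
apply: le_trans (circ_le (M := K + K) _ _) _.
- exact: ccontB.
- move=> v; rewrite (_ : _ - _ = (F (z + cis v + h) - F (z + cis v)) - (F (z + h) - F z)); last first.
    by rewrite (addrAC z (cis v) h); ring.
  apply: le_trans (nrm_sub _ _) _; apply: lerD.
    apply: le_trans (F_lip _ _) _.
    have k : expR (B * (nrm (z + cis v) + nrm h)) <= expR (B * (nrm z + nrm h)) * expR B.
      rewrite -expRD ler_expR (_ : _ + B = B * (nrm z + nrm h + 1)); last by ring.
      rewrite ler_wpM2l//.
      by have := nrmD z (cis v); rewrite nrm_cis; lra.
    rewrite /K [leRHS]mulrAC ler_wpM2r ?nrm_ge0//.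
    by rewrite -[leRHS]mulrA ler_wpM2l ?mulr_ge0.
  apply: le_trans (F_lip _ _) _; rewrite /K ler_peMr// ?mulr_ge0// ?expR_ge0 ?nrm_ge0//.
  by rewrite -expR0 ler_expR.
- by rewrite /K /A2; lra.
Qed.

(** Second order Taylor estimate, from the mean value inequality applied to
    [F w - F' z w] and the Lipschitz bound on [F']. *)
Lemma F_quad z h : nrm (F (z + h) - F z - cD F z * h) <=
  2 * A2 * expR (B * (nrm z + nrm h)) * nrm h ^+ 2.
Proof.
pose G w := F w - cD F z * w.
have dG w : cderiv G w (cD F w - cD F z * 1).
  by apply: cderivB; [exact: hol_cD|apply: cderivZ; exact: cderiv_id].
have -> : F (z + h) - F z - cD F z * h = G (z + h) - G z by rewrite /G; ring.
apply: le_trans (cderiv_mvi (M := A2 * expR (B * (nrm z + nrm h)) * nrm h) dG _) _.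
  move=> t /andP[t0 t1]; rewrite mulr1; apply: le_trans (cD_lip _ _) _.
  have th : nrm (h * t%:C) <= nrm h by rewrite nrmM nrmC ger0_norm// ler_piMr ?nrm_ge0.
  apply: ler_pM => //; rewrite ?nrm_ge0 ?mulr_ge0 ?expR_ge0//.
  by rewrite ler_wpM2l// ler_expR ler_wpM2l// lerD2l.
lra.
Qed.

Lemma ccont_cD z : ccont (fun v => cD F (z + cis v)).
Proof.
apply: ccont_eps => x e e0.
set K : R := A2 * expR (B * (nrm (z + cis x) + 1)) + 1.
have K0 : 0 < K by rewrite /K ltr_wpDl// mulr_ge0// expR_ge0.
have m0 : 0 < Num.min 1 (e / K) by rewrite lt_min ltr01 divr_gt0.
have [d d0 Hd] := ccont_eps_inv x ccont_cis m0.
exists d => // y /Hd; rewrite le_min => /andP[h1 h2].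
have := cD_lip (z + cis x) (cis y - cis x).
rewrite (_ : z + cis x + (cis y - cis x) = z + cis y); last by ring.
move=> /le_trans; apply.
apply: (@le_trans _ _ (K * (e / K))); last by rewrite mulrC divfK// gt_eqF.
apply: ler_pM => //; rewrite ?nrm_ge0 ?mulr_ge0 ?expR_ge0//.
apply: (@le_trans _ _ (A2 * expR (B * (nrm (z + cis x) + 1)))); last by rewrite /K lerDl.
by rewrite ler_wpM2l// ler_expR ler_wpM2l// lerD2l.
Qed.

(** [F'] is an average of [F] over a circle, so it may be differentiated under
    the integral sign; [F_quad] makes the difference quotients uniform. *)
Lemma hol_cDF : hol (cD F).
Proof.
move=> z; exists (circ (fun v => cD F (z + cis v) - cD F z)) => e e0.
set K : R := 4 * (2 * A2 * expR (B * (nrm z + 2))) + 1.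
have K0 : 0 < K by rewrite /K ltr_wpDl// !mulr_ge0// expR_ge0.
exists (Num.min 1 (e / K)) => [|h]; first by rewrite lt_min ltr01 divr_gt0.
rewrite lt_min => /andP[h1 h2].
have E w : ccont (fun v => F (w + cis v) - F w) by apply: ccontB => //; exact: ccont_cst.
have E' w : ccont (fun v => cD F (w + cis v) - cD F w) by apply: ccontB; [exact: ccont_cD|exact: ccont_cst].
rewrite {1}(Cauchy_derivative _ hF) {1}(Cauchy_derivative _ hF) -circB//.
rewrite [_ * h]mulrC -circZ// -circB; [|exact: ccontB|exact: ccontM (ccont_cst h) (E' z)].
set M : R := 2 * A2 * expR (B * (nrm z + 2)) * nrm h ^+ 2.
have bd w : nrm w <= nrm z + 1 -> nrm (F (w + h) - F w - cD F w * h) <= M.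
  move=> wz; apply: le_trans (F_quad _ _) _.
  rewrite /M ler_wpM2r ?exprn_ge0 ?nrm_ge0// ler_wpM2l ?mulr_ge0//.
  by rewrite ler_expR ler_wpM2l//; lra.
apply: le_trans (circ_le (M := M + M) _ _) _.
- by apply: ccontB; [exact: ccontB|exact: ccontM (ccont_cst h) (E' z)].
- move=> v; rewrite (_ : _ - _ = (F (z + cis v + h) - F (z + cis v) - cD F (z + cis v) * h)
      - (F (z + h) - F z - cD F z * h)); last first.
    by rewrite (addrAC z (cis v) h); ring.
  apply: le_trans (nrm_sub _ _) _; apply: lerD; apply: bd.
    by apply: le_trans (nrmD _ _) _; rewrite nrm_cis.
  by rewrite lerDl.
- apply: (@le_trans _ _ (K * nrm h * nrm h)).
    rewrite (_ : 2 * (M + M) = 4 * (2 * A2 * expR (B * (nrm z + 2))) * nrm h * nrm h); last by rewrite /M; ring.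
    by rewrite !ler_wpM2r ?nrm_ge0// /K lerDl.
  rewrite ler_wpM2r ?nrm_ge0// mulrC -ler_pdivlMr// ltW//.
Qed.

End Bounds.

Lemma etype_cD B F : 0 <= B -> etype B F -> etype B (cD F).
Proof.
move=> B0 [hF [A A0 FA]]; split; first exact: hol_cDF FA.
exists (4 * A * expR B); first by rewrite !mulr_ge0// expR_ge0.
by move=> z; exact: cD_le.
Qed.

(** The divided difference, with its removable singularity filled in. *)
Definition dslope F b z : C := if z == b then cD F b else (F z - F b) / (z - b).

Lemma dslopeE F b z : (z - b) * dslope F b z = F z - F b.
Proof.
rewrite /dslope; case: eqVneq => [->|zb]; first by rewrite !subrr mul0r.
by rewrite mulrCA divff ?mulr1// subr_eq0.
Qed.

Lemma dslope_b F b : dslope F b b = cD F b.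
Proof. by rewrite /dslope eqxx. Qed.

(** At the base point the quotient is compared with the quadratic Taylor
    polynomial of [F], whose remainder is cubic by [F_quad] applied to [F']. *)
Lemma cderiv_dslope_b B F b : 0 <= B -> etype B F -> cderiv (dslope F b) b (cD (cD F) b / 2).
Proof.
move=> B0 eF; have [hF' [A A0 FA]] := etype_cD B0 eF; have hF := etype_hol eF.
pose G w := F w - cD F b * w - cD (cD F) b / 2 * ((w - b) * (w - b)).
have dG w : cderiv G w (cD F w - cD F b - cD (cD F) b * (w - b)).
  rewrite (_ : _ - _ - _ = cD F w - cD F b * 1 - cD (cD F) b / 2 * ((1 - 0) * (w - b) + (w - b) * (1 - 0))); last by field.
  apply: cderivB.
    by apply: cderivB; [exact: hol_cD|apply: cderivZ; exact: cderiv_id].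
  have dw : cderiv (fun u => u - b) w (1 - 0) by apply: cderivB; [exact: cderiv_id|exact: cderiv_cst].
  by apply: cderivZ; exact: cderivM.
set K : R := 2 * (4 * (4 * A * expR B) * expR B * 2) * expR (B * (nrm b + 1)).
have K0 : 0 <= K by rewrite /K !mulr_ge0// expR_ge0.
have GK h : nrm h <= 1 -> nrm (G (b + h) - G b) <= 2 * (K * nrm h ^+ 2) * nrm h.
  move=> h1; apply: (cderiv_mvi dG) => t /andP[t0 t1].
  have th : nrm (h * t%:C) <= nrm h by rewrite nrmM nrmC ger0_norm// ler_piMr ?nrm_ge0.
  rewrite [b + _ - b]addrC addKr; apply: le_trans (F_quad B0 A0 hF' FA _ _) _.
  apply: ler_pM; rewrite ?exprn_ge0 ?nrm_ge0 ?mulr_ge0 ?expR_ge0//.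
    by rewrite /K ler_wpM2l ?mulr_ge0 ?expR_ge0// ler_expR ler_wpM2l// lerD2l (le_trans th).
  by rewrite ler_pXn2r// nnegrE nrm_ge0.
move=> e e0.
have K20 : 0 < 2 * K + 1 by rewrite ltr_wpDl ?mulr_ge0.
exists (Num.min 1 (e / (2 * K + 1))) => [|h]; first by rewrite lt_min ltr01 divr_gt0.
rewrite lt_min => /andP[h1 h2].
have [->|h0] := eqVneq h 0; first by rewrite addr0 subrr mulr0 subr0 nrm0 mulr0.
rewrite dslope_b /dslope ifF; last by rewrite -subr_eq0 addrC addKr (negbTE h0).
rewrite (_ : _ - _ - _ = (G (b + h) - G b) / h); last by rewrite /G; field.
rewrite nrmM nrmV ler_pdivrMr ?nrm_gt0//; apply: le_trans (GK _ (ltW h1)) _.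
rewrite ler_wpM2r ?nrm_ge0// (_ : 2 * (K * _) = 2 * K * nrm h * nrm h); last by ring.
rewrite ler_wpM2r ?nrm_ge0//.
apply: (@le_trans _ _ ((2 * K + 1) * nrm h)); first by rewrite ler_wpM2r ?nrm_ge0// lerDl.
by rewrite mulrC -ler_pdivlMr// ltW.
Qed.

Lemma etype_dslope B F b : 0 <= B -> etype B F -> etype B (dslope F b).
Proof.
move=> B0 eF; have [hF [A A0 FA]] := eF; split.
  move=> z; have [->|zb] := eqVneq z b; first by eexists; exact: cderiv_dslope_b eF.
  have zb0 : z - b != 0 by rewrite subr_eq0.
  have n0 : 0 < nrm (z - b) by rewrite nrm_gt0.
  eexists; apply: (@cderiv_near _ (fun u => (F u - F b) * (u - b)^-1) _ _ _ (nrm (z - b))) => //; last first.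
    apply: cderivM; first by apply: cderivB; [exact: hol_cD|exact: cderiv_cst].
    apply: (cderiv_comp (F := fun u => u - b) (G := fun u => u^-1)); last exact: cderivV.
    by apply: cderivB; [exact: cderiv_id|exact: cderiv_cst].
  move=> h hz; rewrite /dslope ifF//; apply: contraTF hz => /eqP <-.
  by rewrite opprD addrA subrr sub0r nrmN ltxx.
pose A1 := 4 * A * expR B.
exists (2 * A1 * expR (B * (2 * nrm b))).
  by rewrite !mulr_ge0// expR_ge0.
move=> z.
have A10 : 0 <= A1 by rewrite /A1 !mulr_ge0// expR_ge0.
rewrite -mulrA -expRD -mulrDr /dslope; case: eqVneq => [->|zb].
  apply: le_trans (cD_le B0 A0 hF FA _) _; rewrite -/A1.
  apply: ler_pM; rewrite ?expR_ge0//; first by lra.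
  by rewrite ler_expR ler_wpM2l//; have := nrm_ge0 b; lra.
rewrite nrmM nrmV ler_pdivrMr ?nrm_gt0 ?subr_eq0//.
have := F_lip B0 A0 hF FA b (z - b); rewrite [b + _]addrC subrK => /le_trans; apply.
rewrite ler_wpM2r ?nrm_ge0// ler_wpM2l ?mulr_ge0// ?expR_ge0//.
by rewrite ler_expR ler_wpM2l//; have := nrm_sub z b; lra.
Qed.

End Cauchy.

(** * Real integrals over the line *)

Section RealInt.
Context {R : realType}.
Notation leb := (@lebesgue_measure R).
Implicit Types (f g r : R -> R).

Definition inv1x2 (x : R) : R := (1 + x ^+ 2)^-1.

Lemma inv1x2_gt0 x : 0 < inv1x2 x.
Proof. by rewrite invr_gt0 ltr_wpDr ?sqr_ge0. Qed.

Lemma inv1x2_cont : continuous inv1x2.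
Proof.
move=> x; apply: cvgV; first by rewrite gt_eqF// ltr_wpDr ?sqr_ge0.
by apply: cvgD; [exact: cvg_cst|exact: exprn_continuous].
Qed.

Lemma cont_measT r : continuous r -> measurable_fun setT (EFin \o r).
Proof. by move=> cr; apply/measurable_EFinP; exact: continuous_measurable_fun. Qed.

(** [1 / (1 + x^2)] is the dominating function used throughout. *)
Lemma integrable_inv1x2 : leb.-integrable setT (EFin \o inv1x2).
Proof.
apply/integrableP; split; first exact: cont_measT inv1x2_cont.
have -> : (\int[leb]_x `|(EFin \o inv1x2) x| = \int[leb]_x (inv1x2 x)%:E)%E.
  by apply: eq_integral => x _; rewrite /= ger0_norm// ltW// inv1x2_gt0.
rewrite ge0_symfun_integralT; [|by move=> x; rewrite ltW// inv1x2_gt0|exact: inv1x2_cont|].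
- rewrite -set_itvcy.
  by rewrite [X in (_ * X)%E]integral0y_oneDsqr -EFinM ltry.
- by move=> x; rewrite /inv1x2 /= sqrrN.
Qed.

Lemma dom_integrable f g : continuous f -> (forall x, `|f x| <= g x) ->
  leb.-integrable setT (EFin \o g) -> leb.-integrable setT (EFin \o f).
Proof.
move=> cf fg; apply: le_integrable => //; first exact: cont_measT.
by move=> x _; rewrite /= lee_fin; exact: le_trans (fg x) (ler_norm _).
Qed.

Let mN : measurable_fun setT (-%R : measurableTypeR R -> measurableTypeR R).
Proof. exact: continuous_measurable_fun opp_continuous. Qed.

Lemma integrable_opp f : continuous f -> leb.-integrable setT (EFin \o f) ->
  leb.-integrable setT (EFin \o (fun x => f (- x))).
Proof.
move=> cf /integrableP[_ fi]; apply/integrableP; split.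
  by apply: cont_measT => x; apply: continuous_comp; [exact: opp_continuous|exact: cf].
apply: le_lt_trans fi; rewrite le_eqVlt; apply/orP; left; apply/eqP.
have := @ge0_integral_pushforward _ _ (measurableTypeR R) (measurableTypeR R) R (-%R) mN leb
  setT (fun x => `|(EFin \o f) x|%E) measurableT _ _ => /=.
rewrite preimage_setT => <-.
- by apply: eq_measure_integral => A mA _; rewrite /= lebesgue_measureN.
- apply: (@cont_measT (fun x => `|f x|)) => x.
  by apply: continuous_comp; [exact: cf|exact: norm_continuous].
- by move=> x _; rewrite lee_fin.
Qed.

Lemma Rint_opp f : continuous f -> leb.-integrable setT (EFin \o f) ->
  \int[leb]_(x in `]-oo, 0[) f x = \int[leb]_(x in `]0, +oo[) f (- x).
Proof.
move=> cf intf; rewrite /Rintegral; congr fine.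
have P : (-%R : R -> R) @^-1` `]-oo, 0[%classic = `]0, +oo[%classic.
  by apply/seteqP; split => x /=; rewrite !in_itv /= andbT oppr_lt0.
rewrite -P.
have := @integral_pushforward _ _ (measurableTypeR R) (measurableTypeR R) R (-%R) mN leb
  `]-oo, 0[%classic (EFin \o f) (cont_measT cf) _ _.
move=> <-//.
- by apply: eq_measure_integral => A mA _; rewrite /= lebesgue_measureN.
- by rewrite P; apply: integrableS (integrable_opp cf intf).
Qed.

Lemma Rint_split0 f : leb.-integrable setT (EFin \o f) ->
  \int[leb]_x f x = \int[leb]_(x in `]0, +oo[) f x + \int[leb]_(x in `]-oo, 0[) f x.
Proof.
move=> intf.
have m0 : leb.-integrable `]-oo, +oo[%classic (EFin \o f) by rewrite set_itvNyy.
have := @Rintegral_itvB R f -oo%O +oo%O 0 m0 isT isT.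
rewrite set_itvNyy => /eqP; rewrite subr_eq => /eqP ->; congr (_ + _).
by rewrite Rintegral_itv_bndo_bndc//; exact: integrableS intf.
Qed.

End RealInt.

(** * Half-line integrals in logarithmic coordinates *)

Section LogLimit.
Context {R : realType}.
Notation leb := (@lebesgue_measure R).
Implicit Types (f g r : R -> R).

(** At [u = 16 n] the exponent [3 u / 2 - 4 n] of the regulator used for
    quadrants exceeds [u] by [4 n]. *)
Definition logrange (n : nat) : R := 16 * n%:R.

Lemma logrange_ge0 n : 0 <= logrange n.
Proof. by rewrite mulr_ge0. Qed.

Lemma exp_subst (G : R -> R) (a b : R) : a <= b -> (forall x, 0 < x -> {for x, continuous G}) ->
  \int[leb]_(x in `[expR a, expR b]) G x = \int[leb]_(u in `[a, b]) (G (expR u) * expR u).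
Proof.
move=> ab cG; rewrite /Rintegral; congr fine.
have dE : derive1 (@expR R) = expR by apply/funext => x; rewrite derive1E derive_val.
rewrite integration_by_substitution_increasing ?dE //.
- by move=> x y _ _; rewrite ltr_expR.
- by move=> x _; exact: continuous_expR.
- by apply/cvg_ex; exists (expR a); apply: cvg_at_right_filter; exact: continuous_expR.
- by apply/cvg_ex; exists (expR b); apply: cvg_at_left_filter; exact: continuous_expR.
- split.
  + by move=> x _; exact: derivable_expR.
  + by apply: cvg_at_right_filter; exact: continuous_expR.
  + by apply: cvg_at_left_filter; exact: continuous_expR.
- apply: continuous_in_subspaceT => x; rewrite inE /= in_itv /= => /andP[ax _].
  by apply: cG; apply: lt_le_trans ax; exact: expR_gt0.
Qed.

(** The substitution [x = e^u] together with dominated convergence for a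
    bounded sequence of cut-offs. *)
Lemma log_limit f (q : nat -> R -> R) (q0 : R) : continuous f ->
  leb.-integrable setT (EFin \o f) -> (forall n, continuous (q n)) ->
  (forall n u, `|q n u| <= 1) -> (forall u, q n u @[n --> \oo] --> q0) ->
  \int[leb]_(u in `[- logrange n, logrange n]) (f (expR u) * expR u * q n u) @[n --> \oo]
    --> q0 * \int[leb]_(x in `]0, +oo[) f x.
Proof.
move=> cf intf cq q1 qq0.
pose P n := `[expR (- logrange n), expR (logrange n)]%classic.
pose G n x := f x * q n (ln x).
have cG n x : 0 < x -> {for x, continuous (G n)}.
  move=> x0; apply: continuousM; first exact: cf.
  by apply: continuous_comp; [exact: continuous_ln|exact: cq].
have mD : measurable (`]0, +oo[%classic : set R) by [].
have intD : leb.-integrable `]0, +oo[ (EFin \o f) by apply: integrableS intf.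
have PD n : `]0, +oo[%classic `&` P n = P n.
  apply/setIidPr => x; rewrite /P /= !in_itv /= andbT => /andP[ax _].
  by apply: lt_le_trans ax; exact: expR_gt0.
have E n : \int[leb]_(u in `[- logrange n, logrange n]) (f (expR u) * expR u * q n u) =
    \int[leb]_(x in `]0, +oo[) (G n \_ (P n)) x.
  rewrite -Rintegral_mkcondr PD /P exp_subst; last exact: cG.
    by apply: eq_Rintegral => u _; rewrite /G expRK mulrAC.
  by have := logrange_ge0 n; lra.
under eq_fun do rewrite E.
rewrite -RintegralZl; [|exact: measurable_itv|exact: intD].
have mfn n : measurable_fun (`]0, +oo[%classic : set R) (fun x : R => ((G n \_ (P n)) x)%:E).
  apply/measurable_EFinP.
  have mP : measurable (P n : set R) by exact: measurable_itv.
  apply: (measurable_restrict (G n) mP mD).1.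
  rewrite PD.
  apply: (@measurable_funS _ _ _ _ (`]0, +oo[%classic : set R)) => //.
    by rewrite -(PD n); exact: subIsetl.
  apply: open_continuous_measurable_fun; first exact: interval_open.
  by move=> x; rewrite inE /= in_itv /= andbT; exact: cG.
have [] := @dominated_convergence _ _ _ leb (`]0, +oo[%classic : set R) mD
  (fun n x => ((G n \_ (P n)) x)%:E) (fun x => (q0 * f x)%:E) (fun x => `|f x|%:E) mfn.
- by apply/measurable_EFinP; apply: measurable_funTS; apply: continuous_measurable_fun => x;
    apply: cvgM; [exact: cvg_cst|exact: cf].
- apply: aeW => x; rewrite /= in_itv /= andbT => x0.
  apply: cvg_EFin; first by near=> n.
  rewrite mulrC.
  have [N hN] : exists N : nat, `|ln x| <= N%:R.
    by exists (Num.bound `|ln x|); rewrite ltW// archi_boundP.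
  have : f x * q n (ln x) @[n --> \oo] --> f x * q0 by apply: cvgM; [exact: cvg_cst|exact: qq0].
  apply: cvg_trans; apply: near_eq_cvg; near=> n => /=.
  have Nn : (N <= n)%N by near: n; exists N.
  rewrite patchE mem_set // /P /= in_itv /= -[x in _ <= x <= _]lnK ?posrE// !ler_expR -ler_norml.
  apply: le_trans hN _; rewrite /logrange -natrM ler_nat.
  by rewrite (leq_trans Nn)// leq_pmull.
- exact: (integrable_norm intD).
- apply: aeW => x n _; rewrite lee_fin patchE; case: ifP => _; last by rewrite normr0.
  by rewrite normrM ler_piMr.
move=> intq _; rewrite -[X in _ --> X -> _]fineK; last exact: integrable_fin_num intq.
by move=> /fine_cvg; rewrite /Rintegral; apply.
Unshelve. all: end_near. Qed.

End LogLimit.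

(** * Complex integrals over the line *)

Section ComplexInt.
Context {R : realType}.
Notation C := R[i].
Notation leb := (@lebesgue_measure R).
Implicit Types (f : R -> C) (z : C).

(** Continuity and a dominating function rather than integrability of each
    component: both are stable under products with bounded functions and under
    passage to the limit. *)
Definition L1c f := ccont f /\
  exists2 g : R -> R, leb.-integrable setT (EFin \o g) & forall x, nrm (f x) <= g x.

(** [CL] integrates over the line, [CP] over the positive half line. *)
Definition CL f : C := Cintegral leb f.
Definition CP f : C := (\int[leb]_(x in `]0, +oo[) complex.Re (f x)) +i*
  (\int[leb]_(x in `]0, +oo[) complex.Im (f x)).

Lemma L1c_ccont f : L1c f -> ccont f. Proof. by case. Qed.

Lemma L1c_Re f : L1c f -> leb.-integrable setT (EFin \o (fun x => complex.Re (f x))).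
Proof.
move=> [/ccontP[c1 _] [g ig fg]]; apply: (dom_integrable (g := g)) => // x.
exact: le_trans (Re_le_nrm _) (fg x).
Qed.

Lemma L1c_Im f : L1c f -> leb.-integrable setT (EFin \o (fun x => complex.Im (f x))).
Proof.
move=> [/ccontP[_ c2] [g ig fg]]; apply: (dom_integrable (g := g)) => // x.
exact: le_trans (Im_le_nrm _) (fg x).
Qed.

Lemma cReD (z w : C) : complex.Re (z + w) = complex.Re z + complex.Re w.
Proof. by case: z w => ? ? []. Qed.
Lemma cImD (z w : C) : complex.Im (z + w) = complex.Im z + complex.Im w.
Proof. by case: z w => ? ? []. Qed.
Lemma cReM (z w : C) : complex.Re (z * w) = complex.Re z * complex.Re w - complex.Im z * complex.Im w.
Proof. by case: z w => ? ? []. Qed.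
Lemma cImM (z w : C) : complex.Im (z * w) = complex.Re z * complex.Im w + complex.Im z * complex.Re w.
Proof. by case: z w => ? ? []. Qed.

Lemma CLD f1 f2 : L1c f1 -> L1c f2 -> CL (fun x => f1 x + f2 x) = CL f1 + CL f2.
Proof.
move=> h1 h2; apply: complexP; rewrite /CL /Cintegral /=.
- rewrite -RintegralD; [|exact: measurableT|exact: L1c_Re|exact: L1c_Re].
  by apply: eq_Rintegral => x _; rewrite cReD.
- rewrite -RintegralD; [|exact: measurableT|exact: L1c_Im|exact: L1c_Im].
  by apply: eq_Rintegral => x _; rewrite cImD.
Qed.

Lemma CLZ z f : L1c f -> CL (fun x => z * f x) = z * CL f.
Proof.
move=> h; have hr := L1c_Re h; have hi := L1c_Im h.
have Zi (c : R) (k : R -> R) : leb.-integrable setT (EFin \o k) -> leb.-integrable setT (EFin \o (fun x => c * k x)).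
  by move=> ik; have := integrableZl measurableT c ik; apply: eq_integrable.
apply: complexP; rewrite /CL /Cintegral /= ?cReM ?cImM /=.
- rewrite -!RintegralZl; [|exact: measurableT|exact: hi|exact: measurableT|exact: hr].
  rewrite -RintegralB; [|exact: measurableT|exact: Zi|exact: Zi].
  by apply: eq_Rintegral => x _; rewrite cReM.
- rewrite -!RintegralZl; [|exact: measurableT|exact: hr|exact: measurableT|exact: hi].
  rewrite -RintegralD; [|exact: measurableT|exact: Zi|exact: Zi].
  by apply: eq_Rintegral => x _; rewrite cImM.
Qed.

Lemma eq_CL f1 f2 : (forall x, f1 x = f2 x) -> CL f1 = CL f2.
Proof. by move=> /funext ->. Qed.

Lemma CL_split f : L1c f -> CL f = CP f + CP (fun x => f (- x)).
Proof.
move=> h; have hr := L1c_Re h; have hi := L1c_Im h.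
have [/ccontP[c1 c2] _] := h.
by apply: complexP; rewrite /CL /CP /Cintegral ?cReD ?cImD /= Rint_split0// Rint_opp.
Qed.

Lemma L1cD f1 f2 : L1c f1 -> L1c f2 -> L1c (fun x => f1 x + f2 x).
Proof.
move=> [c1 [g1 i1 b1]] [c2 [g2 i2 b2]]; split; first exact: ccontD.
exists (fun x => g1 x + g2 x); last first.
  by move=> x; apply: le_trans (nrmD _ _) _; rewrite lerD.
by have := integrableD measurableT i1 i2; apply: eq_integrable.
Qed.

Lemma L1c_dom f (k : R) (g : R -> R) : ccont f -> leb.-integrable setT (EFin \o g) ->
  (forall x, nrm (f x) <= k * g x) -> L1c f.
Proof.
move=> cf ig fg; split=> //; exists (fun x => k * g x) => //.
by have := integrableZl measurableT k ig; apply: eq_integrable.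
Qed.

Lemma L1cM f1 f2 (k : R) : L1c f1 -> ccont f2 -> (forall x, nrm (f2 x) <= k) ->
  L1c (fun x => f2 x * f1 x).
Proof.
move=> [c1 [g1 i1 b1]] c2 b2; apply: (@L1c_dom _ k g1) => //; first exact: ccontM.
by move=> x; rewrite nrmM; apply: ler_pM; rewrite ?nrm_ge0.
Qed.

Lemma L1cZ z f : L1c f -> L1c (fun x => z * f x).
Proof. by move=> h; apply: (L1cM (k := nrm z)) h _ _ => //; exact: ccont_cst. Qed.

Lemma L1c_opp f : L1c f -> L1c (fun x => f (- x)).
Proof.
move=> [c [g i b]]; have /ccontP[c1 c2] := c.
have cn : ccont (fun x => f (- x)).
  have k (r : R -> R) : continuous r -> continuous (fun x => r (- x)).
    by move=> cr x; apply: continuous_comp; [exact: opp_continuous|exact: cr].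
  by apply/ccontP; split; [exact: (k _ c1)|exact: (k _ c2)].
have cnn : continuous (fun x => nrm (f x)).
  move=> x; apply/cvgrPdist_le => e e0; have [d d0 H] := ccont_eps_inv x c e0.
  near=> y; have /H : `|x - y| < d by near: y; exact: (@cvgr_dist_lt _ _ _ _ _ id).
  apply: le_trans; rewrite ler_norml; apply/andP; split.
    have := nrmD (f x) (f y - f x); rewrite [f x + _]addrC subrK; lra.
  have := nrmD (f y) (f x - f y); rewrite [f y + _]addrC subrK nrmB; lra.
have in1 : leb.-integrable setT (EFin \o (fun x => nrm (f x))).
  by apply: (dom_integrable (g := g)) => // x; rewrite ger0_norm ?nrm_ge0.
split=> //; exists (fun x => nrm (f (- x))) => //.
exact: (integrable_opp cnn in1).
Unshelve. all: end_near. Qed.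

Definition ctends (s : nat -> C) (l : C) :=
  (complex.Re (s n) @[n --> \oo] --> complex.Re l) /\ (complex.Im (s n) @[n --> \oo] --> complex.Im l).

Lemma ctendsD s1 s2 l1 l2 : ctends s1 l1 -> ctends s2 l2 -> ctends (fun n => s1 n + s2 n) (l1 + l2).
Proof.
move=> [a1 b1] [a2 b2]; split.
- by under eq_fun do rewrite cReD; rewrite cReD; exact: cvgD.
- by under eq_fun do rewrite cImD; rewrite cImD; exact: cvgD.
Qed.

(** The form in which contour estimates are used: a sequence tending to [l] and
    bounded by a null sequence has [l = 0]. *)
Lemma ctends_eq0 s (l : C) (e : nat -> R) N : ctends s l -> (forall n, (N <= n)%N -> nrm (s n) <= e n) ->
  e n @[n --> \oo] --> 0 -> l = 0.
Proof.
move=> [a b] se e0.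
have key (r : nat -> R) x : r n @[n --> \oo] --> x -> (forall n, (N <= n)%N -> `|r n| <= e n) -> x = 0.
  move=> rx re; have r0 : r n @[n --> \oo] --> 0.
    apply/norm_cvg0P/(squeeze_cvgr _ (cvg_cst 0) e0); near=> n.
    by rewrite normr_ge0 /= re//; near: n; exists N.
  by have := cvg_unique _ rx r0; apply.
by apply: complexP; [apply: key a _|apply: key b _] => n /se; apply: le_trans;
  [exact: Re_le_nrm|exact: Im_le_nrm].
Unshelve. all: end_near. Qed.

Lemma clog_limit f (q : nat -> R -> C) : L1c f -> (forall n, ccont (q n)) ->
  (forall n u, nrm (q n u) <= 1) -> (forall u, ctends (fun n => q n u) 1) ->
  ctends (fun n => Cint (- logrange n) (logrange n) (fun u => f (expR u) * (expR u)%:C * q n u)) (CP f).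
Proof.
move=> hf cq q1 qt; have hr := L1c_Re hf; have hi := L1c_Im hf.
have [/ccontP[c1 c2] _] := hf.
have r1 n : continuous (fun u => complex.Re (q n u)) by have /ccontP[] := cq n.
have r2 n : continuous (fun u => complex.Im (q n u)) by have /ccontP[] := cq n.
have b1 n u : `|complex.Re (q n u)| <= 1 by exact: le_trans (Re_le_nrm _) (q1 n u).
have b2 n u : `|complex.Im (q n u)| <= 1 by exact: le_trans (Im_le_nrm _) (q1 n u).
have l1 u : complex.Re (q n u) @[n --> \oo] --> (1 : R) by have [] := qt u.
have l2 u : complex.Im (q n u) @[n --> \oo] --> (0 : R) by have [] := qt u.
have cM (a b : R -> R) : continuous a -> continuous b -> continuous (fun x => a x * b x).
  by move=> ca cb x; apply: cvgM; [exact: ca|exact: cb].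
have cE (a : R -> R) : continuous a -> continuous (fun x => a (expR x)).
  by move=> ca x; apply: continuous_comp; [exact: continuous_expR|exact: ca].
have ci n (a b : R -> R) : continuous a -> continuous b ->
    leb.-integrable `[- logrange n, logrange n] (EFin \o (fun u => a (expR u) * expR u * b u)).
  move=> ca cb; apply: cont_int; apply: (cM _ _ _ cb).
  by apply: cM; [exact: cE|exact: continuous_expR].
have A := log_limit c1 hr r1 b1 l1; have B := log_limit c2 hi r2 b2 l2.
have A' := log_limit c1 hr r2 b2 l2; have B' := log_limit c2 hi r1 b1 l1.
have eqc (s t : nat -> R) (l : R) : (forall n, s n = t n) -> t n @[n --> \oo] --> l -> s n @[n --> \oo] --> l.
  by move=> /funext ->.
split.
- have := cvgB A B; rewrite mul1r mul0r subr0; move=> H; apply: (eqc _ _ _ _ (H _)) => n {H}.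
  rewrite CintE /= -RintegralB; [|exact: measurable_itv|exact: (ci n _ _ c1 (r1 n))|exact: (ci n _ _ c2 (r2 n))].
  by apply: eq_Rintegral => u _; rewrite !(cReM, cImM) /=; ring.
- have := cvgD A' B'; rewrite mul1r mul0r add0r; move=> H; apply: (eqc _ _ _ _ (H _)) => n {H}.
  rewrite CintE /= -RintegralD; [|exact: measurable_itv|exact: (ci n _ _ c1 (r2 n))|exact: (ci n _ _ c2 (r1 n))].
  by apply: eq_Rintegral => u _; rewrite !(cReM, cImM) /=; ring.
Qed.

End ComplexInt.
Lemma CLE (R : realType) (f : R -> R[i]) : CL f = Cintegral (@lebesgue_measure R) f.
Proof. by []. Qed.

#[global] Opaque CL CP.

(** * The first quadrant *)

Section Quadrant.
Context {R : realType}.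
Notation C := R[i].
Implicit Types (G : C -> C) (z : C) (u v : R).

(** Locked for the same reason as [tau]. *)
Definition eighth : R := locked (pi / 8).

Lemma eighthE : pi = 8 * eighth.
Proof. by rewrite /eighth -lock mulrCA divff ?mulr1// pnatr_eq0. Qed.

Lemma eighth_gt0 : 0 < eighth.
Proof. by have := pi_gt0 R; rewrite eighthE pmulr_rgt0. Qed.

Lemma cos4 : cos (4 * eighth) = 0.
Proof.
rewrite (_ : 4 * eighth = pi / 2) ?cos_pihalf// eighthE.
by rewrite [8 * eighth]mulrC -mulrA [eighth * _]mulrC; congr (_ * _); field.
Qed.

Lemma sin4 : sin (4 * eighth) = 1.
Proof.
rewrite (_ : 4 * eighth = pi / 2) ?sin_pihalf// eighthE.
by rewrite [8 * eighth]mulrC -mulrA [eighth * _]mulrC; congr (_ * _); field.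
Qed.

Lemma cos3_gt0 : 0 < cos (3 * eighth).
Proof.
have e0 := eighth_gt0.
by apply: cos_gt0_pihalf; rewrite eighthE; move: eighth e0 => e e0; lra.
Qed.

Lemma cos3_le t : - (3 * eighth) <= t <= 3 * eighth -> cos (3 * eighth) <= cos t.
Proof.
have e0 := eighth_gt0.
have key s : 0 <= s <= 3 * eighth -> cos (3 * eighth) <= cos s.
  move=> /andP[s0 s3]; rewrite leNgt; apply/negP; rewrite ltr_cos.
  - by rewrite ltNge s3.
  - by rewrite in_itv /= eighthE; move: eighth e0 s3 => e e0 s3; lra.
  - by rewrite in_itv /= eighthE; move: eighth e0 s3 => e e0 s3; lra.
have [t0|t0] := leP 0 t; first by move=> /andP[_ h]; apply: key; rewrite t0.
move=> /andP[h _]; rewrite -(cosN t); apply: key.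
by rewrite oppr_ge0 ltW//= lerNl.
Qed.

(** In the coordinate [zeta = u + i v] of the quadrant [0 <= v <= pi / 2] the
    function [exp (- delta exp (3 zeta / 2 - 3 pi i / 8))], [delta = e^(-4 n)],
    decays faster than any [exp (- B e^u)], because [3 / 2 v - 3 pi / 8] stays
    between [- 3 pi / 8] and [3 pi / 8], where the cosine is positive. [regul s n] is its
    restriction to the horizontal line with [3 / 2 v - 3 pi / 8 = s]. *)
Definition regul (s : R) (n : nat) u : C :=
  Cexp (- Cexp ((3 / 2 * u - 4 * n%:R) +i* s)).

Let th3 := 3 * eighth.
Let c := cos th3.

Lemma nrm_regul (s : R) n u : - th3 <= s <= th3 ->
  nrm (regul s n u) <= expR (- (c * expR (3 / 2 * u - 4 * n%:R))).
Proof.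
move=> sth; rewrite /regul nrm_Cexp ler_expR.
have -> (z : C) : complex.Re (- z) = - complex.Re z by case: z.
rewrite lerN2 CexpE cReM /= mul0r subr0 mulrC ler_wpM2l ?expR_ge0//.
exact: cos3_le.
Qed.

Lemma nrm_regul1 (s : R) n u : - th3 <= s <= th3 -> nrm (regul s n u) <= 1.
Proof.
move=> /nrm_regul /le_trans; apply; rewrite -expR0 ler_expR oppr_le0.
by rewrite mulr_ge0 ?expR_ge0// ltW// cos3_gt0.
Qed.

(** The regularised integrals of [G] over the two edges of the first quadrant,
    written in logarithmic coordinates. *)
Definition quad G n : C :=
  Cint (- logrange n) (logrange n) (fun u => G (expR u)%:C * (expR u)%:C * regul (- th3) n u) -
  Cint (- logrange n) (logrange n) (fun u => G ('i%C * (expR u)%:C) * ('i%C * (expR u)%:C) * regul th3 n u).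

Lemma Cexp_real u : Cexp (u +i* 0) = (expR u)%:C :> C.
Proof. by rewrite CexpE /= cos0 sin0; apply: complexP; rewrite /=; ring. Qed.

Lemma Cexp_imag u : Cexp (u +i* (4 * eighth)) = 'i%C * (expR u)%:C :> C.
Proof. by rewrite CexpE /= cos4 sin4; apply: complexP; rewrite /=; ring. Qed.

(** Goursat on the rectangle [- 16 n, 16 n] x [0, pi / 2] turns the difference of the
    horizontal edges into the vertical ones. On the right edge the regulator
    beats the exponential growth of [G]; on the left edge the Jacobian [e^u]
    is tiny. *)
Lemma quad_bound B G : 0 <= B -> etype B G -> exists K : R, exists N : nat,
  forall n, (N <= n)%N -> nrm (quad G n) <= K * expR (- n%:R).
Proof.
move=> B0 [hG [A A0 GA]].
have e0 := eighth_gt0.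
have c0 : 0 < c by exact: cos3_gt0.
have aux (b x z : R) : (b + 2) * x <= z -> b * x - z <= - (2 * x) by lra.
pose W (n : nat) z := (3 / 2)%:C * z + (- (4 * n%:R)) +i* (- th3).
pose g n z := G (Cexp z) * Cexp z * Cexp (- Cexp (W n z)).
have hW n : hol (W n).
  by apply: holD; [apply: holM; [exact: hol_cst|exact: hol_id]|exact: hol_cst].
have hg n : hol (g n).
  apply: holM; first by apply: holM; [exact: hol_comp hol_Cexp hG|exact: hol_Cexp].
  by apply: hol_comp hol_Cexp; apply: holN; apply: hol_comp hol_Cexp; exact: hW.
have WE n u v : W n (u +i* v) = (3 / 2 * u - 4 * n%:R) +i* (3 / 2 * v - th3).
  by apply: complexP; rewrite /W /=; ring.
have gE n u v : 0 <= v <= 4 * eighth ->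
   nrm (g n (u +i* v)) <= A * expR (B * expR u) * expR u * expR (- (c * expR (3 / 2 * u - 4 * n%:R))).
  move=> /andP[v0 v4]; rewrite /g WE nrmM nrmM -/(regul (3 / 2 * v - th3) n u).
  have nu : nrm (Cexp (u +i* v)) = expR u by rewrite nrm_Cexp.
  rewrite nu; apply: ler_pM; rewrite ?mulr_ge0 ?nrm_ge0 ?expR_ge0//.
    by rewrite ler_wpM2r ?expR_ge0// -nu.
  by apply: nrm_regul; rewrite /th3; lra.
have qE n : quad G n = - ('i%C * (Cint 0 (4 * eighth) (fun y => g n (logrange n +i* y)) -
     Cint 0 (4 * eighth) (fun y => g n (- logrange n +i* y)))).
  have L0 : - logrange n <= logrange n :> R by have := @logrange_ge0 R n; lra.
  have e40 : 0 <= 4 * eighth by lra.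
  have := Goursat (hg n) L0 e40; rewrite bdryE => /eqP; rewrite addr_eq0 => /eqP <-.
  by congr (_ - _); apply: eq_Cint => u _; rewrite /g WE ?Cexp_real ?Cexp_imag /regul;
    congr (_ * Cexp (- Cexp (_ +i* _))); rewrite /th3; field.
have [N N0] : exists N : nat, B + 2 <= c * (1 + 4 * N%:R).
  exists (Num.bound ((B + 2) / c)).
  have := archi_boundP (divr_ge0 (addr_ge0 B0 (ler0n _ 2)) (ltW c0)).
  rewrite ltr_pdivrMr// mulrC => /ltW /le_trans; apply; rewrite ler_wpM2l ?ltW//.
  set m := _%:R; have : 0 <= m :> R by rewrite ler0n.
  lra.
pose K := 2 * (A * (4 * eighth)) + 2 * (A * expR B * (4 * eighth)).
exists K, N => n Nn.
have cg x : ccont (fun y => g n (x +i* y)) by exact: ccont_hol (hg n) (ccont_vert x).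
have e40 : 0 <= 4 * eighth by lra.
have right := @Cint_le R (fun y => g n (logrange n +i* y)) 0 (4 * eighth) (A * expR (- n%:R)) (cg _) e40.
have left := @Cint_le R (fun y => g n (- logrange n +i* y)) 0 (4 * eighth) (A * expR B * expR (- n%:R)) (cg _) e40.
rewrite qE nrmN nrmM nrmi mul1r; apply: le_trans (nrm_sub _ _) _.
have {}right := right (fun y hy => le_trans (gE n _ y hy) _).
have {}left := left (fun y hy => le_trans (gE n _ y hy) _).
apply: le_trans (lerD (right _) (left _)) _; last by rewrite /K; lra.
- set X := expR (logrange n).
  rewrite (_ : expR (3 / 2 * logrange n - 4 * n%:R) = expR (4 * n%:R) * X); last first.
    by rewrite /X -expRD /logrange; congr expR; field.
  have X1 : 1 + 16 * n%:R <= X by rewrite /X /logrange; exact: expR_ge1Dx.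
  have X0 : 0 < X by exact: expR_gt0.
  have cn : B + 2 <= c * expR (4 * n%:R).
    apply: le_trans N0 _; rewrite ler_wpM2l ?(ltW c0)//; apply: le_trans _ (expR_ge1Dx _).
    by rewrite lerD2l ler_wpM2l// ler_nat.
  rewrite -!mulrA ler_wpM2l// mulrCA -expRD.
  apply: (@le_trans _ _ (expR X * expR (- (2 * X)))).
    apply: ler_pM; rewrite ?expR_ge0 ?(ltW X0)//.
      by apply: le_trans _ (expR_ge1Dx X); rewrite lerDr.
    rewrite ler_expR.
    have : (B + 2) * X <= c * expR (4 * n%:R) * X by rewrite ler_wpM2r// ltW.
    rewrite [c * (_ * _)]mulrA; exact: aux.
  by rewrite -expRD ler_expR; have : 0 <= n%:R :> R; [rewrite ler0n|lra].
- set X := expR (- logrange n).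
  have X1 : X <= 1 by rewrite /X -expR0 ler_expR oppr_le0 logrange_ge0.
  rewrite -[leRHS]mulr1; apply: ler_pM; rewrite ?mulr_ge0 ?expR_ge0//.
    apply: ler_pM; rewrite ?mulr_ge0 ?expR_ge0//.
      by rewrite ler_wpM2l// ler_expR ler_piMr.
    rewrite /X ler_expR /logrange; have : 0 <= n%:R :> R by rewrite ler0n.
    lra.
  by rewrite -expR0 ler_expR oppr_le0 mulr_ge0 ?expR_ge0// ltW.
Qed.

End Quadrant.

(** * Cauchy's theorem for the half plane *)

Section HalfPlane.
Context {R : realType}.
Notation C := R[i].
Implicit Types (G : C -> C) (z : C) (u v : R).

Lemma regul_cvg (s u : R) : ctends (fun n => regul s n u) 1.
Proof.
have a0 : expR (3 / 2 * u - 4 * n%:R) @[n --> \oo] --> (0 : R).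
  apply: (squeeze_cvgr _ (cvg_cst 0) (h := fun n => expR (3 / 2 * u) * expR (- n%:R))).
    near=> n; rewrite expR_ge0 /= -expRD ler_expR lerD2l lerN2.
    by have : 0 <= n%:R :> R; [rewrite ler0n|lra].
  by rewrite -[X in _ --> X](mulr0 (expR (3 / 2 * u))); apply: cvgM; [exact: cvg_cst|exact: cvgn_expR].
pose f1 (a : R) := expR (- (a * cos s)) * cos (- (a * sin s)).
pose f2 (a : R) := expR (- (a * cos s)) * sin (- (a * sin s)).
have E n : regul s n u = f1 (expR (3 / 2 * u - 4 * n%:R)) +i* f2 (expR (3 / 2 * u - 4 * n%:R)).
  rewrite /regul [in X in - X]CexpE /= CexpE /f1 /f2.
  by apply: complexP => /=; rewrite !mul0r !subr0 !addr0.
have lin k : continuous (fun a : R => - (a * k)).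
  by move=> a; apply: cvgN; apply: cvgM; [exact: cvg_id|exact: cvg_cst].
have c1 : continuous f1.
  move=> a; apply: cvgM; (apply: continuous_comp; first exact: lin).
    exact: continuous_expR.
  exact: continuous_cos.
have c2 : continuous f2.
  move=> a; apply: cvgM; (apply: continuous_comp; first exact: lin).
    exact: continuous_expR.
  exact: continuous_sin.
have f10 : f1 0 = 1 by rewrite /f1 !mul0r oppr0 expR0 cos0 mulr1.
have f20 : f2 0 = 0 by rewrite /f2 !mul0r oppr0 expR0 sin0 mulr0.
have L1 := cvg_comp _ _ a0 (c1 0); have L2 := cvg_comp _ _ a0 (c2 0).
rewrite f10 in L1; rewrite f20 in L2.
split.
- by under eq_fun do rewrite E.
- by under eq_fun do rewrite E.
Unshelve. all: end_near. Qed.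

Lemma ccont_regul (s : R) n : ccont (regul s n).
Proof.
apply: (ccont_hol (g := fun z => Cexp (- z))).
  by apply: hol_comp hol_Cexp; apply: holN; exact: hol_id.
apply: ccont_hol; first exact: hol_Cexp.
apply/ccontP; split => u /=; last exact: cvg_cst.
by apply: cvgB; [apply: cvgM; [exact: cvg_cst|exact: cvg_id]|exact: cvg_cst].
Qed.

Lemma abs_sin_le (x : R) : `|sin x| <= `|x|.
Proof.
have key (y : R) : 0 <= y -> `|sin y| <= y.
  move=> y0; have [|c _] := @MVT_segment R sin cos 0 y y0 (fun x _ => is_derive_sin x).
    exact/continuous_subspaceT/continuous_sin.
  by rewrite sin0 !subr0 => ->; rewrite normrM (ger0_norm y0) ler_piMl ?cos_max.
have [x0|x0] := leP 0 x; first by rewrite (ger0_norm x0) key.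
by rewrite (ltr0_norm x0) -normrN -sinN key// oppr_ge0 ltW.
Qed.

(** The two regulators on the imaginary axis, coming from the first and from the
    second quadrant, differ by [O (min 1 a)] with [a = exp (3 u / 2 - 4 n)];
    [min 1 a <= sqrt a] keeps enough decay in both [n] and [u]. *)
Lemma regul_diff (s : R) n u : 0 <= cos s ->
  nrm (regul s n u - regul (- s) n u) <= 2 * expR (3 / 4 * u - 2 * n%:R).
Proof.
move=> cs; set a := expR (3 / 2 * u - 4 * n%:R).
have a0 : 0 <= a by exact: expR_ge0.
have E : regul s n u - regul (- s) n u = - ((2 * expR (- (a * cos s)) * sin (a * sin s))%:C * 'i%C).
  rewrite /regul !CexpE /= -/a.
  by apply: complexP; rewrite /= !(mul0r, subr0, addr0, cosN, sinN, mulrN, opprK); ring.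
rewrite E {E} nrmN nrmM nrmi mulr1 nrmC !normrM [ `|2| ]ger0_norm// -(mulrA 2) ler_wpM2l//.
have b1 : `|expR (- (a * cos s))| <= 1.
  by rewrite ger0_norm ?expR_ge0// -expR0 ler_expR oppr_le0 mulr_ge0.
set r := expR (3 / 4 * u - 2 * n%:R).
have r0 : 0 <= r by exact: expR_ge0.
have ar : a = r * r by rewrite /a /r -expRD; congr expR; field.
have b2 : `|sin (a * sin s)| <= r.
  have [r1|r1] := leP r 1; last by apply: le_trans (ltW r1); rewrite sin_max.
  apply: le_trans (abs_sin_le _) _; rewrite normrM (ger0_norm a0).
  apply: (@le_trans _ _ (a * 1)); first by rewrite ler_wpM2l// sin_max.
  by rewrite mulr1 ar ler_piMl.
by rewrite -[leRHS]mul1r; apply: ler_pM.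
Qed.

(** Cauchy's theorem on the upper half plane, for a function of exponential type
    with a mere [1 / (1 + y^2)] bound on the imaginary axis: applying [quad_bound]
    to [G] and to [i G (i z)] closes the two quadrants separately, and the
    imaginary axis, on which [G] is controlled, cancels up to [regul_diff]. No
    Phragmen-Lindeloef principle is needed. *)
Theorem half_plane B G (K : R) : 0 <= B -> etype B G ->
  (forall y, 0 <= y -> nrm (G ('i%C * y%:C)) <= K * inv1x2 y) ->
  L1c (fun x => G x%:C) -> CL (fun x => G x%:C) = 0.
Proof.
move=> B0 eG GK hG.
have e0 := @eighth_gt0 R; have c3 := @cos3_gt0 R.
have K0 : 0 <= K.
  have := GK 0 (lexx 0); rewrite /inv1x2 expr0n addr0 invr1 mulr1.
  exact: le_trans (nrm_ge0 _).
(* the second quadrant is the first one for the rotated function *)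
pose G2 z := 'i%C * G ('i%C * z).
have ii : 'i%C * 'i%C = -1 :> C by rewrite -expr2 sqr_i.
have eG2 : etype B G2.
  have [hol_G [A A0 GA]] := eG; split.
    by apply: holM; [exact: hol_cst|apply: hol_comp hol_G; apply: holM; [exact: hol_cst|exact: hol_id]].
  exists A => // z; rewrite /G2 nrmM nrmi mul1r.
  by apply: le_trans (GA _) _; rewrite nrmM nrmi mul1r.
have [K1 [N1 q1]] := quad_bound B0 eG.
have [K2 [N2 q2]] := quad_bound B0 eG2.
set s := 3 * eighth in c3 *.
pose L n : R := logrange n.
pose T n := Cint (- L n) (L n) (fun u => G (expR u)%:C * (expR u)%:C * regul (- s) n u) +
  Cint (- L n) (L n) (fun u => G (- expR u)%:C * (expR u)%:C * regul s n u).
have th : - s <= - s <= s by rewrite /s; lra.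
have th' : - s <= s <= s by rewrite /s; lra.
have T1 : ctends T (CL (fun x => G x%:C)).
  rewrite (CL_split hG); apply: ctendsD.
    apply: (clog_limit hG); [exact: ccont_regul| |move=> u; exact: regul_cvg].
    by move=> n u; exact: nrm_regul1.
  apply: (clog_limit (L1c_opp hG)); [exact: ccont_regul| |move=> u; exact: regul_cvg].
  by move=> n u; exact: nrm_regul1.
have hol_G := etype_hol eG.
have cre : ccont (fun u => (expR u)%:C) by apply: ccont_real; exact: continuous_expR.
have ciu : ccont (fun u => 'i%C * (expR u)%:C) by exact: ccontM (ccont_cst _) cre.
have cGi : ccont (fun u => G ('i%C * (expR u)%:C)) by exact: (ccont_hol hol_G ciu).
pose D n := Cint (- L n) (L n) (fun u => G ('i%C * (expR u)%:C) * ('i%C * (expR u)%:C) *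
  (regul s n u - regul (- s) n u)).
have TE n : T n = quad G n + quad G2 n + D n.
  rewrite /D; under eq_Cint => u _ do rewrite mulrBr.
  have ci t : ccont (fun u => G ('i%C * (expR u)%:C) * ('i%C * (expR u)%:C) * regul t n u).
    by apply: ccontM; [exact: ccontM cGi ciu|exact: ccont_regul].
  rewrite CintB; [|exact: ci|exact: ci].
  rewrite /T /quad -/s -/(L n).
  have -> : Cint (- L n) (L n) (fun u => G2 (expR u)%:C * (expR u)%:C * regul (- s) n u) =
     Cint (- L n) (L n) (fun u => G ('i%C * (expR u)%:C) * ('i%C * (expR u)%:C) * regul (- s) n u).
    by apply: eq_Cint => u _; rewrite /G2; ring.
  have -> : Cint (- L n) (L n) (fun u => G2 ('i%C * (expR u)%:C) * ('i%C * (expR u)%:C) * regul s n u) =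
     Cint (- L n) (L n) (fun u => (-1) * (G (- expR u)%:C * (expR u)%:C * regul s n u)).
    apply: eq_Cint => u _; rewrite /G2 ['i%C * ('i%C * (expR u)%:C)]mulrA ii.
    have -> : -1 * (expR u)%:C = (- expR u)%:C :> C by rewrite mulN1r rmorphN.
    rewrite -ii; ring.
  rewrite CintZ; last first.
    apply: ccontM; last exact: ccont_regul.
    apply: ccontM => //; apply: (ccont_hol hol_G); apply: ccont_real => u.
    by apply: cvgN; exact: continuous_expR.
  ring.
have DK n : nrm (D n) <= (128 * K) * expR (- n%:R).
  have L0 : - L n <= L n by have := @logrange_ge0 R n; rewrite /L; lra.
  apply: le_trans (Cint_le (M := K * (2 * expR (- (2 * n%:R)))) _ L0 _) _.
  - apply: ccontM; first exact: ccontM cGi ciu.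
    by apply: ccontB; exact: ccont_regul.
  - move=> u _; rewrite !nrmM nrmi mul1r nrmC [ `|expR u| ]ger0_norm ?expR_ge0//.
    have d := regul_diff n u (ltW c3).
    have g := GK _ (expR_ge0 u).
    apply: (@le_trans _ _ (K * inv1x2 (expR u) * expR u * (2 * expR (3 / 4 * u - 2 * n%:R)))).
      apply: ler_pM; rewrite ?mulr_ge0 ?nrm_ge0 ?expR_ge0//.
      by rewrite ler_wpM2r ?expR_ge0.
    have -> : K * inv1x2 (expR u) * expR u * (2 * expR (3 / 4 * u - 2 * n%:R)) =
        K * (2 * expR (- (2 * n%:R))) * (inv1x2 (expR u) * expR (u + 3 / 4 * u)).
      by rewrite !expRD; ring.
    rewrite -[leRHS]mulr1 ler_wpM2l ?mulr_ge0 ?expR_ge0//.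
    rewrite /inv1x2 mulrC ler_pdivrMr ?mul1r ?ltr_wpDr ?sqr_ge0//.
    have [u0|u0] := leP u 0.
      apply: (@le_trans _ _ 1); last by rewrite lerDl sqr_ge0.
      by rewrite -[leRHS]expR0 ler_expR; lra.
    rewrite expr2 -expRD; apply: (@le_trans _ _ (expR (u + u))); last by rewrite lerDr.
    by rewrite ler_expR; lra.
  - have n0 : 0 <= n%:R :> R by rewrite ler0n.
    have ne : n%:R <= expR (n%:R : R) by apply: le_trans _ (expR_ge1Dx _); rewrite lerDr.
    have E2 : expR (- (2 * n%:R)) = expR (- n%:R) * expR (- n%:R) :> R by rewrite -expRD; congr expR; ring.
    have E1 : n%:R * expR (- n%:R) <= 1 :> R by rewrite expRN ler_pdivrMr ?expR_gt0// mul1r.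
    rewrite E2 /L /logrange.
    rewrite [leLHS](_ : _ = 128 * K * expR (- n%:R) * (n%:R * expR (- n%:R))); last by ring.
    by rewrite -[leRHS]mulr1 ler_wpM2l// !mulr_ge0// expR_ge0.
apply: (ctends_eq0 (N := maxn N1 N2) (e := fun n => (K1 + K2 + 128 * K) * expR (- n%:R)) T1).
  move=> n; rewrite geq_max => /andP[n1 n2]; rewrite TE.
  apply: le_trans (nrmD _ _) _; apply: le_trans (lerD (nrmD _ _) (lexx _)) _.
  have := DK n; have := q1 n n1; have := q2 n n2; clear.
  move: (expR _) (nrm _) (nrm _) (nrm _) => a b1 b2 b3; lra.
by rewrite -[X in _ --> X](mulr0 (K1 + K2 + 128 * K)); apply: cvgM; [exact: cvg_cst|exact: cvgn_expR].
Qed.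

End HalfPlane.

(** * Division of entire functions; trigonometric functions *)

Section Etype.
Context {R : realType}.
Notation C := R[i].
Implicit Types (F G : C -> C) (z w c b : C) (B : R).

Lemma etype_le B B' F : B <= B' -> etype B F -> etype B' F.
Proof.
move=> BB' [hF [A A0 FA]]; split=> //; exists A => // z; apply: le_trans (FA z) _.
by rewrite ler_wpM2l// ler_expR ler_wpM2r// nrm_ge0.
Qed.

Lemma etypeD B F G : etype B F -> etype B G -> etype B (fun z => F z + G z).
Proof.
move=> [hF [A A0 FA]] [hG [A' A'0 GA]]; split; first exact: holD.
exists (A + A'); first exact: addr_ge0.
by move=> z; apply: le_trans (nrmD _ _) _; rewrite mulrDl lerD.
Qed.

Lemma etypeM B B' F G : etype B F -> etype B' G -> etype (B + B') (fun z => F z * G z).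
Proof.
move=> [hF [A A0 FA]] [hG [A' A'0 GA]]; split; first exact: holM.
exists (A * A'); first exact: mulr_ge0.
by move=> z; rewrite nrmM mulrDl expRD mulrACA; apply: ler_pM; rewrite ?nrm_ge0.
Qed.

Lemma etype_cst B c : 0 <= B -> etype B (fun=> c).
Proof.
move=> B0; split; first exact: hol_cst.
exists (nrm c); first exact: nrm_ge0.
by move=> z; rewrite ler_peMr ?nrm_ge0// -expR0 ler_expR mulr_ge0 ?nrm_ge0.
Qed.

Lemma etypeZ B c F : 0 <= B -> etype B F -> etype B (fun z => c * F z).
Proof. by move=> B0 eF; rewrite -(add0r B); apply: etypeM => //; exact: etype_cst. Qed.

Lemma etypeN B F : 0 <= B -> etype B F -> etype B (fun z => - F z).
Proof.
move=> B0 /(etypeZ (-1) B0); by under [X in etype B X]eq_fun do rewrite mulN1r.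
Qed.

Lemma etypeB B F G : 0 <= B -> etype B F -> etype B G -> etype B (fun z => F z - G z).
Proof. by move=> B0 eF eG; apply: etypeD => //; exact: etypeN. Qed.

Lemma etype_id : etype 1 (id : C -> C).
Proof.
split; first exact: hol_id.
exists 1 => // z; rewrite !mul1r; apply: le_trans _ (expR_ge1Dx _).
by rewrite lerDr.
Qed.

Lemma etype_exp c : etype (nrm c) (fun z => Cexp (c * z)).
Proof.
split; first by apply: hol_comp hol_Cexp; apply: holM; [exact: hol_cst|exact: hol_id].
exists 1 => // z; rewrite mul1r nrm_Cexp ler_expR -nrmM.
by apply: le_trans (Re_le_nrm _); exact: ler_norm.
Qed.

Lemma etype_comp_lin B F c : 0 <= B -> etype B F -> etype (B * nrm c) (fun z => F (c * z)).
Proof.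
move=> B0 [hF [A A0 FA]]; split.
  by apply: hol_comp hF; apply: holM; [exact: hol_cst|exact: hol_id].
by exists A => // z; apply: le_trans (FA _) _; rewrite nrmM mulrA.
Qed.

Lemma cD_exp c z : cD (fun z => Cexp (c * z)) z = c * Cexp (c * z).
Proof.
apply: cD_eq; rewrite mulrC -[X in _ * X]mulr1; apply: cderiv_comp; last exact: cderiv_Cexp.
by apply: cderivZ; exact: cderiv_id.
Qed.

Lemma hol_zero F z0 (r : R) : hol F -> 0 < r ->
  (forall h, 0 < nrm h < r -> F (z0 + h) = 0) -> F z0 = 0.
Proof.
move=> hF r0 F0; apply/eqP; rewrite -nrm_eq0; apply/eqP/le_anti; rewrite nrm_ge0 andbT.
have [d d0 H] := cderiv_lip (hol_cD z0 hF).
set L := nrm (cD F z0) + 1 in H.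
have L0 : 0 < L by rewrite /L; have := nrm_ge0 (cD F z0); lra.
apply/ler_addgt0Pl => e e0; rewrite addr0.
pose t : R := Num.min (r / 2) (Num.min (d / 2) (e / L)).
have t0 : 0 < t by rewrite !lt_min !divr_gt0.
have /andP[tr /andP[td te]] : [&& t <= r / 2, t <= d / 2 & t <= e / L].
  by rewrite -!le_min lexx.
have nt : nrm t%:C = t by rewrite nrmC gtr0_norm.
have trr : t < r by lra.
have tdd : t < d by lra.
have := H t%:C; rewrite nt F0 ?nt ?t0 ?trr// sub0r nrmN => /(_ tdd) /le_trans; apply.
by rewrite mulrC -ler_pdivlMr.
Qed.

(** Entire functions are continuous, so the cubic may be cancelled even at its
    zeros. *)
Lemma hol_div_uniq F G b : b != 0 -> hol F -> hol G ->
  (forall z, z ^+ 2 * (z - b) * F z = z ^+ 2 * (z - b) * G z) -> forall z, F z = G z.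
Proof.
move=> b0 hF hG FG z; have hB := holB hF hG.
have gen u : u != 0 -> u != b -> F u - G u = 0.
  move=> u0 ub; have := FG u; move/mulfI => -> //; first by rewrite subrr.
  by rewrite mulf_neq0 ?expf_neq0// subr_eq0.
have nb : 0 < nrm b by rewrite nrm_gt0.
apply/eqP; rewrite -subr_eq0; apply/eqP.
have [->|z0] := eqVneq z 0.
  apply: (hol_zero hB nb) => h /andP[h0 hb]; rewrite add0r; apply: gen.
    by rewrite -nrm_gt0.
  by apply: contraTneq hb => ->; rewrite ltxx.
have [->|zb] := eqVneq z b; last exact: gen.
apply: (hol_zero hB nb) => h /andP[h0 hb]; apply: gen.
  apply: contraTneq hb => /eqP; rewrite addr_eq0 => /eqP ->.
  by rewrite nrmN ltxx.
by rewrite -subr_eq0 addrC addKr -nrm_gt0.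
Qed.

Lemma dslope2 F : F 0 = 0 -> cD F 0 = 0 ->
  forall z, z ^+ 2 * dslope (dslope F 0) 0 z = F z.
Proof.
move=> F0 F'0 z; have := dslopeE (dslope F 0) 0 z; rewrite dslope_b F'0 !subr0 => e.
by rewrite expr2 -mulrA e -[z in z * _]subr0 dslopeE F0 subr0.
Qed.

(** A function vanishing doubly at 0 and simply at [b] is divisible by
    [z^2 (z - b)] within its exponential type: take divided differences three
    times. *)
Lemma dslope3 B W b : 0 <= B -> etype B W -> b != 0 -> W 0 = 0 -> cD W 0 = 0 -> W b = 0 ->
  exists2 G, etype B G & forall z, z ^+ 2 * (z - b) * G z = W z.
Proof.
move=> B0 eW b0 W0 W'0 Wb; pose D := dslope (dslope W 0) 0.
have eD : etype B D by do 2 apply: etype_dslope => //.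
have DE := dslope2 W0 W'0.
have Db : D b = 0.
  have /eqP := DE b; rewrite Wb mulf_eq0 expf_eq0 /= (negbTE b0) => /eqP.
  by rewrite -/D.
exists (dslope D b); first exact: etype_dslope.
by move=> z; rewrite -mulrA dslopeE Db subr0 DE.
Qed.

End Etype.

Section Trig.
Context {R : realType}.
Notation C := R[i].
Implicit Types (z w c b : C).

Lemma CcosE z : Ccos z = (Cexp ('i%C * z) + Cexp (- ('i%C * z))) / 2.
Proof. by rewrite /Ccos -complexiE. Qed.

Lemma CsinE z : Csin z = (Cexp ('i%C * z) - Cexp (- ('i%C * z))) / (2 * 'i%C).
Proof. by rewrite /Csin -complexiE. Qed.

Lemma i_neq0 : 'i%C != 0 :> C.
Proof. by rewrite -nrm_gt0 nrmi. Qed.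

Lemma ii : 'i%C * 'i%C = -1 :> C.
Proof. by rewrite -expr2 sqr_i. Qed.

Lemma Cexp_i (x : R) : Cexp ('i%C * x%:C) = cos x +i* sin x.
Proof.
have -> : 'i%C * x%:C = 0 +i* x :> C by apply: complexP; rewrite /=; ring.
by rewrite CexpE /= expR0; apply: complexP; rewrite /=; ring.
Qed.

Lemma Ccos_real (x : R) : Ccos x%:C = (cos x)%:C.
Proof.
rewrite CcosE CexpN; have -> : (Cexp ('i%C * x%:C))^-1 = cos x -i* sin x.
  have -> : (Cexp ('i%C * x%:C))^-1 = Cexp ('i%C * (- x)%:C).
    by rewrite -CexpN rmorphN mulrN.
  by rewrite Cexp_i cosN sinN.
rewrite Cexp_i; have -> : (cos x +i* sin x) + (cos x -i* sin x) = 2 * (cos x)%:C.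
  by apply: complexP; rewrite /=; ring.
by rewrite mulrC mulKf// pnatr_eq0.
Qed.

Lemma Csin_real (x : R) : Csin x%:C = (sin x)%:C.
Proof.
rewrite CsinE CexpN; have -> : (Cexp ('i%C * x%:C))^-1 = cos x -i* sin x.
  have -> : (Cexp ('i%C * x%:C))^-1 = Cexp ('i%C * (- x)%:C).
    by rewrite -CexpN rmorphN mulrN.
  by rewrite Cexp_i cosN sinN.
rewrite Cexp_i; have -> : (cos x +i* sin x) - (cos x -i* sin x) = 2 * 'i%C * (sin x)%:C.
  by apply: complexP; rewrite /=; ring.
by rewrite mulrC mulKf// mulf_neq0 ?i_neq0// pnatr_eq0.
Qed.

Lemma nrmNi : nrm (- 'i%C : C) = 1.
Proof. by rewrite nrmN nrmi. Qed.

Lemma etype_expi : etype 1 (fun z : C => Cexp ('i%C * z)).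
Proof. by have := etype_exp ('i%C : C); rewrite nrmi. Qed.

Lemma etype_expNi : etype 1 (fun z : C => Cexp (- ('i%C * z))).
Proof.
have := etype_exp (- 'i%C : C); rewrite nrmNi.
by under [X in etype _ X -> _]eq_fun do rewrite mulNr.
Qed.

(** [(1 - cos z) / z^2]. *)
Definition versine z : C := dslope (dslope (fun z => 1 - Ccos z) 0) 0 z.

Lemma etype_cos : etype 1 (@Ccos R).
Proof.
have -> : @Ccos R = (fun z => 2^-1 * (Cexp ('i%C * z) + Cexp (- ('i%C * z)))).
  by apply/funext => z; rewrite CcosE mulrC.
by apply: etypeZ => //; apply: etypeD; [exact: etype_expi|exact: etype_expNi].
Qed.

Lemma etype_sin : etype 1 (@Csin R).
Proof.
have -> : @Csin R = (fun z => (2 * 'i%C)^-1 * (Cexp ('i%C * z) - Cexp (- ('i%C * z)))).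
  by apply/funext => z; rewrite CsinE mulrC.
by apply: etypeZ => //; apply: etypeB => //; [exact: etype_expi|exact: etype_expNi].
Qed.

Lemma cD_expi z : cderiv (fun z => Cexp ('i%C * z)) z ('i%C * Cexp ('i%C * z)).
Proof. by rewrite -cD_exp; apply: hol_cD; case: etype_expi. Qed.

Lemma cD_expNi z : cderiv (fun z => Cexp (- ('i%C * z))) z (- 'i%C * Cexp (- ('i%C * z))).
Proof.
have e : (fun z => Cexp (- ('i%C * z))) = (fun z => Cexp (- 'i%C * z)).
  by apply/funext => u; rewrite mulNr.
rewrite e -mulNr -cD_exp; apply: hol_cD; rewrite -e; by case: etype_expNi.
Qed.

Lemma cderiv_cos z : cderiv (@Ccos R) z (- Csin z).
Proof.
have -> : @Ccos R = (fun z => 2^-1 * (Cexp ('i%C * z) + Cexp (- ('i%C * z)))).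
  by apply/funext => u; rewrite CcosE mulrC.
have -> : - Csin z = 2^-1 * ('i%C * Cexp ('i%C * z) + - 'i%C * Cexp (- ('i%C * z))).
  rewrite CsinE; have -> : (2 * 'i%C)^-1 = - (2^-1 * 'i%C) :> C.
    rewrite -[RHS]mul1r; apply: (mulIf (x := 2 * 'i%C)).
      by rewrite mulf_neq0 ?i_neq0// pnatr_eq0.
    rewrite mulVf ?mulf_neq0 ?i_neq0 ?pnatr_eq0// mul1r mulNr mulrACA ii mulVf ?pnatr_eq0// mulrN1 opprK//.
  ring.
by apply: cderivZ; apply: cderivD; [exact: cD_expi|exact: cD_expNi].
Qed.

Lemma cderiv_sin z : cderiv (@Csin R) z (Ccos z).
Proof.
have -> : @Csin R = (fun z => (2 * 'i%C)^-1 * (Cexp ('i%C * z) - Cexp (- ('i%C * z)))).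
  by apply/funext => u; rewrite CsinE mulrC.
have -> : Ccos z = (2 * 'i%C)^-1 * ('i%C * Cexp ('i%C * z) - - 'i%C * Cexp (- ('i%C * z))).
  by rewrite CcosE; field; rewrite i_neq0.
by apply: cderivZ; apply: cderivB; [exact: cD_expi|exact: cD_expNi].
Qed.

Lemma Ccos0 : Ccos 0 = 1 :> C.
Proof. by have := Ccos_real 0; rewrite cos0 !rmorph0 rmorph1. Qed.

Lemma Csin0 : Csin 0 = 0 :> C.
Proof. by have := Csin_real 0; rewrite sin0 !rmorph0. Qed.

Lemma versineE z : z ^+ 2 * versine z = 1 - Ccos z.
Proof.
apply: (dslope2 (F := fun z => 1 - Ccos z)); first by rewrite Ccos0 subrr.
have := cderivB (cderiv_cst 1 0) (cderiv_cos 0).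
by rewrite Csin0 oppr0 subr0 => /cD_eq.
Qed.

Lemma etype_versine : etype 1 versine.
Proof.
apply: etype_dslope => //; apply: etype_dslope => //; apply: etypeB => //.
  exact: etype_cst.
exact: etype_cos.
Qed.

End Trig.

(** * The integral of (1 - cos x) / x^2 *)

Section Kappa.
Context {R : realType}.
Notation C := R[i].
Implicit Types (F G W : C -> C) (z w c b : C) (B : R).

Lemma inv1x2_ge (x r : R) : `|x| <= r -> 1 <= (1 + r ^+ 2) * inv1x2 x.
Proof.
move=> xr; rewrite /inv1x2 ler_pdivlMr ?ltr_wpDr ?sqr_ge0// mul1r lerD2l.
by rewrite -(real_normK (num_real x)) ler_pXn2r// nnegrE// (le_trans _ xr).
Qed.

(** A bound known far out on a ray holds on the whole ray, at the cost of the
    constant, since [F] is bounded on the initial segment. *)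
Lemma etype_ray_bound B F (g : R -> C) (r0 K : R) (m : R -> R) : 0 <= B -> etype B F -> 0 <= K ->
  (forall x, nrm (g x) = `|x|) -> (forall x, 0 <= m x) ->
  (forall x, r0 <= `|x| -> nrm (F (g x)) <= K * inv1x2 x + m x) ->
  exists2 K' : R, 0 <= K' & forall x, nrm (F (g x)) <= K' * inv1x2 x + m x.
Proof.
move=> B0 [_ [A A0 FA]] K0 gx m0 FK.
pose c := A * expR (B * r0) * (1 + r0 ^+ 2).
have c0 : 0 <= c by rewrite !mulr_ge0 ?expR_ge0 ?addr_ge0 ?sqr_ge0.
exists (K + c) => [|x]; first exact: addr_ge0.
have i0 := ltW (inv1x2_gt0 x).
have [xr|xr] := leP r0 `|x|.
  apply: le_trans (FK x xr) _; rewrite lerD2r ler_wpM2r//; lra.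
apply: le_trans (FA _) _; rewrite gx.
apply: (@le_trans _ _ (c * inv1x2 x)); last first.
  have k0 : 0 <= K * inv1x2 x by rewrite mulr_ge0.
  by have := m0 x; lra.
rewrite /c -mulrA -[leLHS]mulr1; apply: ler_pM; rewrite ?mulr_ge0 ?expR_ge0//.
  by rewrite ler_wpM2l// ler_expR ler_wpM2l// ltW.
exact: inv1x2_ge (ltW xr).
Qed.

Lemma ccont_hol_real F : hol F -> ccont (fun x => F x%:C).
Proof. by move=> hF; apply: (ccont_hol hF); apply: ccont_real => x; exact: cvg_id. Qed.

Lemma L1c_versine : L1c (fun x => versine (x%:C : C)).
Proof.
have ev := @etype_versine R.
have bd (x : R) : 1 <= `|x| -> nrm (versine (x%:C : C)) <= 4 * inv1x2 x + 0.
  move=> x1; rewrite addr0; have x0 : 0 < `|x| by lra.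
  have x2 : 1 <= x ^+ 2 by rewrite -(real_normK (num_real x)) expr_ge1.
  have := f_equal nrm (versineE (x%:C : C)); rewrite nrmM nrmX nrmC real_normK ?num_real// => e.
  have b2 : x ^+ 2 * nrm (versine (x%:C : C)) <= 2.
    rewrite e {e} Ccos_real -(rmorph1 (real_complex R)) -rmorphB nrmC.
    apply: le_trans (ler_normB _ _) _; rewrite normr1.
    by have := cos_max x; lra.
  have n0 := nrm_ge0 (versine (x%:C : C)).
  rewrite /inv1x2 ler_pdivlMr ?ltr_wpDr ?sqr_ge0//.
  move: (nrm _) n0 b2 => v n0 b2; move: (x ^+ 2) x2 b2 => y y1 b2; nra.
have [K K0 KP] := etype_ray_bound (ler01 : 0 <= 1) ev (ler0n _ 4 : 0 <= 4 :> R) (@nrmC R) (fun=> lexx 0) bd.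
apply: (L1c_dom (k := K) (ccont_hol_real (etype_hol ev)) integrable_inv1x2) => x.
by have := KP x; rewrite addr0.
Qed.

Lemma CL_opp (f : R -> C) : L1c f -> CL (fun x => f (- x)) = CL f.
Proof.
move=> hf; rewrite (CL_split hf) (CL_split (L1c_opp hf)) addrC; congr (_ + _).
by congr CP; apply/funext => x; rewrite opprK.
Qed.

Lemma etype_lip0 B F : 0 <= B -> etype B F -> exists2 K : R, 0 <= K &
  forall h, nrm h <= 1 -> nrm (F h - F 0) <= K * nrm h.
Proof.
move=> B0 [hF [A A0 FA]].
exists (2 * (4 * A * expR B) * expR (B * 1)); first by rewrite !mulr_ge0// expR_ge0.
move=> h h1; have := F_lip B0 A0 hF FA 0 h; rewrite add0r nrm0 add0r => /le_trans; apply.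
rewrite ler_wpM2r ?nrm_ge0// ler_wpM2l ?mulr_ge0// ?expR_ge0//.
by rewrite ler_expR ler_wpM2l.
Qed.

Lemma Cint_cst_sub (T : R) (f : R -> C) (c : C) M : ccont f -> 0 <= T ->
  (forall v, 0 <= v <= T -> nrm (f v - c) <= M) -> nrm (Cint 0 T f - T%:C * c) <= 2 * (M * T).
Proof.
move=> cf T0 fM; have := Cint_cst c T0; rewrite subr0 => <-.
rewrite -CintB//; last exact: ccont_cst.
have := @Cint_le R (fun v => f v - c) 0 T M; rewrite subr0; apply=> //.
by apply: ccontB => //; exact: ccont_cst.
Qed.

(** With the entire function [s z = (e^(i z) - 1) / z] one has
    [s (- x) - s x = 2 (1 - cos x) / x], so Goursat for [s (e^zeta)] on the
    rectangle [- L, L] x [0, pi] expresses the integral by the two vertical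
    edges. The outer one tends to 0, and the inner one to [pi s 0 = i pi]. *)
Theorem integral_versine : CL (fun x => versine (x%:C : C)) = (pi : R)%:C.
Proof.
pose s := dslope (fun z : C => Cexp ('i%C * z)) 0.
have es : etype 1 s by apply: etype_dslope => //; exact: etype_expi.
have hs := etype_hol es.
have sE z : z * s z = Cexp ('i%C * z) - 1.
  by have := dslopeE (fun z : C => Cexp ('i%C * z)) 0 z; rewrite subr0 mulr0 Cexp0.
have s0 : s 0 = 'i%C by rewrite /s dslope_b cD_exp mulr0 Cexp0 mulr1.
have e0 := @eighth_gt0 R.
pose T : R := 8 * eighth.
have T0 : 0 <= T by rewrite /T; lra.
have cosT : cos T = -1 by rewrite /T -eighthE cospi.
have sinT : sin T = 0 by rewrite /T -eighthE sinpi.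
pose g z := s (Cexp z).
have hg : hol g by exact: hol_comp (@hol_Cexp R) hs.
have cg x : ccont (fun y => g (x +i* y)) by exact: ccont_hol hg (ccont_vert x).
have cv : ccont (fun u => versine ((expR u)%:C : C) * (expR u)%:C * 1).
  have cre : ccont (fun u : R => (expR u)%:C) by apply: ccont_real; exact: continuous_expR.
  apply: ccontM; last exact: ccont_cst.
  by apply: ccontM => //; apply: (ccont_hol (etype_hol (@etype_versine R))).
pose L n : R := logrange n.
pose X n := Cint (- L n) (L n) (fun u => versine ((expR u)%:C : C) * (expR u)%:C * 1).
have diff u : g (u +i* T) - g (u +i* 0) = 2 * (versine ((expR u)%:C : C) * (expR u)%:C * 1).
  rewrite mulr1 /g Cexp_real.
  have -> : Cexp (u +i* T) = - (expR u)%:C.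
    by rewrite CexpE /= cosT sinT; apply: complexP; rewrite /=; ring.
  set x := (expR u)%:C.
  have x0 : x != 0 by apply: realC_neq0; rewrite gt_eqF// expR_gt0.
  apply: (mulfI x0).
  have -> : x * (s (- x) - s x) = - (- x * s (- x)) - x * s x by ring.
  rewrite !sE.
  have -> : x * (2 * (versine x * x)) = 2 * (x ^+ 2 * versine x) by ring.
  by rewrite versineE CcosE mulrN; field.
have key n : 2 * X n = 'i%C * (Cint 0 T (fun y => g (L n +i* y)) - Cint 0 T (fun y => g (- L n +i* y))).
  have L0 : - L n <= L n by have := @logrange_ge0 R n; rewrite /L; lra.
  have /eqP := Goursat hg L0 T0; rewrite bdryE addrC addr_eq0 opprB => /eqP ->.
  rewrite -CintZ// -CintB; last first.
  - exact: ccont_hol hg (ccont_horiz _).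
  - exact: ccont_hol hg (ccont_horiz _).
  by apply: eq_Cint => u _; rewrite diff.
have X1 : ctends X (CP (fun x => versine (x%:C : C))).
  apply: (clog_limit (q := fun _ _ => 1) L1c_versine).
  - by move=> n; exact: ccont_cst.
  - by move=> n u; rewrite nrm1.
  - by move=> u; split; exact: cvg_cst.
have even : CL (fun x => versine (x%:C : C)) = CP (fun x => versine (x%:C : C)) + CP (fun x => versine (x%:C : C)).
  rewrite (CL_split L1c_versine); congr (_ + CP _); apply/funext => x.
  have [->|x0] := eqVneq x 0; first by rewrite oppr0.
  have x0' : x%:C ^+ 2 != 0 :> C by rewrite expf_neq0// realC_neq0.
  apply: (mulfI x0'); rewrite versineE -[x%:C ^+ 2]sqrrN -rmorphN versineE.
  by rewrite !Ccos_real cosN.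
have TE : T%:C = pi%:C :> C by rewrite /T -eighthE.
have X2 := ctendsD (ctendsD X1 X1) (s2 := fun _ => - T%:C) (l2 := - T%:C) (conj (cvg_cst _) (cvg_cst _)).
rewrite even; apply/eqP; rewrite -TE -subr_eq0; apply/eqP.
have [K K0 sK] := etype_lip0 (ler01 : 0 <= 1) es.
apply: (ctends_eq0 (N := 0%N) (e := fun n => (4 * T + 2 * K * T) * expR (- n%:R)) (X2 _ _)); last first.
  by rewrite -[X in _ --> X](mulr0 (4 * T + 2 * K * T)); apply: cvgM; [exact: cvg_cst|exact: cvgn_expR].
move=> n _; have n0 : 0 <= n%:R :> R by rewrite ler0n.
have Ln : expR (- L n) <= expR (- n%:R) by rewrite ler_expR /L /logrange; lra.
have L1 : expR (- L n) <= 1.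
  by rewrite -[leRHS]expR0 ler_expR oppr_le0; exact: logrange_ge0.
have -> : X n + X n = 2 * X n by ring.
rewrite key.
have -> (P Q : C) : 'i%C * (P - Q) - T%:C = 'i%C * (P - (Q - T%:C * 'i%C)).
  rewrite -[X in _ + X]mulN1r -ii; ring.
rewrite nrmM nrmi mul1r; apply: le_trans (nrm_sub _ _) _.
rewrite mulrDl; apply: lerD.
  apply: le_trans (Cint_le (M := 2 * expR (- n%:R)) (cg _) T0 _) _; last by rewrite subr0; lra.
  move=> v /andP[v0 vT]; rewrite /g.
  have nc : nrm (Cexp (L n +i* v)) = expR (L n) by rewrite nrm_Cexp.
  have c0 : Cexp (L n +i* v) != 0 by exact: Cexp_neq0.
  have : nrm (Cexp (L n +i* v) * s (Cexp (L n +i* v))) <= 2.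
    rewrite sE; apply: le_trans (nrm_sub _ _) _; rewrite nrm1 nrm_Cexp.
    suff : expR (complex.Re ('i%C * Cexp (L n +i* v))) <= 1 by lra.
    have -> : complex.Re ('i%C * Cexp (L n +i* v)) = - (expR (L n) * sin v).
      by rewrite CexpE /=; ring.
    rewrite -[leRHS]expR0 ler_expR oppr_le0 mulr_ge0 ?expR_ge0// sin_ge0_pi//.
    by rewrite eighthE v0.
  rewrite nrmM nc; set q := nrm _ => q2.
  apply: (@le_trans _ _ (2 * expR (- L n))); last by rewrite ler_wpM2l.
  by rewrite expRN ler_pdivlMr ?expR_gt0// mulrC.
rewrite -s0.
apply: le_trans (Cint_cst_sub (M := K * expR (- n%:R)) (cg _) T0 _) _; last by lra.
move=> v _; rewrite /g; apply: le_trans (sK _ _) _; rewrite nrm_Cexp//=.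
by rewrite ler_wpM2l.
Qed.

End Kappa.

(** * A residue formula on the real line *)

Section Residue.
Context {R : realType}.
Notation C := R[i].
Notation leb := (@lebesgue_measure R).
Implicit Types (F G W : C -> C) (z w c b : C) (B : R).

(** Division by the cubic turns a numerator of size [1 + |x|] into [1 / (1 + x^2)],
    and one of size [(1 + |x|)^3 m x] into [m x]; near the zeros of the cubic
    [etype_ray_bound] takes over. *)
Lemma div3_ray_bound B G W b (g : R -> C) (K : R) (m : R -> R) :
  0 <= B -> etype B G -> 0 <= K ->
  (forall z, z ^+ 2 * (z - b) * G z = W z) ->
  (forall x, nrm (g x) = `|x|) -> (forall x, 0 <= m x) ->
  (forall x, nrm (W (g x)) <= (1 + `|x|) ^+ 3 * m x + K * (1 + `|x|)) ->
  exists2 K' : R, 0 <= K' & forall x, nrm (G (g x)) <= K' * inv1x2 x + 16 * m x.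
Proof.
move=> B0 eG K0 GW gx m0 WK.
have r0 : 1 <= 1 + 2 * nrm b by have := nrm_ge0 b; lra.
apply: (etype_ray_bound (r0 := 1 + 2 * nrm b) (K := 8 * K) B0 eG _ gx) => [|x|x xr].
- by rewrite mulr_ge0.
- by rewrite mulr_ge0.
set t := `|x| in xr WK *.
have t1 : 1 <= t by lra.
have := WK x; rewrite -GW nrmM nrmM nrmX gx -/t => h.
have tb : t / 2 <= nrm (g x - b).
  have := nrmD (g x - b) b; rewrite subrK gx -/t => hh; have := nrm_ge0 b; lra.
have G0 := nrm_ge0 (G (g x)).
have mx := m0 x.
have h2 : t ^+ 3 * nrm (G (g x)) <= 16 * t ^+ 3 * m x + 4 * K * t.
  have a1 : t ^+ 2 * (t / 2) * nrm (G (g x)) <= t ^+ 2 * nrm (g x - b) * nrm (G (g x)).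
    by rewrite ler_wpM2r// ler_wpM2l// sqr_ge0.
  have a2 : (1 + t) ^+ 3 * m x <= 8 * t ^+ 3 * m x.
    rewrite ler_wpM2r// (_ : 8 * t ^+ 3 = (2 * t) ^+ 3); last by ring.
    by rewrite ler_pXn2r// ?nnegrE; lra.
  have a3 : K * (1 + t) <= K * (2 * t) by rewrite ler_wpM2l//; lra.
  rewrite (_ : t ^+ 3 * _ = 2 * (t ^+ 2 * (t / 2) * nrm (G (g x)))); last by field.
  lra.
have t3 : 0 < t ^+ 3 by rewrite exprn_gt0//; lra.
rewrite -(ler_pM2l t3); apply: le_trans h2 _.
rewrite mulrDr [leLHS]addrC (_ : 16 * t ^+ 3 * m x = t ^+ 3 * (16 * m x)); last by ring.
rewrite lerD2r.
rewrite /inv1x2 -(real_normK (num_real x)) -/t.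
rewrite (_ : t ^+ 3 * (8 * K / (1 + t ^+ 2)) = 4 * K * t * (2 * t ^+ 2 / (1 + t ^+ 2))); last first.
  by field; rewrite gt_eqF// ltr_wpDr ?sqr_ge0.
rewrite -[leLHS]mulr1 ler_wpM2l ?mulr_ge0//; first by lra.
have t2 : 1 <= t ^+ 2 by rewrite expr_ge1//; lra.
by rewrite ler_pdivlMr ?ltr_wpDr ?sqr_ge0// mul1r; lra.
Qed.

Lemma Re_i_real (x : R) : complex.Re ('i%C * x%:C) = 0.
Proof. by rewrite /=; ring. Qed.

Lemma Re_i_i (y : R) : complex.Re ('i%C * ('i%C * y%:C)) = - y.
Proof. by rewrite /=; ring. Qed.

Section Formula.
Variables (B : R) (U V E : C -> C) (b : C) (K : R) (m : R -> R).
Hypotheses (B1 : 1 + 1 <= B) (eU : etype B U) (eV : etype B V) (hE : hol E) (b0 : b != 0).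
Hypotheses (K0 : 0 <= K) (m0 : forall x, 0 <= m x) (im : leb.-integrable setT (EFin \o m)).
Hypothesis UVE : forall z, z ^+ 2 * (z - b) * E z = U z + V z.
Hypothesis Uimag : forall y, 0 <= y -> nrm (U ('i%C * y%:C)) <= K * (1 + y).
Hypothesis Vimag : forall y, 0 <= y -> nrm (V (- ('i%C * y%:C))) <= K * (1 + y).
Hypothesis Ureal : forall x : R, nrm (U x%:C) <= (1 + `|x|) ^+ 3 * m x.
Hypothesis Vreal : forall x : R, nrm (V x%:C) <= (1 + `|x|) ^+ 3 * m x.

Let B0 : 0 <= B. Proof. exact: le_trans (ler0n R 2) B1. Qed.

(** Subtracting the interpolation terms does not spoil the bounds, since they
    grow linearly on the rays where [e] is bounded. *)
Lemma interp_bound (c0 c1 c2 : C) (e : C -> C) F (g : R -> C) (mm : R -> R) :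
  (forall x, nrm (g x) = `|x|) -> (forall x, nrm (e (g x)) <= 2) ->
  (forall x, nrm (F (g x)) <= (1 + `|x|) ^+ 3 * mm x + K * (1 + `|x|)) ->
  exists2 K' : R, 0 <= K' & forall x,
    nrm (F (g x) - c0 - c1 * g x - c2 * ((g x - b) * e (g x))) <=
      (1 + `|x|) ^+ 3 * mm x + K' * (1 + `|x|).
Proof.
move=> gx ex FK; exists (K + nrm c0 + nrm c1 + nrm c2 * (2 * (1 + nrm b))).
  by rewrite !addr_ge0 ?mulr_ge0 ?addr_ge0 ?nrm_ge0.
move=> x; have x0 := normr_ge0 x.
apply: le_trans (nrm_sub _ _) _; apply: le_trans (lerD (nrm_sub _ _) (lexx _)) _.
apply: le_trans (lerD (lerD (nrm_sub _ _) (lexx _)) (lexx _)) _.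
rewrite !nrmM gx !mulrDl !addrA.
have F1 := FK x; rewrite mulrDr mulr1 in F1.
have d1 : nrm (g x - b) * nrm (e (g x)) <= (1 + `|x|) * (1 + nrm b) * 2.
  apply: ler_pM; rewrite ?nrm_ge0//; apply: le_trans (nrm_sub _ _) _; rewrite gx.
  have := nrm_ge0 b; nra.
have d2 : nrm c2 * (nrm (g x - b) * nrm (e (g x))) <= nrm c2 * ((1 + `|x|) * (1 + nrm b) * 2).
  by rewrite ler_wpM2l ?nrm_ge0.
have d3 : nrm c0 <= nrm c0 * (1 + `|x|) by rewrite ler_peMr ?nrm_ge0// lerDl.
have d4 : nrm c1 * `|x| <= nrm c1 * (1 + `|x|) by rewrite ler_wpM2l ?nrm_ge0// lerDr.
lra.
Qed.

Let ep z : C := (Cexp ('i%C * z) - 1) / 'i%C.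
Let em z : C := (1 - Cexp (- ('i%C * z))) / 'i%C.

Let ep0 : ep 0 = 0.
Proof. by rewrite /ep mulr0 Cexp0 subrr mul0r. Qed.

Let em0 : em 0 = 0.
Proof. by rewrite /em mulr0 oppr0 Cexp0 subrr mul0r. Qed.

Let dep : cderiv ep 0 1.
Proof.
have := cderivM (cderivB (cD_expi 0) (cderiv_cst (1 : C) 0)) (cderiv_cst ('i%C)^-1 0).
by rewrite mulr0 Cexp0 mulr1 subr0 mulr0 addr0 divff ?i_neq0.
Qed.

Let dem : cderiv em 0 1.
Proof.
have := cderivM (cderivB (cderiv_cst (1 : C) 0) (cD_expNi 0)) (cderiv_cst ('i%C)^-1 0).
by rewrite mulr0 oppr0 Cexp0 mulr1 sub0r opprK mulr0 addr0 divff ?i_neq0.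
Qed.

Let eep : etype 1 ep.
Proof.
have := etypeZ ('i%C)^-1 ler01 (etypeB ler01 (@etype_expi R) (etype_cst 1 ler01)).
by under [X in etype _ X -> _]eq_fun do rewrite mulrC.
Qed.

Let eem : etype 1 em.
Proof.
have := etypeZ ('i%C)^-1 ler01 (etypeB ler01 (etype_cst 1 ler01) (@etype_expNi R)).
by under [X in etype _ X -> _]eq_fun do rewrite mulrC.
Qed.

Let W F (e : C -> C) c0 c1 c2 z := F z - c0 - c1 * z - c2 * ((z - b) * e z).

Let etype_W F e c0 c1 c2 : etype B F -> etype 1 e -> etype B (W F e c0 c1 c2).
Proof.
move=> eF ee; have B1' : 1 <= B by apply: le_trans B1; rewrite lerDl.
apply: etypeB => //; last first.
  apply: etypeZ => //; apply: (etype_le B1); apply: etypeM => //.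
  by apply: etypeB => //; [exact: etype_id|exact: etype_cst].
apply: etypeB => //; first by apply: etypeB => //; exact: etype_cst.
by apply: etypeZ => //; apply: (etype_le B1'); exact: etype_id.
Qed.

Let cderiv_W F e c0 c1 c2 l : cderiv F 0 l -> cderiv e 0 1 -> e 0 = 0 ->
  cderiv (W F e c0 c1 c2) 0 (l - c1 + c2 * b).
Proof.
move=> dF de e0.
have d1 : cderiv (fun z => z - b) 0 (1 - 0) by apply: cderivB; [exact: cderiv_id|exact: cderiv_cst].
have := cderivB (cderivB (cderivB dF (cderiv_cst c0 0)) (cderivZ c1 (cderiv_id 0))) (cderivZ c2 (cderivM d1 de)).
by rewrite e0 subr0 sub0r subr0 !mulr1 mulr0 add0r mulrN opprK.
Qed.

Let dUV : cD V 0 = - cD U 0.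
Proof.
apply/eqP; rewrite -addr_eq0; apply/eqP.
have d1 : cderiv (fun z => U z + V z) 0 (cD U 0 + cD V 0).
  by apply: cderivD; apply: hol_cD; [case: eU|case: eV].
have d2 : cderiv (fun z => z * (z * ((z - b) * E z))) 0 0.
  have hz : hol (fun z => z * ((z - b) * E z)).
    apply: holM; first exact: hol_id.
    by apply: holM => //; apply: holB; [exact: hol_id|exact: hol_cst].
  have := cderivM (cderiv_id 0) (hol_cD 0 hz).
  by rewrite mul0r mulr0 mul0r addr0.
rewrite addrC; apply: cderiv_uniq d1 _; apply: cderiv_eq d2 => z.
by rewrite -UVE; ring.
Qed.

Let imx (x : R) : C := 'i%C * `|x|%:C.
Let nimx (x : R) : C := - ('i%C * `|x|%:C).

Let nrm_imx x : nrm (imx x) = `|x|.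
Proof. by rewrite /imx nrmM nrmi mul1r nrmC normr_id. Qed.

Let nrm_nimx x : nrm (nimx x) = `|x|.
Proof. by rewrite /nimx nrmN nrmM nrmi mul1r nrmC normr_id. Qed.

Let ep_bound z : complex.Re ('i%C * z) <= 0 -> nrm (ep z) <= 2.
Proof.
move=> h; rewrite /ep nrmM nrmV nrmi invr1 mulr1; apply: le_trans (nrm_sub _ _) _.
rewrite nrm1 nrm_Cexp; have : expR (complex.Re ('i%C * z)) <= 1 by rewrite -[leRHS]expR0 ler_expR.
lra.
Qed.

Let em_bound z : complex.Re (- ('i%C * z)) <= 0 -> nrm (em z) <= 2.
Proof.
move=> h; rewrite /em nrmM nrmV nrmi invr1 mulr1; apply: le_trans (nrm_sub _ _) _.
rewrite nrm1 nrm_Cexp; have : expR (complex.Re (- ('i%C * z))) <= 1 by rewrite -[leRHS]expR0 ler_expR.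
lra.
Qed.

Let Gbound F e c0 c1 c2 G (g : R -> C) (mm : R -> R) :
  etype B G -> (forall z, z ^+ 2 * (z - b) * G z = W F e c0 c1 c2 z) ->
  (forall x, 0 <= mm x) ->
  (forall x, nrm (g x) = `|x|) -> (forall x, nrm (e (g x)) <= 2) ->
  (forall x, nrm (F (g x)) <= (1 + `|x|) ^+ 3 * mm x + K * (1 + `|x|)) ->
  exists2 K' : R, 0 <= K' & forall x, nrm (G (g x)) <= K' * inv1x2 x + 16 * mm x.
Proof.
move=> eG GW mm0 gx ex FK.
have [K1 K10 h] := interp_bound c0 c1 c2 gx ex FK.
exact: (div3_ray_bound B0 eG K10 GW gx mm0 h).
Qed.

(** The residues of [U / (z^2 (z - b))] in the upper half plane, where [U] is
    controlled, without ever forming a quotient with poles. Subtract from [U]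
    the combination [c0 + c1 z + c2 (z - b) (e^(i z) - 1) / i] that interpolates
    [U], [U'] at 0 and [U] at [b], and from [V] the opposite one built with
    [(1 - e^(- i z)) / i]. Both differences are divisible by [z^2 (z - b)], so
    [half_plane] makes their quotients integrate to 0; the two corrections add
    up to [2 i c2 (1 - cos z) / z^2], evaluated by [integral_versine]. *)
Theorem residue_formula : L1c (fun x => E x%:C) ->
  CL (fun x => E x%:C) = 2 * 'i%C * pi%:C * (((U b - U 0) / b - cD U 0) / b).
Proof.
move=> LE.
set c1 := (U b - U 0) / b; set c2 := (c1 - cD U 0) / b; set c0 := U 0.
have eWp := etype_W c0 c1 c2 eU eep.
have eWm := etype_W (- c0) (- c1) (- c2) eV eem.
have UV0 : V 0 = - U 0.
  by apply/eqP; rewrite -addr_eq0 addrC -UVE expr0n !mul0r.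
have UVb : V b = - U b.
  by apply/eqP; rewrite -addr_eq0 addrC -UVE subrr mulr0 mul0r.
have [Gp eGp GpE] : exists2 G, etype B G & forall z, z ^+ 2 * (z - b) * G z = W U ep c0 c1 c2 z.
  apply: dslope3 => //.
  - by rewrite /W ep0 !mulr0 !subr0 /c0 subrr.
  - apply: cD_eq; have := cderiv_W c0 c1 c2 (hol_cD 0 (etype_hol eU)) dep ep0.
    by rewrite /c2 divfK// (_ : _ - c1 + _ = 0); last ring.
  - by rewrite /W subrr mul0r mulr0 subr0 /c0 /c1 divfK// subrr.
have [Gm eGm GmE] : exists2 G, etype B G & forall z, z ^+ 2 * (z - b) * G z = W V em (- c0) (- c1) (- c2) z.
  apply: dslope3 => //.
  - by rewrite /W em0 !mulr0 !subr0 /c0 UV0 subrr.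
  - apply: cD_eq; have := cderiv_W (- c0) (- c1) (- c2) (hol_cD 0 (etype_hol eV)) dem em0.
    by rewrite dUV mulNr /c2 divfK// (_ : _ - - c1 - _ = 0); last ring.
  - by rewrite /W subrr mul0r mulr0 subr0 /c0 UVb mulNr /c1 divfK// opprK opprB; ring.
have zero_m (x : R) : 0 <= 0 :> R by [].
have intg (k : R) : leb.-integrable setT (EFin \o (fun x => k * inv1x2 x + 16 * m x)).
  have := integrableD measurableT (integrableZl measurableT k (@integrable_inv1x2 R)) (integrableZl measurableT 16 im).
  exact: eq_integrable.
have LG G : etype B G -> (exists2 K' : R, 0 <= K' & forall x, nrm (G x%:C) <= K' * inv1x2 x + 16 * m x) ->
    L1c (fun x => G x%:C).
  move=> eG [K' _ hK]; split; first exact: ccont_hol_real (etype_hol eG).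
  by exists (fun x => K' * inv1x2 x + 16 * m x).
have Kp x : 0 <= K * (1 + `|x|) by rewrite mulr_ge0 ?addr_ge0.
have LGp : L1c (fun x => Gp x%:C).
  apply: LG => //; apply: (Gbound eGp GpE m0 (@nrmC R)).
    by move=> x; apply: ep_bound; rewrite Re_i_real.
  by move=> x; apply: le_trans (Ureal x) _; rewrite lerDl.
have LGm : L1c (fun x => Gm x%:C).
  apply: LG => //; apply: (Gbound eGm GmE m0 (@nrmC R)).
    by move=> x; apply: em_bound; rewrite -mulrN -rmorphN Re_i_real.
  by move=> x; apply: le_trans (Vreal x) _; rewrite lerDl.
have Ip : CL (fun x => Gp x%:C) = 0.
  have [|x|K' K'0 hK] := Gbound eGp GpE zero_m nrm_imx.
  - by move=> x; apply: ep_bound; rewrite /imx Re_i_i oppr_le0.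
  - by rewrite mulr0 add0r; apply: Uimag.
  apply: (half_plane (K := K') B0 eGp _ LGp) => y y0.
  by have := hK y; rewrite /imx ger0_norm// mulr0 addr0.
have Im : CL (fun x => Gm x%:C) = 0.
  have [|x|K' K'0 hK] := Gbound eGm GmE zero_m nrm_nimx.
  - by move=> x; apply: em_bound; rewrite /nimx mulrN opprK Re_i_i oppr_le0.
  - by rewrite mulr0 add0r; apply: Vimag.
  pose H z := Gm (-1 * z).
  have eH : etype B H.
    by have := etype_comp_lin (-1) B0 eGm; rewrite nrmN nrm1 mulr1.
  have HE (x : R) : H x%:C = Gm (- x)%:C by rewrite /H mulN1r rmorphN.
  rewrite -(CL_opp LGm); under eq_CL do rewrite -HE.
  apply: (half_plane (K := K') B0 eH) => [y y0|].
    by have := hK y; rewrite /nimx /H mulN1r ger0_norm// mulr0 addr0.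
  have := L1c_opp LGm; by under [X in L1c X -> _]eq_fun do rewrite -HE.
have dec z : E z = Gp z + Gm z + 2 * 'i%C * c2 * versine z.
  move: z; apply: (hol_div_uniq (F := E) (G := fun z => Gp z + Gm z + 2 * 'i%C * c2 * versine z) b0 hE).
    apply: holD; first by apply: holD; [case: eGp|case: eGm].
    by apply: holM; [exact: hol_cst|case: (@etype_versine R)].
  move=> z; rewrite [_ * (Gp z + Gm z + _)]mulrDr [_ * (Gp z + Gm z)]mulrDr GpE GmE UVE.
  have -> : z ^+ 2 * (z - b) * (2 * 'i%C * c2 * versine z) = 2 * 'i%C * c2 * (z - b) * (z ^+ 2 * versine z) by ring.
  rewrite versineE CcosE /W /ep /em.
  have -> : 2 * 'i%C * c2 * (z - b) * (1 - (Cexp ('i%C * z) + Cexp (- ('i%C * z))) / 2) =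
     ('i%C * 'i%C) * (c2 * (z - b) * (2 - Cexp ('i%C * z) - Cexp (- ('i%C * z)))) / 'i%C.
    by field; rewrite i_neq0.
  by rewrite ii; field; rewrite i_neq0.
under eq_CL do rewrite dec.
have Lv := L1cZ (2 * 'i%C * c2) (@L1c_versine R).
rewrite (CLD (L1cD LGp LGm) Lv) (CLD LGp LGm) Ip Im !add0r (CLZ _ (@L1c_versine R)).
by rewrite integral_versine mulrAC.
Qed.

End Formula.
End Residue.

(** * Pairing with dilated sine kernels *)

Section Pairing.
Context {R : realType}.
Notation C := R[i].
Notation leb := (@lebesgue_measure R).
Implicit Types (F G : C -> C) (z w c b : C) (p : R).

Lemma csincE : @csinc R = dslope (@Csin R) 0.
Proof.
apply/funext => z; rewrite /csinc /dslope; case: eqVneq => [_|_]; last by rewrite Csin0 !subr0.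
by rewrite (cD_eq (cderiv_sin 0)) Ccos0.
Qed.

Lemma etype_csinc : etype 1 (@csinc R).
Proof. by rewrite csincE; apply: etype_dslope => //; exact: etype_sin. Qed.

Lemma mul_csinc z : z * csinc z = Csin z.
Proof.
have := dslopeE (@Csin R) 0 z; rewrite csincE !subr0 => ->.
by rewrite Csin0 subr0.
Qed.

(** The upper half plane part of
    [z^2 (z - b) csinc (p (z - b)) (1 - csinc (p z)^2)], where [X] stands for
    [e^(i p z)] and the argument [b] for [e^(i p b)]; the other part is
    [- Mfun p b^-1 z X^-1]. *)
Definition Mfun p b z (X : C) : C := (2 * 'i%C * p%:C)^-1 *
  (z ^+ 2 * X / b - (4 * p%:C ^+ 2)^-1 * (- X ^+ 3 / b + (2 / b + b) * X)).

Lemma Mfun_bound p b : exists2 K : R, 0 <= K &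
  forall z X, nrm X <= 1 -> nrm (Mfun p b z X) <= K * (1 + nrm z ^+ 2) * nrm X.
Proof.
pose k1 := nrm (2 * 'i%C * p%:C)^-1; pose k2 := nrm b^-1; pose k3 := nrm (4 * p%:C ^+ 2)^-1.
pose k4 := nrm (2 / b + b).
have k10 : 0 <= k1 by exact: nrm_ge0. have k20 : 0 <= k2 by exact: nrm_ge0.
have k30 : 0 <= k3 by exact: nrm_ge0. have k40 : 0 <= k4 by exact: nrm_ge0.
exists (k1 * (k2 + k3 * (k2 + k4))); first by rewrite mulr_ge0 ?addr_ge0 ?mulr_ge0 ?addr_ge0.
move=> z X X1; rewrite /Mfun nrmM -/k1 -!(mulrA k1) ler_wpM2l//.
have X0 := nrm_ge0 X; have z0 := sqr_ge0 (nrm z).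
apply: le_trans (nrm_sub _ _) _; rewrite nrmM nrmM nrmX nrmM -/k2 -/k3.
have h1 : nrm (- X ^+ 3 / b + (2 / b + b) * X) <= (k2 + k4) * nrm X.
  apply: le_trans (nrmD _ _) _; rewrite nrmM nrmN nrmX nrmM -/k2 -/k4 mulrDl lerD2r mulrC.
  rewrite ler_wpM2l// exprS -[leRHS]mulr1 ler_wpM2l//.
  by rewrite exprn_ile1.
have h2 : k3 * nrm (- X ^+ 3 / b + (2 / b + b) * X) <= k3 * ((k2 + k4) * nrm X) by rewrite ler_wpM2l.
have h3 : 0 <= k2 * nrm X by rewrite mulr_ge0.
have h4 : 0 <= k3 * (k2 + k4) * nrm X * nrm z ^+ 2.
  by apply: mulr_ge0 => //; apply: mulr_ge0 => //; apply: mulr_ge0 => //; exact: addr_ge0.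
lra.
Qed.

(** Decay uniform on horizontal strips: it survives complex shifts of the
    argument and differentiation. *)
Definition strip_decay (f : C -> C) := forall Y0 : R, 0 <= Y0 -> exists2 K : R, 0 <= K &
  forall w, `|complex.Im w| <= Y0 -> nrm (f w) <= K / (1 + nrm w).

Lemma csinc_bound : strip_decay (@csinc R).
Proof.
move=> Y0 Y00; have [_ [A A0 h]] := etype_csinc.
exists (2 * (A * expR 1) + 2 * expR Y0) => [|w wY].
  by rewrite addr_ge0 ?mulr_ge0 ?expR_ge0.
have w0 := nrm_ge0 w; have c0 := nrm_ge0 (csinc w).
have e10 : 0 <= A * expR 1 by rewrite mulr_ge0 ?expR_ge0.
have e20 : 0 <= expR Y0 by exact: expR_ge0.
rewrite ler_pdivlMr ?ltr_wpDr//.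
have [w1|w1] := leP (nrm w) 1.
  have : nrm (csinc w) <= A * expR 1.
    by apply: le_trans (h w) _; rewrite ler_wpM2l// ler_expR mul1r.
  have : nrm (csinc w) * nrm w <= nrm (csinc w) * 1 by rewrite ler_wpM2l.
  lra.
have sb : nrm w * nrm (csinc w) <= expR Y0.
  rewrite -nrmM mul_csinc CsinE nrmM nrmV nrmM nrmi mulr1.
  have -> : nrm (2 : C) = 2.
    by have -> : (2 : C) = (2 : R)%:C; [rewrite rmorph_nat|rewrite nrmC ger0_norm].
  rewrite ler_pdivrMr//; apply: le_trans (nrm_sub _ _) _; rewrite !nrm_Cexp.
  have r1 : complex.Re ('i%C * w) = - complex.Im w by case: w {wY w0 c0 w1} => x y /=; ring.
  have r2 : complex.Re (- ('i%C * w)) = complex.Im w by case: w {wY w0 c0 w1 r1} => x y /=; ring.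
  rewrite r1 r2; move: wY; rewrite ler_norml => /andP[y1 y2].
  have : expR (- complex.Im w) <= expR Y0 by rewrite ler_expR; lra.
  have : expR (complex.Im w) <= expR Y0 by rewrite ler_expR; lra.
  lra.
have : nrm (csinc w) * 1 <= nrm (csinc w) * nrm w by rewrite ler_wpM2l// ltW.
rewrite (mulrC (nrm w)) in sb; lra.
Qed.

Lemma strip_decay_shift f (r T : R) : strip_decay f -> 0 <= r -> 0 <= T -> exists2 K : R, 0 <= K &
  forall (t x : R) u, 1 <= t <= T -> nrm u <= r ->
   nrm (f (t%:C * (x%:C - u))) <= K / (1 + `|x|).
Proof.
move=> fd r0 T0; have [K1 K10 h1] := fd _ (mulr_ge0 T0 r0).
exists (K1 * (1 + r)) => [|t x u /andP[t1 tT] ub].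
  by rewrite !mulr_ge0 ?addr_ge0.
have t0 : 0 <= t by lra.
have u0 := nrm_ge0 u; have x0 := normr_ge0 x.
apply: le_trans (h1 _ _) _.
  have -> : complex.Im (t%:C * (x%:C - u)) = - (t * complex.Im u).
    by case: u {ub u0} => c d /=; ring.
  rewrite normrN normrM ger0_norm//; apply: ler_pM => //.
  exact: le_trans (Im_le_nrm _) ub.
rewrite -mulrA ler_wpM2l//.
have n1 : 0 <= nrm (t%:C * (x%:C - u)) by exact: nrm_ge0.
rewrite -[X in X <= _]mul1r ler_pdivrMr ?ltr_wpDr// mulrAC ler_pdivlMr ?ltr_wpDr// mul1r.
rewrite nrmM nrmC ger0_norm// in n1 *.
have d : `|x| <= nrm (x%:C - u) + nrm u by have := nrmD (x%:C - u) u; rewrite subrK nrmC.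
have d0 := nrm_ge0 (x%:C - u).
have d1 : nrm (x%:C - u) <= t * nrm (x%:C - u) by rewrite ler_peMl.
nra.
Qed.

Lemma sinc_kernel_bound b (T : R) : 0 <= T -> exists2 K : R, 0 <= K &
  forall (t x : R) u, 1 <= t <= T -> nrm u <= nrm b ->
   nrm (csinc (t%:C * (x%:C - u)) * (1 - csinc (t%:C * x%:C) ^+ 2)) <= K / (1 + `|x|).
Proof.
move=> T0; have [K1 K10 h1] := strip_decay_shift csinc_bound (nrm_ge0 b) T0.
have [K2 K20 h2] := csinc_bound (lexx 0).
exists (K1 * (1 + K2 ^+ 2)) => [|t x u tT ub].
  by rewrite mulr_ge0 ?addr_ge0 ?sqr_ge0.
rewrite nrmM mulrAC; apply: ler_pM; rewrite ?nrm_ge0//; first exact: h1.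
apply: le_trans (nrm_sub _ _) _; rewrite nrm1 lerD2l nrmX ler_pXn2r ?nnegrE ?nrm_ge0//.
have i0 : complex.Im (t%:C * x%:C) = 0 by rewrite /=; ring.
apply: le_trans (h2 _ _) _; first by rewrite i0 normr0.
by rewrite ler_pdivrMr ?ltr_wpDr ?nrm_ge0// ler_peMr// lerDl nrm_ge0.
Qed.

Section FixF.
Variable F : C -> C.
Hypothesis hF : hol F.
Hypothesis FA : forall e : R, 0 < e -> exists2 A : R, 0 <= A &
  forall z, nrm (F z) <= A * expR ((pi + e) * nrm z).
Hypothesis F2 : leb.-integrable setT (EFin \o (fun x : R => nrm (F x%:C) ^+ 2)).

(** By the inequality of the means it dominates [F] times a kernel decaying like
    [1 / (1 + |x|)]. *)
Definition Fdom (k : R) (x : R) : R := k * (nrm (F x%:C) ^+ 2 + inv1x2 x).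

Lemma Fdom_ge0 k x : 0 <= k -> 0 <= Fdom k x.
Proof. by move=> k0; rewrite mulr_ge0// addr_ge0 ?sqr_ge0// ltW// inv1x2_gt0. Qed.

Lemma integrable_Fdom k : leb.-integrable setT (EFin \o Fdom k).
Proof.
have := integrableZl measurableT k (integrableD measurableT F2 (@integrable_inv1x2 R)).
exact: eq_integrable.
Qed.

Lemma Fdom_bound x k : 0 <= k -> nrm (F x%:C) * (k / (1 + `|x|)) <= Fdom k x.
Proof.
move=> k0; rewrite /Fdom mulrCA ler_wpM2l//.
have x0 := normr_ge0 x.
set f := nrm _; set s := (1 + `|x|)^-1.
have s2 : s ^+ 2 <= inv1x2 x.
  rewrite /s /inv1x2 exprVn lef_pV2 ?posrE ?exprn_gt0 ?ltr_wpDr ?sqr_ge0//.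
  by rewrite -(real_normK (num_real x)); nra.
have := sqr_ge0 (f - s); have := sqr_ge0 (f + s); nra.
Qed.

Definition pairfun p b z : C := F z * (csinc (p%:C * (z - b)) * (1 - csinc (p%:C * z) ^+ 2)).

Lemma hol_pairfun p b : hol (pairfun p b).
Proof.
apply: holM => //; have hs := etype_hol etype_csinc.
have hid c : hol (fun z => p%:C * (z - c)).
  by apply: holM; [exact: hol_cst|apply: holB; [exact: hol_id|exact: hol_cst]].
apply: holM; first exact: hol_comp (hid b) hs.
apply: holB; first exact: hol_cst.
have hh : hol (fun z => csinc (p%:C * z)).
  by apply: hol_comp hs; apply: holM; [exact: hol_cst|exact: hol_id].
by have := holM hh hh.
Qed.

Lemma pairfun_dom (T : R) b : 0 <= T -> exists2 K : R, 0 <= K &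
  forall p (x : R) u, 1 <= p <= T -> nrm u <= nrm b -> nrm (pairfun p u x%:C) <= Fdom K x.
Proof.
move=> T0; have [K K0 h] := sinc_kernel_bound b T0; exists K => // p x u pT ub.
apply: le_trans (Fdom_bound x K0); rewrite /pairfun nrmM ler_wpM2l ?nrm_ge0//.
exact: h.
Qed.

Lemma L1c_pairfun p b : 1 <= p -> L1c (fun x => pairfun p b x%:C).
Proof.
move=> p1; have p00 : 0 <= p by apply: le_trans p1.
have [K K0 h] := pairfun_dom b p00.
split; first exact: ccont_hol_real (@hol_pairfun p b).
exists (Fdom K); first exact: integrable_Fdom.
by move=> x; apply: h => //; rewrite p1 lexx.
Qed.

Lemma pi_ge1 : 1 <= pi :> R.
Proof. by apply: le_trans (pi_ge2 R); rewrite ler1n. Qed.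

Lemma exp_poly_bound (e y : R) : 0 < e -> 0 <= y -> (1 + y ^+ 2) * expR (- (e * y)) <= (1 + e^-1) * (1 + y).
Proof.
move=> e0 y0; rewrite expRN ler_pdivrMr ?expR_gt0//.
have h : 1 + e * y <= expR (e * y) by exact: expR_ge1Dx.
apply: (@le_trans _ _ ((1 + e^-1) * (1 + y) * (1 + e * y))); last first.
  rewrite ler_wpM2l//; apply: mulr_ge0; apply: addr_ge0 => //.
  by rewrite invr_ge0 ltW.
have ee : e^-1 * e = 1 by rewrite mulVf// gt_eqF.
have ei : 0 < e^-1 by rewrite invr_gt0.
have -> : (1 + e^-1) * (1 + y) * (1 + e * y) = 1 + y + e^-1 + e^-1 * y + e * y + e * y * y + e^-1 * e * y + e^-1 * e * y * y by ring.
rewrite ee !mul1r expr2.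
have t1 : 0 <= e * y := mulr_ge0 (ltW e0) y0.
have t2 : 0 <= e * y * y := mulr_ge0 t1 y0.
have t3 : 0 <= e^-1 * y := mulr_ge0 (ltW ei) y0.
lra.
Qed.

Section FixP.
Variables (p : R) (b : C).
Hypotheses (pp : pi < p) (b0 : b != 0).

Let p0 : 0 < p. Proof. exact: lt_trans (pi_gt0 R) pp. Qed.
Let pC0 : p%:C != 0 :> C. Proof. by apply: realC_neq0; rewrite gt_eqF. Qed.

Let X z : C := Cexp ('i%C * (p%:C * z)).
Let Y z : C := Cexp (- ('i%C * (p%:C * z))).

Let XY z : X z * Y z = 1.
Proof. by rewrite /X /Y CexpN mulfV// Cexp_neq0. Qed.

Let X0 : X 0 = 1. Proof. by rewrite /X !mulr0 Cexp0. Qed.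

Let U z : C := F z * Mfun p (X b) z (X z).
Let V z : C := F z * - Mfun p (Y b) z (Y z).

Let nrmp : nrm p%:C = p. Proof. by rewrite nrmC gtr0_norm. Qed.

Let etX : etype p X.
Proof.
have := etype_comp_lin p%:C ler01 (@etype_expi R); by rewrite nrmp mul1r.
Qed.

Let etY : etype p Y.
Proof.
have := etype_comp_lin p%:C ler01 (@etype_expNi R); by rewrite nrmp mul1r.
Qed.

Let etF : etype p F.
Proof.
split=> //; have [|A A0 h] := FA (e := p - pi); first by rewrite subr_gt0.
by exists A => // z; have := h z; rewrite addrC subrK.
Qed.

Let p00 : 0 <= p := ltW p0.

Let etM c (Z : C -> C) : etype p Z -> etype (2 + (p + (p + p))) (fun z => Mfun p c z (Z z)).
Proof.
move=> eZ; have q0 : 0 <= 2 + (p + (p + p)) by rewrite !addr_ge0.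
have q1 : 2 + p <= 2 + (p + (p + p)) by rewrite lerD2l lerDl addr_ge0.
have q2 : p + (p + p) <= 2 + (p + (p + p)) by rewrite lerDr.
have q3 : p <= 2 + (p + (p + p)) by rewrite addrCA lerDl !addr_ge0.
apply: etypeZ => //; apply: etypeB => //.
  have -> : (fun z => z ^+ 2 * Z z / c) = (fun z => c^-1 * (z * z * Z z)).
    by apply/funext => z; rewrite expr2 mulrC.
  apply: etypeZ => //; apply: (etype_le q1); apply: etypeM => //.
  by apply: (etypeM (@etype_id R) (@etype_id R)).
apply: etypeZ => //; apply: etypeD => //; last first.
  by apply: etypeZ => //; exact: etype_le q3 eZ.
have -> : (fun z => - Z z ^+ 3 / c) = (fun z => - c^-1 * (Z z * (Z z * Z z))).
  by apply/funext => z; rewrite !exprS expr0 mulr1 mulrC mulrN mulNr.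
by apply: etypeZ => //; apply: (etype_le q2); apply: etypeM => //; exact: etypeM.
Qed.

Let split_UV z : z ^+ 2 * (z - b) * pairfun p b z = U z + V z.
Proof.
rewrite /pairfun /U /V.
have -> : z ^+ 2 * (z - b) * (F z * (csinc (p%:C * (z - b)) * (1 - csinc (p%:C * z) ^+ 2))) =
  F z * (p%:C ^- 3 * ((p%:C * (z - b)) * csinc (p%:C * (z - b))) * (p%:C ^+ 2 * z ^+ 2 - ((p%:C * z) * csinc (p%:C * z)) ^+ 2)).
  by field.
rewrite !mul_csinc !CsinE -mulrDr; congr (_ * _).
have -> : Cexp ('i%C * (p%:C * (z - b))) = X z * Y b by rewrite /X /Y -CexpD; congr Cexp; ring.
have -> : Cexp (- ('i%C * (p%:C * (z - b)))) = Y z * X b by rewrite /X /Y -CexpD; congr Cexp; ring.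
rewrite -/(X z) -/(Y z) /Mfun.
have e1 := XY z; have e2 := XY b.
have Xz : X z != 0 by exact: Cexp_neq0.
have Xb : X b != 0 by exact: Cexp_neq0.
have -> : Y z = (X z)^-1 by rewrite /Y CexpN.
have -> : Y b = (X b)^-1 by rewrite /Y CexpN.
clear e1 e2; move: (X z) (X b) Xz Xb => x y x0 y0.
have -> : ((x - x^-1) / (2 * 'i%C)) ^+ 2 = - (x - x^-1) ^+ 2 / 4.
  rewrite expr_div_n exprMn expr2 [in 'i%C ^+ 2]expr2 ii; by field.
by field; rewrite y0 x0 i_neq0 pC0.
Qed.

Let Uray (c : C) : exists2 K : R, 0 <= K & forall w y Z, 0 <= y -> nrm w = y -> nrm Z = expR (- (p * y)) ->
  nrm (F w * Mfun p c w Z) <= K * (1 + y).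
Proof.
have [K K0 MK] := Mfun_bound p c.
(* half of the gap p - pi goes to the growth of F, half to absorb 1 + y ^ 2 *)
pose e := (p - pi) / 2.
have e0 : 0 < e by rewrite divr_gt0// subr_gt0.
have [A A0 hA] := FA e0.
exists (A * K * (1 + e^-1)) => [|w y Z y0 wy Zy].
  by rewrite !mulr_ge0 ?addr_ge0// invr_ge0 ltW.
have Z1 : nrm Z <= 1 by rewrite Zy -expR0 ler_expR oppr_le0 mulr_ge0.
rewrite nrmM; apply: (@le_trans _ _ (A * expR ((pi + e) * y) * (K * (1 + y ^+ 2) * expR (- (p * y))))).
  apply: ler_pM; rewrite ?nrm_ge0//; first by rewrite -wy.
  by have := MK w Z Z1; rewrite wy Zy.
have -> : A * expR ((pi + e) * y) * (K * (1 + y ^+ 2) * expR (- (p * y))) =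
    A * K * ((1 + y ^+ 2) * expR (- (e * y))).
  have -> : - (e * y) = (pi + e) * y + - (p * y) by rewrite /e; field.
  by rewrite expRD; ring.
by rewrite -[leRHS]mulrA ler_wpM2l ?mulr_ge0// exp_poly_bound.
Qed.

Let Ureal' (c : C) : exists2 K : R, 0 <= K & forall (x : R) Z, nrm Z = 1 ->
  nrm (F x%:C * Mfun p c x%:C Z) <= (1 + `|x|) ^+ 3 * Fdom K x.
Proof.
have [K K0 MK] := Mfun_bound p c.
exists K => // x Z Z1; have x0 := normr_ge0 x; rewrite nrmM.
have h := Fdom_bound x K0.
have f0 := nrm_ge0 (F x%:C).
have M1 : nrm (Mfun p c x%:C Z) <= K * (1 + `|x|) ^+ 2.
  have := MK x%:C Z; rewrite Z1 => /(_ (lexx 1)) /le_trans; apply; rewrite mulr1 nrmC.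
  by rewrite ler_wpM2l//; nra.
apply: (@le_trans _ _ (nrm (F x%:C) * (K * (1 + `|x|) ^+ 2))); first by rewrite ler_wpM2l.
have -> : nrm (F x%:C) * (K * (1 + `|x|) ^+ 2) = (1 + `|x|) ^+ 3 * (nrm (F x%:C) * (K / (1 + `|x|))).
  by field; rewrite gt_eqF// ltr_wpDr.
by rewrite ler_wpM2l// exprn_ge0// addr_ge0.
Qed.

Let cderiv_M c : cderiv (fun z => Mfun p c z (X z)) 0
  ((2 * 'i%C * p%:C)^-1 * - ((4 * p%:C ^+ 2)^-1 * ((- (3 / c) + (2 / c + c)) * ('i%C * p%:C)))).
Proof.
have dX : cderiv X 0 ('i%C * p%:C).
  have := hol_cD 0 (etype_hol (etype_exp ('i%C * p%:C))); rewrite cD_exp mulr0 Cexp0 mulr1.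
  by apply: cderiv_eq => z; rewrite /X mulrA.
have d1 := cderivM (cderivM (cderivM (cderiv_id 0) (cderiv_id 0)) dX) (cderiv_cst c^-1 0).
have d2 := cderivM (cderivN (cderivM dX (cderivM dX dX))) (cderiv_cst c^-1 0).
have d3 := cderivZ (2 / c + c) dX.
have := cderivZ (2 * 'i%C * p%:C)^-1 (cderivB d1 (cderivZ (4 * p%:C ^+ 2)^-1 (cderivD d2 d3))).
rewrite X0 => d; have := cderiv_eq (G := fun z => Mfun p c z (X z)) _ d.
move=> /(_ _) dd.
apply: (eq_rect _ (fun l => cderiv _ 0 l) (dd _)).
  by move=> u; rewrite /Mfun; ring.
by congr (_ * _); ring.
Qed.

(** [residue_formula] for the decomposition by [Mfun]. Dilating the kernel by
    [p > pi] makes [e^(i p z)] beat the type of [F] on the imaginary axis with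
    an exponential to spare, as the formula requires. *)
Theorem pairing_dilated :
  2 * p%:C ^+ 3 * b ^+ 2 * CL (fun x => pairfun p b x%:C) =
  pi%:C * (F b * (2 * p%:C ^+ 2 * b ^+ 2 - 1) + F 0 * Ccos (p%:C * b) +
    b * (Ccos (p%:C * b) * cD F 0 - p%:C * Csin (p%:C * b) * F 0)).
Proof.
have [K1 K10 u1] := Uray (X b); have [K2 K20 u2] := Uray (Y b).
have [k1 k10 r1] := Ureal' (X b); have [k2 k20 r2] := Ureal' (Y b).
pose Bd := p + (2 + (p + (p + p))).
have B2 : 1 + 1 <= Bd by rewrite /Bd addrCA lerDl !addr_ge0.
have eU : etype Bd U by apply: etypeM => //; exact: etM.
have eV : etype Bd V.
  by apply: etypeM => //; apply: etypeN; [rewrite !addr_ge0|exact: etM].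
have nX (y : R) : nrm (X ('i%C * y%:C)) = expR (- (p * y)).
  by rewrite /X nrm_Cexp; congr expR; rewrite /=; ring.
have nY (y : R) : nrm (Y (- ('i%C * y%:C))) = expR (- (p * y)).
  by rewrite /Y nrm_Cexp; congr expR; rewrite /=; ring.
have nXr (x : R) : nrm (X x%:C) = 1.
  by rewrite /X -rmorphM nrm_Cexp Re_i_real expR0.
have nYr (x : R) : nrm (Y x%:C) = 1.
  by rewrite /Y -rmorphM -mulrN -rmorphN nrm_Cexp Re_i_real expR0.
have ny (y : R) : 0 <= y -> nrm ('i%C * y%:C) = y by move=> y0; rewrite nrmM nrmi mul1r nrmC ger0_norm.
pose k := k1 + k2.
have k0 : 0 <= k by exact: addr_ge0.
have Fk (k' x : R) : k' <= k -> Fdom k' x <= Fdom k x.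
  by move=> kk; rewrite /Fdom ler_wpM2r// addr_ge0 ?sqr_ge0// ltW// inv1x2_gt0.
have -> : CL (fun x => pairfun p b x%:C) = 2 * 'i%C * pi%:C * (((U b - U 0) / b - cD U 0) / b).
  apply: (residue_formula (V := V) (K := K1 + K2) (m := Fdom k) B2 eU eV (@hol_pairfun p b) b0).
  - exact: addr_ge0.
  - by move=> x; exact: Fdom_ge0.
  - exact: integrable_Fdom.
  - exact: split_UV.
  - move=> y y0; apply: le_trans (u1 _ y _ y0 (ny y y0) (nX y)) _.
    by rewrite ler_wpM2r ?addr_ge0// lerDl.
  - move=> y y0; rewrite /V mulrN nrmN; apply: le_trans (u2 _ y _ y0 _ (nY y)) _.
      by rewrite nrmN ny.
    by rewrite ler_wpM2r ?addr_ge0// lerDr.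
  - move=> x; apply: le_trans (r1 x _ (nXr x)) _; rewrite ler_wpM2l ?exprn_ge0 ?addr_ge0//.
    by apply: Fk; rewrite lerDl.
  - move=> x; rewrite /V mulrN nrmN; apply: le_trans (r2 x _ (nYr x)) _; rewrite ler_wpM2l ?exprn_ge0 ?addr_ge0//.
    by apply: Fk; rewrite lerDr.
  - exact: L1c_pairfun (le_trans pi_ge1 (ltW pp)).
have dU := cD_eq (cderivM (hol_cD 0 hF) (cderiv_M (X b))).
have -> : cD U 0 = cD F 0 * Mfun p (X b) 0 (X 0) + F 0 * ((2 * 'i%C * p%:C)^-1 * - ((4 * p%:C ^+ 2)^-1 * ((- (3 / X b) + (2 / X b + X b)) * ('i%C * p%:C)))).
  exact: dU.
clear dU; rewrite /U X0 CcosE CsinE -/(X b) -/(Y b).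
have -> : Y b = (X b)^-1 by rewrite /Y CexpN.
have Xb : X b != 0 by exact: Cexp_neq0.
rewrite /Mfun; move: (X b) Xb => x x0.
rewrite (_ : (x - x^-1) / (2 * 'i%C) = - 'i%C * (x - x^-1) / 2); last first.
  have -> : - 'i%C = 'i%C^-1 :> C.
    by apply: (mulfI i_neq0); rewrite mulrN ii opprK divff// i_neq0.
  by field; rewrite x0 i_neq0.
by field; rewrite ?x0 ?b0 ?pC0 ?i_neq0.
Qed.

End FixP.
End FixF.
End Pairing.

(** * The pairing at the critical dilation *)

Section Limits.
Context {R : realType}.
Notation C := R[i].
Notation leb := (@lebesgue_measure R).
Implicit Types (F G : C -> C) (z w c b : C) (p : R).

Lemma Rdct (fn : nat -> R -> R) (f g : R -> R) : (forall n, continuous (fn n)) -> continuous f ->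
  leb.-integrable setT (EFin \o g) -> (forall n x, `|fn n x| <= g x) ->
  (forall x, fn n x @[n --> \oo] --> f x) ->
  \int[leb]_x fn n x @[n --> \oo] --> \int[leb]_x f x.
Proof.
move=> cfn cf ig fg ff.
have [|||//||] := @dominated_convergence _ _ _ leb setT measurableT
  (fun n x => (fn n x)%:E) (EFin \o f) (EFin \o g).
- by move=> n; exact: cont_measT.
- exact: cont_measT.
- by apply: aeW => x _; apply: cvg_EFin; [near=> n|exact: ff].
- by apply: aeW => x n _; rewrite /= lee_fin.
move=> intf _; rewrite -[X in _ --> X -> _]fineK; last exact: integrable_fin_num intf.
by move=> /fine_cvg; rewrite /Rintegral; apply.
Unshelve. all: end_near. Qed.

Lemma CL_dct (fn : nat -> R -> C) (f : R -> C) (g : R -> R) : (forall n, ccont (fn n)) -> ccont f ->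
  leb.-integrable setT (EFin \o g) -> (forall n x, nrm (fn n x) <= g x) ->
  (forall x, ctends (fun n => fn n x) (f x)) ->
  ctends (fun n => CL (fn n)) (CL f).
Proof.
move=> cfn /ccontP[cf1 cf2] ig fg ff.
have c1 n : continuous (fun x => complex.Re (fn n x)) by have /ccontP[] := cfn n.
have c2 n : continuous (fun x => complex.Im (fn n x)) by have /ccontP[] := cfn n.
split.
- apply: (Rdct c1 cf1 ig) => [n x|x]; first exact: le_trans (Re_le_nrm _) (fg n x).
  by have [] := ff x.
- apply: (Rdct c2 cf2 ig) => [n x|x]; first exact: le_trans (Im_le_nrm _) (fg n x).
  by have [] := ff x.
Qed.

Lemma ctends_uniq (s : nat -> C) l1 l2 : ctends s l1 -> ctends s l2 -> l1 = l2.
Proof.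
move=> [a1 b1] [a2 b2]; apply: complexP.
  by have := cvg_unique _ a1 a2; apply.
by have := cvg_unique _ b1 b2; apply.
Qed.

Lemma ctends_eq (s t : nat -> C) l : (forall n, s n = t n) -> ctends s l -> ctends t l.
Proof. by move=> /funext ->. Qed.

Lemma ctends_cst c : ctends (fun=> c) c.
Proof. by split; exact: cvg_cst. Qed.

Lemma ctendsM (s1 s2 : nat -> C) (l1 l2 : C) : ctends s1 l1 -> ctends s2 l2 -> ctends (fun n => s1 n * s2 n) (l1 * l2).
Proof.
move=> [a1 b1] [a2 b2]; split.
- by under eq_fun do rewrite cReM; rewrite cReM; apply: cvgB; exact: cvgM.
- by under eq_fun do rewrite cImM; rewrite cImM; apply: cvgD; exact: cvgM.
Qed.

Lemma ctends_ccont (f : R -> C) (r : nat -> R) (r0 : R) : ccont f -> r n @[n --> \oo] --> r0 ->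
  ctends (fun n => f (r n)) (f r0).
Proof.
move=> /ccontP[c1 c2] rr; split.
- exact: (cvg_comp _ _ rr (c1 r0)).
- exact: (cvg_comp _ _ rr (c2 r0)).
Qed.

Lemma ctends_small (s : nat -> C) l : (forall e : R, 0 < e -> exists N, forall n, (N <= n)%N -> nrm (s n - l) <= e) ->
  ctends s l.
Proof.
move=> H; split; apply/cvgrPdist_le => e e0; have [N HN] := H e e0; near=> n;
  (have Nn : (N <= n)%N by near: n; exists N); rewrite distrC; apply: le_trans (HN n Nn).
- by have := Re_le_nrm (s n - l); case: (s n) l {H HN} => ? ? [].
- by have := Im_le_nrm (s n - l); case: (s n) l {H HN} => ? ? [].
Unshelve. all: end_near. Qed.

Definition step (n : nat) : R := n.+1%:R^-1.

Lemma step_gt0 n : 0 < step n.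
Proof. by rewrite invr_gt0 ltr0n. Qed.

Lemma step_le1 n : step n <= 1.
Proof. by rewrite /step invf_le1 ?ltr0n// ler1n. Qed.

Lemma step_cvg : step n @[n --> \oo] --> (0 : R).
Proof. exact: cvg_harmonic. Qed.

Lemma step_small (d : R) : 0 < d -> exists N, forall n, (N <= n)%N -> step n < d.
Proof.
move=> d0; exists (Num.bound d^-1) => n Nn; rewrite /step -[ltRHS]invrK ltf_pV2 ?posrE ?invr_gt0 ?ltr0n//.
apply: (@lt_le_trans _ _ (Num.bound d^-1)%:R); first by rewrite archi_boundP// invr_ge0 ltW.
by rewrite ler_nat ltnW.
Qed.

(** Differentiation along the sequence [c / (n + 1)], the form to which dominated
    convergence applies. *)
Lemma cderiv_seq F z l c : cderiv F z l ->
  ctends (fun n => (step n)%:C^-1 * (F (z + c * (step n)%:C) - F z)) (c * l).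
Proof.
move=> dF; apply: ctends_small => e e0.
have c0 := nrm_ge0 c; have e' : 0 < e / (nrm c + 1) by rewrite divr_gt0//; lra.
have [d d0 H] := dF _ e'.
have [N HN] := step_small (divr_gt0 d0 (ltr_wpDl c0 ltr01)).
exists N => n Nn; have s0 := step_gt0 n; have ss := HN n Nn.
have sC : (step n)%:C != 0 :> C by apply: realC_neq0; rewrite gt_eqF.
have hn : nrm (c * (step n)%:C) = nrm c * step n by rewrite nrmM nrmC gtr0_norm.
have := H (c * (step n)%:C); rewrite hn.
have -> : nrm c * step n < d.
  move: ss; rewrite ltr_pdivlMr; last by lra.
  by apply: le_lt_trans; rewrite mulrC ler_wpM2l ?(ltW s0)//; lra.
move=> /(_ isT) h.
rewrite (_ : _ - _ = (step n)%:C^-1 * (F (z + c * (step n)%:C) - F z - l * (c * (step n)%:C))); last by field.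
rewrite nrmM nrmV nrmC gtr0_norm// mulrC ler_pdivrMr//; apply: le_trans h _.
rewrite mulrA ler_wpM2r ?(ltW s0)// mulrAC ler_pdivrMr; last by lra.
by rewrite ler_wpM2l ?(ltW e0)//; lra.
Qed.

Section FixF.
Variable F : C -> C.
Hypothesis hF : hol F.
Hypothesis FA : forall e : R, 0 < e -> exists2 A : R, 0 <= A &
  forall z, nrm (F z) <= A * expR ((pi + e) * nrm z).
Hypothesis F2 : leb.-integrable setT (EFin \o (fun x : R => nrm (F x%:C) ^+ 2)).

(** What the pairing with the shifted kernel computes, up to [2 p^2 b^2]: the
    residues at [b] and at the double point 0. *)
Definition pairnum p b : C := F b * (2 * p%:C ^+ 2 * b ^+ 2 - 1) + F 0 * Ccos (p%:C * b) +
    b * (Ccos (p%:C * b) * cD F 0 - p%:C * Csin (p%:C * b) * F 0).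

Let pi_step n : pi < pi + step n :> R.
Proof. by rewrite ltrDl step_gt0. Qed.

Let pC0 : pi%:C != 0 :> C.
Proof. by apply: realC_neq0; rewrite gt_eqF// pi_gt0. Qed.

(** Both sides of [pairing_dilated] are continuous in the dilation, so it may be
    let down to [pi]; the kernels are dominated uniformly. *)
Theorem pairing b : b != 0 ->
  2 * pi%:C ^+ 2 * b ^+ 2 * CL (fun x => pairfun F pi b x%:C) = pairnum pi b.
Proof.
move=> b0; apply: (mulfI pC0).
have rn : pi + step n @[n --> \oo] --> (pi : R).
  by rewrite -[X in _ --> X]addr0; apply: cvgD; [exact: cvg_cst|exact: step_cvg].
have cid : ccont (fun p : R => p%:C) by apply: ccont_real => x; exact: cvg_id.
have T0 : 0 <= pi + 1 :> R by rewrite addr_ge0// pi_ge0.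
have [K K0 dom] := pairfun_dom F b T0.
have hs := etype_hol (@etype_csinc R).
have L1 : ctends (fun n => CL (fun x => pairfun F (pi + step n) b x%:C)) (CL (fun x => pairfun F pi b x%:C)).
  apply: (CL_dct (g := Fdom F K)).
  - by move=> n; apply: ccont_hol_real; exact: hol_pairfun.
  - by apply: ccont_hol_real; exact: hol_pairfun.
  - exact: integrable_Fdom.
  - move=> n x; apply: dom => //; rewrite lerD2l step_le1 andbT.
    by apply: le_trans pi_ge1 _; rewrite lerDl ltW// step_gt0.
  - move=> x; apply: (ctends_ccont (f := fun p => pairfun F p b x%:C)) rn.
    apply: ccontM; first exact: ccont_cst.
    have cs c : ccont (fun p : R => csinc (p%:C * c)).
      by apply: (ccont_hol hs); apply: ccontM => //; exact: ccont_cst.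
    apply: ccontM; first exact: cs.
    apply: ccontB; first exact: ccont_cst.
    by have := ccontM (cs x%:C) (cs x%:C).
have cX k : ccont (fun p : R => p%:C ^+ k).
  elim: k => [|k IH]; first exact: ccont_cst.
  by have := ccontM cid IH; under [X in ccont X -> _]eq_fun do rewrite -exprS.
have ccos : ccont (fun p : R => Ccos (p%:C * b)).
  by apply: (ccont_hol (etype_hol (@etype_cos R))); apply: ccontM => //; exact: ccont_cst.
have csin : ccont (fun p : R => Csin (p%:C * b)).
  by apply: (ccont_hol (etype_hol (@etype_sin R))); apply: ccontM => //; exact: ccont_cst.
have cnum : ccont (fun p => pairnum p b).
  apply: ccontD; first apply: ccontD.
  - apply: ccontM; first exact: ccont_cst.
    apply: ccontB; last exact: ccont_cst.
    by apply: ccontM; [apply: ccontM; [exact: ccont_cst|exact: cX]|exact: ccont_cst].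
  - by apply: ccontM => //; exact: ccont_cst.
  - apply: ccontM; first exact: ccont_cst.
    apply: ccontB; first by apply: ccontM => //; exact: ccont_cst.
    by apply: ccontM; [apply: ccontM|exact: ccont_cst].
have cl : ccont (fun p : R => 2 * p%:C ^+ 3 * b ^+ 2).
  by apply: ccontM; [apply: ccontM; [exact: ccont_cst|exact: cX]|exact: ccont_cst].
have A1 := ctendsM (ctends_ccont cl rn) L1.
have A2 := ctendsM (ctends_cst pi%:C) (ctends_ccont cnum rn).
have E n : 2 * (pi + step n)%:C ^+ 3 * b ^+ 2 * CL (fun x => pairfun F (pi + step n) b x%:C) = pi%:C * pairnum (pi + step n) b.
  exact: pairing_dilated.
have := ctends_uniq (ctends_eq E A1) A2; move=> <-.
by ring.
Qed.

End FixF.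
End Limits.

(** * Entire functions and removable singularities *)

Section Bridge.
Context {R : realType}.
Notation C := R[i].
Implicit Types (F G : C -> C) (z w l : C).

Lemma derivable_cderiv F z : derivable (F : C^o -> C^o) (z : C^o) 1 <-> exists l, cderiv F z l.
Proof.
split=> [dF|[l /cderivP[]]//]; exists ('D_1 (F : C^o -> C^o) (z : C^o)).
by apply/cderivP; exact: DeriveDef.
Qed.

Lemma entire_hol F : entire F <-> hol F.
Proof. by split => H z; apply/derivable_cderiv; exact: H. Qed.

Lemma hol_cvg F z : hol F -> (F u : C^o) @[u --> (z : C^o)^'] --> (F z : C^o).
Proof.
move=> hF; apply/cvg_dnbhs => e e0.
have [d d0 H] := cderiv_lip (hol_cD z hF).
set L := nrm (cD F z) + 1 in H.
have L0 : 0 < L by rewrite /L; have := nrm_ge0 (cD F z); lra.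
exists (Num.min d (e / L)) => [|h]; first by rewrite lt_min d0 divr_gt0.
rewrite lt_min => /and3P[_ h1 h2]; apply: le_trans (H h h1) _.
by rewrite mulrC -ler_pdivlMr// ltW.
Qed.

(** Removable singularities are filled in by any entire function that agrees
    nearby. *)
Lemma lim_dnbhs F G z (r : R) : hol G -> 0 < r -> (forall h, 0 < nrm h < r -> F (z + h) = G (z + h)) ->
  lim ((F u : C^o) @[u --> (z : C^o)^']) = G z.
Proof.
move=> hG r0 FG; apply/cvg_lim => //; apply/cvg_dnbhs => e e0.
have /cvg_dnbhs/(_ e e0)[d d0 H] := hol_cvg (z := z) hG.
exists (Num.min r d) => [|h]; first by rewrite lt_min r0.
by rewrite lt_min => /and3P[h0 h1 h2]; rewrite FG ?h0//; apply: H; rewrite h0.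
Qed.

End Bridge.

(** * Pairing with sine kernels and their derivatives *)

Section Weighted.
Context {R : realType}.
Notation C := R[i].
Notation leb := (@lebesgue_measure R).
Implicit Types (F k : C -> C) (z w c b u : C) (p x : R).

(** The Paley-Wiener kernel and its derivative in the parameter [u]. *)
Definition sinck u z : C := csinc (pi%:C * (z - u)).
Definition dsinck u z : C := pi%:C * -1 * cD (@csinc R) (pi%:C * (z - u)).

Lemma cderiv_shift z u : cderiv (fun v => sinck v z) u (dsinck u z).
Proof.
rewrite /dsinck mulrC; apply: (cderiv_comp (F := fun v => pi%:C * (z - v))).
  apply: cderivZ; rewrite -[X in cderiv _ _ X]sub0r.
  by apply: cderivB; [exact: cderiv_cst|exact: cderiv_id].
exact: hol_cD (etype_hol (@etype_csinc R)).
Qed.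

Lemma strip_decay_cD : strip_decay (cD (@csinc R)).
Proof.
move=> Y0 Y00; have Y1 : 0 <= Y0 + 1 by rewrite addr_ge0.
have [K K0 h] := csinc_bound Y1.
exists (6 * K) => [|w wY]; first by rewrite mulr_ge0.
have hs := etype_hol (@etype_csinc R).
rewrite Cauchy_derivative//.
have w0 := nrm_ge0 w.
have w1 : 0 < 1 + nrm w by lra.
apply: le_trans (circ_le (M := 3 * K / (1 + nrm w)) _ _) _.
- apply: ccontB; last exact: ccont_cst.
  by apply: (ccont_hol hs); apply: ccontD; [exact: ccont_cst|exact: ccont_cis].
- move=> v; apply: le_trans (nrm_sub _ _) _.
  have h1 : nrm (csinc w) <= K / (1 + nrm w) by apply: h; lra.
  have h2 : nrm (csinc (w + cis v)) <= 2 * K / (1 + nrm w).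
    have c1 := nrm_cis v.
    apply: le_trans (h _ _) _.
      rewrite cImD; apply: le_trans (ler_normD _ _) _.
      by have := Im_le_nrm (cis v); lra.
    have d : nrm w <= nrm (w + cis v) + 1.
      by have := nrm_sub (w + cis v) (cis v); rewrite addrK c1.
    have d0 := nrm_ge0 (w + cis v).
    rewrite ler_pdivrMr; last by lra.
    rewrite mulrAC ler_pdivlMr// mulrAC -mulrA [K * _]mulrC.
    have : K * (1 + nrm w) <= K * (2 * (1 + nrm (w + cis v))) by rewrite ler_wpM2l//; lra.
    lra.
  have -> : 3 * K / (1 + nrm w) = 2 * K / (1 + nrm w) + K / (1 + nrm w) by field; rewrite gt_eqF.
  exact: lerD.
- by rewrite le_eqVlt; apply/orP; left; apply/eqP; field; rewrite gt_eqF.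
Qed.

Lemma csinc_real x : csinc x%:C = (sinc x)%:C :> C.
Proof.
rewrite /csinc /sinc Csin_real.
have -> : (x%:C == 0 :> C) = (x == 0) by rewrite eq_complex /= eqxx andbT.
by case: ifP => // _; rewrite fmorph_div.
Qed.

Lemma weight_real x : 1 - csinc (pi%:C * x%:C) ^+ 2 = (mu_density x)%:C :> C.
Proof. by rewrite -rmorphM csinc_real /mu_density rmorphB rmorph1 rmorphXn. Qed.

Lemma mu_density_le1 x : mu_density x <= 1.
Proof. by rewrite /mu_density gerBl sqr_ge0. Qed.

Lemma nrm_density x : nrm (mu_density x)%:C <= 1.
Proof. by rewrite nrmC ger0_norm ?mu_density_ge0// mu_density_le1. Qed.

Lemma ccont_density : ccont (fun x => (mu_density x)%:C : C).
Proof.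
have hs := etype_hol (@etype_csinc R).
have c1 : ccont (fun x => csinc (pi%:C * x%:C : C)).
  apply: (ccont_hol hs); apply: ccontM; first exact: ccont_cst.
  by apply: ccont_real => x; exact: cvg_id.
have := ccontB (ccont_cst 1) (ccontM c1 c1).
by under [X in ccont X -> _]eq_fun do rewrite -expr2 weight_real.
Qed.

(** The space as it is used: square integrability for Lebesgue measure instead
    of [mu], and a nonnegative constant in the growth condition. *)
Definition PW F := [/\ hol F,
  forall e : R, 0 < e -> exists2 A : R, 0 <= A & forall z, nrm (F z) <= A * expR ((pi + e) * nrm z) &
  leb.-integrable setT (EFin \o (fun x : R => nrm (F x%:C) ^+ 2))].

Definition kdecay k := hol k /\ exists2 K : R, 0 <= K & forall x : R, nrm (k x%:C) <= K / (1 + `|x|).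

Lemma kdecayD k1 k2 : kdecay k1 -> kdecay k2 -> kdecay (fun z => k1 z + k2 z).
Proof.
move=> [h1 [K1 K10 b1]] [h2 [K2 K20 b2]]; split; first exact: holD.
exists (K1 + K2); first exact: addr_ge0.
by move=> x; apply: le_trans (nrmD _ _) _; rewrite mulrDl lerD.
Qed.

Lemma kdecayZ c k : kdecay k -> kdecay (fun z => c * k z).
Proof.
move=> [h1 [K1 K10 b1]]; split; first by apply: holM => //; exact: hol_cst.
exists (nrm c * K1); first by rewrite mulr_ge0 ?nrm_ge0.
by move=> x; rewrite nrmM -mulrA ler_wpM2l ?nrm_ge0.
Qed.

Let pi_range : 1 <= (pi : R) <= pi.
Proof. by rewrite lexx andbT; exact: pi_ge1. Qed.

Let hol_lin u : hol (fun z => pi%:C * (z - u)).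
Proof. by apply: holM; [exact: hol_cst|apply: holB; [exact: hol_id|exact: hol_cst]]. Qed.

Lemma kdecay_shift u : kdecay (sinck u).
Proof.
split; first exact: hol_comp (hol_lin u) (etype_hol (@etype_csinc R)).
have [K K0 h] := strip_decay_shift csinc_bound (nrm_ge0 u) (pi_ge0 R).
by exists K => // x; exact: h.
Qed.

Lemma dshift_decay (r : R) : 0 <= r -> exists2 K : R, 0 <= K & forall u x, nrm u <= r ->
  nrm (dsinck u x%:C) <= K / (1 + `|x|).
Proof.
move=> r0; have [K K0 h] := strip_decay_shift strip_decay_cD r0 (pi_ge0 R).
exists (nrm (pi%:C * -1 : C) * K) => [|u x ur]; first by rewrite mulr_ge0 ?nrm_ge0.
by rewrite /dsinck nrmM -mulrA ler_wpM2l ?nrm_ge0//; apply: h.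
Qed.

Lemma kdecay_dshift u : kdecay (dsinck u).
Proof.
split; last by have [K K0 h] := dshift_decay (nrm_ge0 u); exists K => // x; exact: h.
apply: holM; first exact: hol_cst.
exact: hol_comp (hol_lin u) (etype_hol (etype_cD ler01 (@etype_csinc R))).
Qed.

(** The bilinear form behind the inner product: no conjugate, so that it is
    linear in the kernel and holomorphic in its parameter. *)
Definition wpair F k : C := CL (fun x => F x%:C * (k x%:C * (mu_density x)%:C)).

Lemma wpair_dom F k (K : R) x : 0 <= K -> nrm (k x%:C) <= K / (1 + `|x|) ->
  nrm (F x%:C * (k x%:C * (mu_density x)%:C)) <= Fdom F K x.
Proof.
move=> K0 kx; apply: le_trans (Fdom_bound F x K0); rewrite nrmM ler_wpM2l ?nrm_ge0//.
rewrite nrmM; apply: le_trans kx; rewrite ler_piMr ?nrm_ge0//; exact: nrm_density.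
Qed.

Lemma L1c_wpair F k : PW F -> kdecay k -> L1c (fun x => F x%:C * (k x%:C * (mu_density x)%:C)).
Proof.
move=> [hF _ F2] [hk [K K0 kb]]; split.
  apply: ccontM; first exact: ccont_hol_real.
  by apply: ccontM; [exact: ccont_hol_real|exact: ccont_density].
exists (Fdom F K); first exact: integrable_Fdom.
by move=> x; exact: wpair_dom.
Qed.

Lemma wpairD F k1 k2 : PW F -> kdecay k1 -> kdecay k2 ->
  wpair F (fun z => k1 z + k2 z) = wpair F k1 + wpair F k2.
Proof.
move=> pF h1 h2; rewrite /wpair -(CLD (L1c_wpair pF h1) (L1c_wpair pF h2)).
by apply: eq_CL => x; ring.
Qed.

Lemma wpairZ F c k : PW F -> kdecay k -> wpair F (fun z => c * k z) = c * wpair F k.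
Proof.
move=> pF h1; rewrite /wpair -(CLZ c (L1c_wpair pF h1)).
by apply: eq_CL => x; ring.
Qed.

Theorem wpair_shift F b : PW F -> b != 0 ->
  2 * pi%:C ^+ 2 * b ^+ 2 * wpair F (sinck b) = pairnum F pi b.
Proof.
move=> [hF FA F2] b0; rewrite -pairing//; congr (_ * _); apply: eq_CL => x.
by rewrite /pairfun /sinck weight_real.
Qed.

(** The pairing with [sinck u] is known for all [u] by [wpair_shift];
    differentiate in [u] under the integral, along the sequence
    [w0 + w0 / (n + 1)], which avoids [u = 0]. *)
Theorem wpair_dshift F (w0 l : C) : PW F -> w0 != 0 ->
  cderiv (fun u => pairnum F pi u * (2 * pi%:C ^+ 2 * u ^+ 2)^-1) w0 l -> wpair F (dsinck w0) = l.
Proof.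
move=> pF w00 dR; have [hF FA F2] := pF.
have pC0 : pi%:C != 0 :> C by apply: realC_neq0; rewrite gt_eqF// pi_gt0.
have shE u : u != 0 -> wpair F (sinck u) = pairnum F pi u * (2 * pi%:C ^+ 2 * u ^+ 2)^-1.
  move=> u0; rewrite -(wpair_shift pF u0) mulrC mulrA mulVf ?mul1r//.
  by rewrite !mulf_neq0// ?expf_neq0// pnatr_eq0.
(* real multiples of w0, so none of the parameters is 0 *)
pose un n := w0 + w0 * (step n)%:C.
have un0 n : un n != 0.
  have -> : un n = w0 * (1 + step n)%:C by rewrite /un rmorphD rmorph1; ring.
  rewrite mulf_neq0//; apply: realC_neq0; rewrite gt_eqF//.
  by have := @step_gt0 R n; lra.
have t1 := cderiv_seq w0 dR.
pose q n z := (step n)%:C^-1 * (sinck (un n) z - sinck w0 z).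
have kq n : kdecay (q n).
  apply: kdecayZ; apply: kdecayD; first exact: kdecay_shift.
  have := kdecayZ (-1) (kdecay_shift w0); by under [X in kdecay X -> _]eq_fun do rewrite mulN1r.
have qE n : wpair F (q n) = (step n)%:C^-1 * (pairnum F pi (un n) * (2 * pi%:C ^+ 2 * un n ^+ 2)^-1 - pairnum F pi w0 * (2 * pi%:C ^+ 2 * w0 ^+ 2)^-1).
  rewrite -!shE// /q.
  have nk : kdecay (fun z => (-1) * sinck w0 z) by apply: kdecayZ; exact: kdecay_shift.
  rewrite wpairZ//; last first.
    by have := kdecayD (kdecay_shift (un n)) nk; under [X in kdecay X -> _]eq_fun do rewrite mulN1r.
  congr (_ * _); rewrite -[X in _ = _ + X]mulN1r -wpairZ//; last exact: kdecay_shift.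
  rewrite -wpairD//; last exact: kdecay_shift.
  by apply: eq_CL => x; rewrite mulN1r.
have n0 := nrm_ge0 w0.
have [K K0 dK] := dshift_decay (mulr_ge0 (ler0n R 2) n0).
have t2 : ctends (fun n => wpair F (q n)) (wpair F (fun z => w0 * dsinck w0 z)).
  apply: (CL_dct (g := Fdom F (2 * K * nrm w0))).
  - by move=> n; exact: L1c_ccont (L1c_wpair pF (kq n)).
  - have kd : kdecay (fun z => w0 * dsinck w0 z) by apply: kdecayZ; exact: kdecay_dshift.
    exact: L1c_ccont (L1c_wpair pF kd).
  - exact: integrable_Fdom.
  - move=> n x; apply: wpair_dom; first by rewrite !mulr_ge0.
    have s0 := @step_gt0 R n.
    rewrite /q nrmM nrmV nrmC gtr0_norm// mulrC ler_pdivrMr//.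
    have x1 : 0 < 1 + `|x| by have := normr_ge0 x; lra.
    have := cderiv_mvi (F := fun u => sinck u x%:C) (F' := fun u => dsinck u x%:C) (z := w0) (h := w0 * (step n)%:C) (M := K / (1 + `|x|)).
    move=> /(_ (fun u => cderiv_shift _ u)) /(_ _) H; apply: le_trans (H _) _; last first.
      rewrite nrmM nrmC (gtr0_norm s0) le_eqVlt; apply/orP; left; apply/eqP; field; by rewrite gt_eqF.
    move=> t /andP[t0 t1']; apply: dK; apply: le_trans (nrmD _ _) _.
    rewrite !nrmM !nrmC (gtr0_norm s0) (ger0_norm t0).
    have : nrm w0 * step n * t <= nrm w0 * 1 * 1.
      apply: ler_pM; rewrite ?mulr_ge0 ?(ltW s0)//.
      by rewrite ler_wpM2l// step_le1.
    lra.
  - move=> x; apply: ctendsM; first exact: ctends_cst.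
    apply: ctendsM; last exact: ctends_cst.
    exact: cderiv_seq (cderiv_shift x%:C w0).
have t3 := ctends_uniq (ctends_eq qE t2) t1.
rewrite wpairZ// in t3; last exact: kdecay_dshift.
exact: (mulfI w00).
Qed.

End Weighted.

(** * Values of a function as pairings *)

Section Representation.
Context {R : realType}.
Notation C := R[i].
Implicit Types (F k : C -> C) (z w c b u : C) (p x : R).

(** The positive solution of [2 pi^2 w^2 = 1]; [rhalf] is [pi] times it. Both are
    locked like [tau]. *)
Definition crit : R := locked (pi * Num.sqrt 2)^-1.
Definition rhalf : R := locked (Num.sqrt 2)^-1.

Lemma critE : crit = (pi * Num.sqrt 2)^-1. Proof. by rewrite /crit -lock. Qed.
Lemma rhalfE : rhalf = (Num.sqrt 2)^-1. Proof. by rewrite /rhalf -lock. Qed.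

Lemma sqrt2_sqr : Num.sqrt 2 ^+ 2 = 2 :> R. Proof. by rewrite sqr_sqrtr. Qed.

Lemma crit_gt0 : 0 < crit.
Proof. by rewrite critE invr_gt0 mulr_gt0 ?pi_gt0// sqrtr_gt0. Qed.

Lemma rhalf_gt0 : 0 < rhalf. Proof. by rewrite rhalfE invr_gt0 sqrtr_gt0. Qed.

Lemma rhalf_sqr : 2 * rhalf ^+ 2 = 1.
Proof. by rewrite rhalfE exprVn sqrt2_sqr mulfV. Qed.

Lemma pi_crit : pi * crit = rhalf.
Proof. by rewrite critE rhalfE invfM mulrA mulfV ?mul1r// gt_eqF// pi_gt0. Qed.

Lemma cos_rhalf_gt : 1 / 2 < cos rhalf.
Proof.
have q0 := rhalf_gt0; have q2 := rhalf_sqr.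
have -> : cos rhalf = 1 - 2 * sin (rhalf / 2) ^+ 2.
  have := cosD (rhalf / 2) (rhalf / 2); rewrite -splitr => ->.
  by rewrite -!expr2 cos2sin2; ring.
have := abs_sin_le (rhalf / 2); rewrite (ger0_norm (x := rhalf / 2)); last by lra.
rewrite -(@ler_pXn2r _ 2)//; last by rewrite nnegrE; lra.
rewrite real_normK ?num_real// exprMn; lra.
Qed.

Lemma cos_rhalf_neq0 : cos rhalf != 0.
Proof. by rewrite gt_eqF//; have := cos_rhalf_gt; lra. Qed.

Lemma cosB_rhalf_neq0 : cos rhalf - rhalf * sin rhalf != 0.
Proof.
have q0 := rhalf_gt0; have q2 := rhalf_sqr; have h := cos_rhalf_gt.
have := abs_sin_le rhalf; rewrite (ger0_norm (ltW q0)) => s.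
have := ler_norm (sin rhalf) => s'.
rewrite gt_eqF//; nra.
Qed.

Lemma crit_sqr : 2 * pi%:C ^+ 2 * crit%:C ^+ 2 = 1 :> C.
Proof.
have -> : 2 * pi%:C ^+ 2 * crit%:C ^+ 2 = (2 * (pi * crit) ^+ 2)%:C :> C.
  by rewrite rmorphM rmorph_nat rmorphXn/= rmorphM; ring.
by rewrite pi_crit rhalf_sqr.
Qed.

Lemma one_sub_sqr w : 1 - 2 * pi%:C ^+ 2 * w ^+ 2 = - (2 * pi%:C ^+ 2) * (w - crit%:C) * (w + crit%:C).
Proof. by rewrite -[X in X - _ = _]crit_sqr; ring. Qed.

(** The exceptional points are those at which the value [F w] drops out of
    [pairnum F pi w]. *)
Lemma exceptionalE w : exceptional w = (1 - 2 * pi%:C ^+ 2 * w ^+ 2 == 0).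
Proof.
rewrite one_sub_sqr !mulf_eq0 oppr_eq0 mulf_eq0 expf_eq0 pnatr_eq0/=.
have -> : (pi%:C == 0 :> C) = false by apply/negbTE/realC_neq0; rewrite gt_eqF// pi_gt0.
by rewrite /exceptional -critE subr_eq0 addr_eq0.
Qed.

Lemma cos_rhalfC_neq0 : (cos rhalf)%:C != 0 :> C.
Proof. exact/realC_neq0/cos_rhalf_neq0. Qed.

Lemma cosB_rhalfC_neq0 : (cos rhalf - rhalf * sin rhalf)%:C != 0 :> C.
Proof. exact/realC_neq0/cosB_rhalf_neq0. Qed.

Lemma critC_neq0 : crit%:C != 0 :> C.
Proof. by apply: realC_neq0; rewrite gt_eqF// crit_gt0. Qed.

Lemma piC_neq0 : pi%:C != 0 :> C.
Proof. by apply: realC_neq0; rewrite gt_eqF// pi_gt0. Qed.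

Lemma CcosN z : Ccos (- z) = Ccos z.
Proof. by rewrite !CcosE mulrN opprK addrC. Qed.

Lemma CsinN z : Csin (- z) = - Csin z.
Proof. by rewrite !CsinE mulrN opprK -[RHS]mulNr opprB. Qed.

Lemma pi_critC : pi%:C * crit%:C = rhalf%:C :> C.
Proof. by rewrite -rmorphM pi_crit. Qed.

Lemma Ccos_crit : Ccos (pi%:C * crit%:C) = (cos rhalf)%:C :> C.
Proof. by rewrite pi_critC Ccos_real. Qed.

Lemma Csin_crit : Csin (pi%:C * crit%:C) = (sin rhalf)%:C :> C.
Proof. by rewrite pi_critC Csin_real. Qed.

Lemma cosB_rhalfC : (cos rhalf - rhalf * sin rhalf)%:C = (cos rhalf)%:C - pi%:C * crit%:C * (sin rhalf)%:C :> C.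
Proof. by rewrite pi_critC -[rhalf%:C * _]rmorphM -rmorphB. Qed.

(** At the critical points the pairing only sees [F 0] and [F' 0], and the two of
    them determine these values. *)
Lemma wpair_crit F : PW F -> wpair F (sinck crit%:C) =
  F 0 * (cos rhalf - rhalf * sin rhalf)%:C + crit%:C * cD F 0 * (cos rhalf)%:C.
Proof.
move=> pF; have := wpair_shift pF critC_neq0; rewrite crit_sqr mul1r => ->.
rewrite /pairnum crit_sqr Ccos_crit Csin_crit cosB_rhalfC.
ring.
Qed.

Lemma wpair_critN F : PW F -> wpair F (sinck (- crit%:C)) =
  F 0 * (cos rhalf - rhalf * sin rhalf)%:C - crit%:C * cD F 0 * (cos rhalf)%:C.
Proof.
move=> pF; have c0 : - crit%:C != 0 :> C by rewrite oppr_eq0 critC_neq0.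
have := wpair_shift pF c0; rewrite sqrrN crit_sqr mul1r => ->.
rewrite /pairnum sqrrN crit_sqr mulrN CcosN CsinN Ccos_crit Csin_crit cosB_rhalfC.
ring.
Qed.

Lemma value_at0 F : PW F -> F 0 = (2 * (cos rhalf - rhalf * sin rhalf)%:C)^-1 *
  (wpair F (sinck crit%:C) + wpair F (sinck (- crit%:C))).
Proof.
move=> pF; rewrite wpair_crit// wpair_critN//.
by have := cosB_rhalfC_neq0; move: (_%:C) => x x0; field.
Qed.

Lemma slope_at0 F : PW F -> cD F 0 = (2 * crit%:C * (cos rhalf)%:C)^-1 *
  (wpair F (sinck crit%:C) - wpair F (sinck (- crit%:C))).
Proof.
move=> pF; rewrite wpair_crit// wpair_critN//.
by have := cos_rhalfC_neq0; have := critC_neq0; move: crit%:C (cos rhalf)%:C => y x y0 x0; field; rewrite ?x0 ?y0.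
Qed.

Definition coef_shift w : C := (2 * pi%:C ^+ 2 * w ^+ 2) / (2 * pi%:C ^+ 2 * w ^+ 2 - 1).
Definition coef_crit w : C := (kernel_c w + kernel_d w) / 2.
Definition coef_critN w : C := (kernel_c w - kernel_d w) / 2.

(** Solve the pairing formula at [w] for [F w], and replace [F 0] and [F' 0] by
    the pairings at the critical points. The formula also holds at [w = 0],
    where the kernel [sinck w] does not enter. *)
Theorem representation F w : PW F -> ~~ exceptional w ->
  F w = coef_shift w * wpair F (sinck w) + coef_crit w * wpair F (sinck crit%:C) +
        coef_critN w * wpair F (sinck (- crit%:C)).
Proof.
move=> pF; rewrite exceptionalE => ne.
have W : 2 * pi%:C ^+ 2 * w ^+ 2 * wpair F (sinck w) = pairnum F pi w.
  have [->|w0] := eqVneq w 0; last exact: wpair_shift.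
  by rewrite /pairnum expr0n/= !mulr0 Ccos0 !mul0r; ring.
rewrite /coef_shift mulrAC W /coef_crit /coef_critN.
have Dc : kernel_c w = (Ccos (pi%:C * w) - pi%:C * w * Csin (pi%:C * w)) /
  ((1 - 2 * pi%:C ^+ 2 * w ^+ 2) * (cos rhalf - rhalf * sin rhalf)%:C) by rewrite rhalfE.
have Dd : kernel_d w = (w * Ccos (pi%:C * w)) /
  ((1 - 2 * pi%:C ^+ 2 * w ^+ 2) * (crit%:C * (cos rhalf)%:C)).
  rewrite /kernel_d -rhalfE.
  have -> : (Num.sqrt 2 * cos rhalf)%:C = 2 * pi%:C * (crit%:C * (cos rhalf)%:C) :> C.
    have -> : Num.sqrt 2 = 2 * pi * crit :> R.
      have s0 : Num.sqrt 2 != 0 :> R by rewrite sqrtr_eq0 -ltNge.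
      by rewrite -mulrA pi_crit rhalfE -[in X in X / _]sqrt2_sqr expr2 mulfK.
    by rewrite !rmorphM rmorph_nat; ring.
  have := piC_neq0; have := critC_neq0; have := cos_rhalfC_neq0.
  move: (Ccos _) => X; move: crit%:C (cos rhalf)%:C (pi%:C) ne => a c p ne c0 a0 p0.
  by field; rewrite ?ne ?c0 ?a0 ?p0.
rewrite Dc Dd /pairnum (value_at0 pF) (slope_at0 pF).
have := critC_neq0; have := cos_rhalfC_neq0; have := cosB_rhalfC_neq0.
move: (wpair F (sinck crit%:C)) (wpair F (sinck (- crit%:C))) (F w) => I J v.
move: (Ccos _) (Csin _) => X Y; move: (_ - rhalf * _)%:C => e; move: crit%:C (cos rhalf)%:C (pi%:C) ne => a c p ne e0 c0 a0.
have ne' : 2 * p ^+ 2 * w ^+ 2 - 1 != 0 by rewrite -opprB oppr_eq0.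
by field; rewrite ?ne ?ne' ?c0 ?a0 ?e0.
Qed.

Lemma cderiv_val F z l m : cderiv F z l -> l = m -> cderiv F z m.
Proof. by move=> + <-. Qed.

(** Here the coefficient of [F w] vanishes to first order, so it is the derivative
    of the pairing in the parameter that contains [F w], with factor
    [4 pi^2 w]. *)
Theorem representation_exceptional w : exceptional w ->
  exists k : C * C * C, forall F, PW F -> F w = k.1.1 * wpair F (dsinck w) +
    k.1.2 * wpair F (sinck crit%:C) + k.2 * wpair F (sinck (- crit%:C)).
Proof.
rewrite exceptionalE subr_eq0 => /eqP we.
have w0 : w != 0.
  by apply/negP => /eqP w0; move: we; rewrite w0 expr0n/= mulr0 => /eqP; rewrite oner_eq0.
have p0 := piC_neq0.
have D F : PW F -> wpair F (dsinck w) = 4 * pi%:C ^+ 2 * w * F w +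
   (- pi%:C * Csin (pi%:C * w)  - pi%:C * Csin (pi%:C * w) - w * (pi%:C ^+ 2 * Ccos (pi%:C * w))
     - 4 * pi%:C ^+ 2 * w * (Ccos (pi%:C * w) - pi%:C * w * Csin (pi%:C * w))) * F 0 +
   (Ccos (pi%:C * w) - pi%:C * w * Csin (pi%:C * w) - 4 * pi%:C ^+ 2 * w * (w * Ccos (pi%:C * w))) * cD F 0.
  move=> pF; apply: wpair_dshift => //.
  have [hF _ _] := pF.
  have dp : cderiv (fun u => pi%:C * u) w (pi%:C * 1) by apply: cderivZ; exact: cderiv_id.
  have dc := cderiv_comp dp (cderiv_cos _).
  have ds := cderiv_comp dp (cderiv_sin _).
  have d2 : cderiv (fun u => 2 * pi%:C ^+ 2 * u ^+ 2) w (2 * pi%:C ^+ 2 * (1 * w + w * 1)).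
    by apply: cderivZ; apply: cderivM; exact: cderiv_id.
  have T0 : 2 * pi%:C ^+ 2 * w ^+ 2 != 0 by rewrite -we oner_eq0.
  have d2i := cderiv_comp d2 (cderivV T0).
  have dN := cderivD (cderivD (cderivM (hol_cD w hF) (cderivB d2 (cderiv_cst 1 w))) (cderivZ (F 0) dc))
    (cderivM (cderiv_id w) (cderivB (cderivM dc (cderiv_cst (cD F 0) w))
       (cderivM (cderivZ pi%:C ds) (cderiv_cst (F 0) w)))).
  have dR := cderivM dN d2i.
  move: dR; rewrite /pairnum -we => dR.
  apply: cderiv_val dR _; rewrite expr1n !invr1; ring.
pose A0 : C := (- pi%:C * Csin (pi%:C * w)  - pi%:C * Csin (pi%:C * w) - w * (pi%:C ^+ 2 * Ccos (pi%:C * w))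
     - 4 * pi%:C ^+ 2 * w * (Ccos (pi%:C * w) - pi%:C * w * Csin (pi%:C * w))).
pose A1 : C := (Ccos (pi%:C * w) - pi%:C * w * Csin (pi%:C * w) - 4 * pi%:C ^+ 2 * w * (w * Ccos (pi%:C * w))).
pose m : C := (4 * pi%:C ^+ 2 * w)^-1.
pose c1 : C := (2 * (cos rhalf - rhalf * sin rhalf)%:C)^-1.
pose c2 : C := (2 * crit%:C * (cos rhalf)%:C)^-1.
exists (m, - m * (A0 * c1 + A1 * c2), - m * (A0 * c1 - A1 * c2)) => F pF /=.
have m0 : m * (4 * pi%:C ^+ 2 * w) = 1.
  by rewrite mulVf// !mulf_neq0 ?expf_neq0// pnatr_eq0.
have E : F w = m * (wpair F (dsinck w) - A0 * F 0 - A1 * cD F 0).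
  have -> : wpair F (dsinck w) - A0 * F 0 - A1 * cD F 0 = (4 * pi%:C ^+ 2 * w) * F w by rewrite (D F pF) -/A0 -/A1; ring.
  by rewrite mulrA m0 mul1r.
rewrite E (value_at0 pF) (slope_at0 pF) -/c1 -/c2; ring.
Qed.

End Representation.

(** * The kernel functions as combinations of sine kernels *)

Section KernelIdentities.
Context {R : realType}.
Notation C := R[i].
Implicit Types (F G k : C -> C) (z w c b u : C) (p x : R).

Local Notation a := (crit%:C : C).
Local Notation cj := (@conjc R).
Local Notation p0 := (pi%:C : C).

Lemma CsinD z w : Csin (z + w) = Csin z * Ccos w + Ccos z * Csin w.
Proof.
rewrite !CsinE !CcosE mulrDr opprD !CexpD !CexpN.
have := Cexp_neq0 ('i%C * z); have := Cexp_neq0 ('i%C * w).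
move: (Cexp _) (Cexp _) => x y y0 x0; have := @i_neq0 R; move: 'i%C => i i0.
by field; rewrite ?x0 ?y0 ?i0.
Qed.

Lemma mul_sinck u z : p0 * (z - u) * sinck u z = Csin (p0 * z) * Ccos (p0 * u) - Ccos (p0 * z) * Csin (p0 * u).
Proof. by rewrite mul_csinc mulrBr CsinD CcosN CsinN mulrN. Qed.

(** The two exceptional points are [2 crit] apart, hence each is isolated. *)
Lemma near_nonexceptional z h : exceptional z -> 0 < nrm h < crit -> ~~ exceptional (z + h).
Proof.
move=> ez /andP[h0 h1]; have h0' : h != 0 by rewrite -nrm_gt0.
have c0 := @crit_gt0 R.
have n2 : nrm (2 * a) = 2 * crit.
  by rewrite nrmM nrmC (gtr0_norm c0) -(rmorph_nat (real_complex R)) nrmC ger0_norm.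
have far u : nrm u = 2 * crit -> h != u.
  by move=> nu; apply/negP => /eqP hu; move: h1; rewrite hu nu => h1; lra.
have f1 := far _ n2.
have f2 := far (- (2 * a)); rewrite nrmN in f2; move: (f2 n2) => {}f2.
move: ez; rewrite /exceptional -!critE => /orP[] /eqP ->; rewrite negb_or.
  rewrite -[X in _ != X]addr0 (inj_eq (addrI _)) h0'/= -subr_eq0.
  by rewrite (_ : _ - _ = h - - (2 * a)) ?subr_eq0//; ring.
rewrite -[X in _ && (_ != X)]addr0 (inj_eq (addrI _)) h0' andbT -subr_eq0.
by rewrite (_ : _ - _ = h - (2 * a)) ?subr_eq0//; ring.
Qed.

Lemma fill_removableE F G : hol G -> (forall u, ~~ exceptional u -> F u = G u) ->
  fill_removable F = G.
Proof.
move=> hG FG; apply/funext => z; rewrite /fill_removable; case: ifPn => [ez|]; last exact: FG.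
by apply: (lim_dnbhs hG (@crit_gt0 R)) => h hr; apply: FG; exact: near_nonexceptional.
Qed.

Let hol_sinck u : hol (sinck u) := (kdecay_shift u).1.

Let two_pi_crit x : (Num.sqrt 2 * x)%:C = 2 * (p0 * a) * x%:C :> C.
Proof.
rewrite rmorphM; congr (_ * _); rewrite pi_critC -(rmorph_nat (real_complex R)) -rmorphM; congr (_%:C).
have s0 : Num.sqrt 2 != 0 :> R by rewrite sqrtr_eq0 -ltNge.
by apply: (mulIf s0); rewrite -expr2 sqrt2_sqr rhalfE -mulrA mulVf ?mulr1.
Qed.

Let cst_half : hol (fun=> 2^-1 : C). Proof. exact: hol_cst. Qed.

(** [mul_sinck] puts the two sine kernels over the common denominator
    [1 - 2 pi^2 z^2]. *)
Lemma kernel_gE : kernel_g = (fun z => (sinck a z + sinck (- a) z) / 2) :> (C -> C).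
Proof.
apply: fill_removableE => [|z]; first by apply: holM => //; apply: holD.
rewrite exceptionalE => ne; apply: (mulIf ne); rewrite mulfVK//.
have := mul_sinck a z; have := mul_sinck (- a) z.
rewrite one_sub_sqr -rhalfE mulrN CcosN CsinN Ccos_crit Csin_crit two_pi_crit.
move: (sinck a z) (sinck (- a) z) (Ccos _) (Csin _) => s t X Y; move: a p0 => b p h1 h2.
rewrite [RHS](_ : _ = - p * ((z - b) * (p * (z - - b) * t) + (z + b) * (p * (z - b) * s))); last by field.
rewrite h1 h2; ring.
Qed.

Lemma kernel_hE : kernel_h = (fun z => (sinck a z - sinck (- a) z) / 2) :> (C -> C).
Proof.
apply: fill_removableE => [|z]; first by apply: holM => //; apply: holB.
rewrite exceptionalE => ne; apply: (mulIf ne); rewrite mulfVK//.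
have := mul_sinck a z; have := mul_sinck (- a) z.
rewrite one_sub_sqr -rhalfE mulrN CcosN CsinN Ccos_crit Csin_crit two_pi_crit.
move: (sinck a z) (sinck (- a) z) (Ccos _) (Csin _) => s t X Y; move: a p0 => b p h1 h2.
rewrite [RHS](_ : _ = - p * ((z + b) * (p * (z - b) * s) - (z - b) * (p * (z - - b) * t))); last by field.
rewrite h1 h2; ring.
Qed.

Lemma kernel_formulaE w z : kernel_formula w z = coef_shift (cj w) * sinck (cj w) z +
  coef_crit (cj w) * sinck a z + coef_critN (cj w) * sinck (- a) z.
Proof.
rewrite /kernel_formula kernel_gE kernel_hE /kernel_f -/(sinck (cj w) z) -/(coef_shift _).
rewrite /coef_crit /coef_critN; ring.
Qed.

Let cjM z w : (cj (z * w)) = (cj z) * (cj w). Proof. exact: rmorphM. Qed.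
Let cjD z w : (cj (z + w)) = (cj z) + (cj w). Proof. exact: rmorphD. Qed.
Let cjB z w : (cj (z - w)) = (cj z) - (cj w). Proof. exact: rmorphB. Qed.
Let cjN z : (cj (- z)) = - (cj z). Proof. exact: rmorphN. Qed.
Let cjV z : (cj (z^-1)) = ((cj z))^-1. Proof. exact: fmorphV. Qed.
Let cjX z n : (cj (z ^+ n)) = (cj z) ^+ n. Proof. exact: rmorphXn. Qed.
Let cj1 : (cj (1 : C)) = 1. Proof. exact: rmorph1. Qed.

Lemma CexpJ z : Cexp (cj z) = (cj (Cexp z)).
Proof. by case: z => x y; rewrite !CexpE; apply: complexP; rewrite /= ?cosN ?sinN; ring. Qed.

Lemma iJ : (cj ('i%C)) = - 'i%C :> C.
Proof. by apply: complexP; rewrite /= ?oppr0. Qed.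

Let twoJ : (cj (2 : C)) = 2. Proof. exact: (conjc_nat R 2). Qed.

Lemma CcosJ z : Ccos (cj z) = (cj (Ccos z)).
Proof.
rewrite !CcosE cjM cjV twoJ cjD -!CexpJ cjN cjM iJ.
by congr (_ / _); rewrite mulNr opprK addrC.
Qed.

Lemma CsinJ z : Csin (cj z) = (cj (Csin z)).
Proof.
rewrite !CsinE cjM cjV [cj (2 * _)]cjM twoJ cjB -!CexpJ cjN cjM iJ.
by rewrite mulNr opprK mulrN invrN mulrN -mulNr opprB.
Qed.

Lemma csincJ z : csinc (cj z) = (cj (csinc z)).
Proof.
rewrite /csinc conjc_eq0; case: ifP => _; first by rewrite cj1.
by rewrite CsinJ cjM cjV.
Qed.

Lemma sinckJ u z : sinck (cj u) (cj z) = (cj (sinck u z)).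
Proof. by rewrite /sinck -csincJ cjM cjB conjc_real. Qed.

(** Conjugating both the argument and the value preserves holomorphy. *)
Lemma cderivJ F z l : cderiv F z l -> cderiv (fun w => (cj (F (cj w)))) (cj z) (cj l).
Proof.
move=> dF e e0; have [d d0 H] := dF e e0; exists d => // h hd.
rewrite -nrm_conj -(nrm_conj h).
rewrite !cjB !cjM !conjcK cjD conjcK; apply: H.
by rewrite nrm_conj.
Qed.

Lemma dsinckJ u z : dsinck (cj u) (cj z) = (cj (dsinck u z)).
Proof.
rewrite /dsinck !cjM cjN cj1 conjc_real; congr (_ * _).
have := cderivJ (hol_cD (p0 * (z - u)) (etype_hol (@etype_csinc R))).
rewrite cjM cjB conjc_real => H; apply: cD_eq.
by apply: cderiv_eq H => w; rewrite csincJ conjcK.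
Qed.

Let denJ w : (cj (1 - 2 * p0 ^+ 2 * w ^+ 2)) = 1 - 2 * p0 ^+ 2 * (cj w) ^+ 2.
Proof. by rewrite cjB cj1 [cj (2 * _ * _)]cjM [cj (2 * _)]cjM twoJ !cjX conjc_real. Qed.

Let pJ w : cj (p0 * w) = p0 * cj w. Proof. by rewrite cjM conjc_real. Qed.

Lemma kernel_cJ w : kernel_c (cj w) = (cj (kernel_c w)).
Proof.
rewrite /kernel_c; set m := (cos _ - _)%:C; rewrite -pJ CcosJ CsinJ.
move: (Ccos _) (Csin _) => X Y.
by rewrite [RHS]cjM cjV cjB [cj (_ * m)]cjM denJ conjc_real [cj (_ * Y)]cjM.
Qed.

Lemma kernel_dJ w : kernel_d (cj w) = (cj (kernel_d w)).
Proof.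
rewrite /kernel_d; set m := (_ * cos _)%:C; rewrite -pJ CcosJ; move: (Ccos _) => X.
by rewrite [RHS]cjM cjV [cj (_ * m)]cjM denJ conjc_real !cjM twoJ conjc_real.
Qed.

Lemma coef_shiftJ w : coef_shift (cj w) = (cj (coef_shift w)).
Proof.
rewrite /coef_shift cjM cjV; congr (_ / _); first by rewrite [cj (2 * _ * _)]cjM [cj (2 * _)]cjM twoJ !cjX conjc_real.
by rewrite cjB cj1 [cj (2 * _ * _)]cjM [cj (2 * _)]cjM twoJ !cjX conjc_real.
Qed.

Lemma coef_critJ w : coef_crit (cj w) = (cj (coef_crit w)).
Proof. by rewrite /coef_crit cjM cjV twoJ cjD kernel_cJ kernel_dJ. Qed.

Lemma coef_critNJ w : coef_critN (cj w) = (cj (coef_critN w)).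
Proof. by rewrite /coef_critN cjM cjV twoJ cjB kernel_cJ kernel_dJ. Qed.

Lemma kernel_formula_conj w x : (cj (kernel_formula w x%:C)) = coef_shift w * sinck w x%:C +
  coef_crit w * sinck a x%:C + coef_critN w * sinck (- a) x%:C.
Proof.
have cjs c u : cj (c * sinck u x%:C) = cj c * sinck (cj u) x%:C.
  by rewrite cjM -sinckJ conjc_real.
rewrite kernel_formulaE !cjD !cjs -coef_shiftJ -coef_critJ -coef_critNJ !conjcK.
by rewrite cjN !conjc_real.
Qed.

End KernelIdentities.

(** * Integration against a density *)

Section Density.
Context {R : realType}.
Notation leb := (@lebesgue_measure R).
Notation den x := (mu_density x)%:E.
Import HBNNSimple.
Local Open Scope ereal_scope.

Let dge0 (x : R) : 0 <= den x. Proof. by rewrite lee_fin mu_density_ge0. Qed.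

Let mden : measurable_fun [set: measurableTypeR R] (fun x : measurableTypeR R => den x).
Proof. by apply/measurable_EFinP; exact: measurable_mu_density. Qed.

Let integral_mu_nnsfun (h : {nnsfun measurableTypeR R >-> R}) :
  \int[@mu R]_x (h x)%:E = \int[leb]_x ((h x)%:E * den x).
Proof.
transitivity (\int[@mu R]_x
   (\sum_(y \in range h) (y * \1_(h @^-1` [set y]) x)%:E)).
  by apply: eq_integral => t tE; rewrite /= fimfunE -fsumEFin.
have indich r : measurable_fun setT (fun x => (r * \1_(h @^-1` [set r]) x)%:E).
  by apply: (measurable_comp measurableT) => //; exact: measurable_funM.
rewrite ge0_integral_fsum//; last by move=> m y Ey; exact: nnfun_muleindic_ge0.
transitivity (\int[leb]_x (\sum_(y \in range h)
    (y * \1_(h @^-1` [set y]) x)%:E * den x)); last first.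
  apply: eq_integral => x xE.
  rewrite -ge0_mule_fsuml => [|y]; last exact: nnfun_muleindic_ge0.
  by rewrite fsumEFin // -(fimfunE _ x).
rewrite ge0_integral_fsum//; last 2 first.
  - by move=> y; apply: emeasurable_funM.
  - by move=> m y Ey; rewrite mule_ge0// nnfun_muleindic_ge0.
apply: eq_fsbigr => r rhn.
under [LHS]eq_integral do rewrite EFinM.
rewrite integralZl_indic_nnsfun//.
under [RHS]eq_integral do rewrite EFinM -muleA.
rewrite ge0_integralZl//; last 3 first.
- by apply: emeasurable_funM => //; exact/measurable_EFinP.
- by move=> t Et; rewrite mule_ge0 ?lee_fin ?mu_density_ge0.
- by move: rhn; rewrite inE => -[t _ <-]; rewrite lee_fin.
congr (_ * _).
under [RHS]eq_integral do rewrite muleC.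
rewrite [RHS](eq_integral ((fun x => den x) \_ (h @^-1` [set r]))); last first.
  by move=> x xE; rewrite epatch_indic.
by rewrite -integral_mkcondr setTI integral_indic// setIT.
Qed.

(** For simple functions this is the definition of [mu]; monotone approximation
    does the rest. *)
Lemma ge0_integral_mu (f : measurableTypeR R -> \bar R) : (forall x, 0 <= f x) -> measurable_fun setT f ->
  \int[@mu R]_x f x = \int[leb]_x (f x * den x).
Proof.
move=> f0 mf; pose h := nnsfun_approx measurableT mf.
have hf x : f x = lim ((EFin \o h n) x @[n --> \oo]).
  by apply/esym/cvg_lim => //; exact: cvg_nnsfun_approx.
transitivity (lim (\int[@mu R]_x (EFin \o h n) x @[n --> \oo])).
  under eq_integral => x _ do rewrite hf.
  apply: monotone_convergence => //.
  - by move=> n; apply/measurable_EFinP.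
  - by move=> n x Ex //=; rewrite lee_fin.
  - by move=> x Ex a b ab; rewrite lee_fin; exact/lefP/nd_nnsfun_approx.
have -> : (fun n => \int[@mu R]_x (EFin \o h n) x) = (fun n => \int[leb]_x ((EFin \o h n) x * den x)).
  by apply/funext => n; exact: integral_mu_nnsfun.
rewrite -monotone_convergence//.
- apply: eq_integral => x _; apply/cvg_lim => //; apply: cvgeZr => //; exact: cvg_nnsfun_approx.
- by move=> n; apply: emeasurable_funM => //; apply/measurable_EFinP.
- by move=> n x Ex /=; rewrite mule_ge0 ?lee_fin ?mu_density_ge0.
- by move=> x Ex a b ab/=; rewrite lee_wpmul2r ?lee_fin ?mu_density_ge0//; exact/lefP/nd_nnsfun_approx.
Qed.

(** Positive and negative parts are treated separately, so that no
    integrability is required. *)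
Lemma integral_mu (f : R -> R) : measurable_fun setT f ->
  \int[@mu R]_x (f x)%:E = \int[leb]_x (f x * mu_density x)%:E.
Proof.
move=> mf; have mE : measurable_fun setT (EFin \o f) by apply/measurable_EFinP.
rewrite integralE [RHS]integralE; congr (_ - _).
  rewrite ge0_integral_mu//; last exact: measurable_funepos.
  apply: eq_integral => x _; rewrite !funeposE/= -EFin_max -EFinM -EFin_max; congr (_%:E).
  by rewrite maxr_pMl ?mul0r// mu_density_ge0.
rewrite ge0_integral_mu//; last exact: measurable_funeneg.
apply: eq_integral => x _; rewrite !funenegE/= -EFin_max -EFinM -EFin_max; congr (_%:E).
by rewrite maxr_pMl ?mul0r ?mulNr// mu_density_ge0.
Qed.

End Density.

(** * The Hilbert space *)

Section HilbertSpace.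
Context {R : realType}.
Notation C := R[i].
Notation leb := (@lebesgue_measure R).
Implicit Types (F G k : C -> C) (z w c u : C) (x : R).

Lemma ccont_nrm2 (f : R -> C) : ccont f -> continuous (fun x => nrm (f x) ^+ 2).
Proof.
move=> /ccontP[cr ci] x; under eq_fun do rewrite nrm_sqr !expr2.
by apply: cvgD; apply: cvgM; [exact: cr|exact: cr|exact: ci|exact: ci].
Qed.

Lemma Cintegral_mu (f : R -> C) : ccont f ->
  Cintegral mu f = CL (fun x => f x * (mu_density x)%:C).
Proof.
move=> /ccontP[cr ci]; rewrite CLE /Cintegral.
have mr (g : R -> R) : continuous g -> measurable_fun setT g by move=> cg; exact: continuous_measurable_fun.
congr (_ +i* _); rewrite /Rintegral (integral_mu (mr _ _))//; congr (fine _); apply: eq_integral => x _.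
  by rewrite cReM /= mulr0 subr0.
by rewrite cImM /= mulr0 add0r.
Qed.

Lemma B2_inner_wpair F G k : hol F -> hol k -> (forall x, conjc (G x%:C) = k x%:C) ->
  B2_inner mu F G = wpair F k.
Proof.
move=> hF hk Gk; rewrite /B2_inner /wpair.
have -> : (fun x : measurableTypeR R => F x%:C * Num.conj (G x%:C)) = (fun x : R => F x%:C * k x%:C).
  by apply/funext => x; rewrite -Gk.
rewrite Cintegral_mu; last by apply: ccontM; exact: ccont_hol_real.
by apply: eq_CL => x; rewrite mulrA.
Qed.

(** The weight vanishes only at the origin, so it only matters near it, where
    entire functions are bounded anyway. *)
Lemma mu_density_ge (x : R) : 1 <= `|x| -> 1 / 2 <= mu_density x.
Proof.
move=> x1; have p2 := pi_ge2 R.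
have px : 2 <= `|pi * x| by rewrite normrM (ger0_norm (pi_ge0 R)); nra.
have px0 : pi * x != 0 by rewrite -normr_gt0; lra.
rewrite /mu_density /sinc (negbTE px0) -(real_normK (num_real (_ / _))) normrM normfV.
have s1 : `|sin (pi * x)| <= 1 by rewrite ler_norml sin_geN1 sin_le1.
have h : `|sin (pi * x)| / `|pi * x| <= 1 / 2.
  by rewrite ler_pdivrMr; lra.
have h0 : 0 <= `|sin (pi * x)| / `|pi * x| by rewrite divr_ge0.
nra.
Qed.

Lemma B2_PW F : B2 pi mu F -> PW F.
Proof.
move=> [/entire_hol hF gF F2].
have FA e : 0 < e -> exists2 A : R, 0 <= A & forall z, nrm (F z) <= A * expR ((pi + e) * nrm z).
  move=> e0; have [A HA] := gF e e0.
  have {}HA z : nrm (F z) <= A * expR ((pi + e) * nrm z) by have := HA z; rewrite !nrmE.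
  exists A => //; have := HA 0; rewrite nrm0 mulr0 expR0 mulr1.
  exact: le_trans (nrm_ge0 _).
split=> //.
have cF := ccont_nrm2 (ccont_hol_real hF).
have mF : measurable_fun setT (fun x : measurableTypeR R => (nrm (F x%:C) ^+ 2)%:E).
  exact: cont_measT cF.
have iD : leb.-integrable setT (EFin \o (fun x : R => nrm (F x%:C) ^+ 2 * mu_density x)).
  apply/integrableP; split.
    apply/measurable_EFinP; apply: measurable_funM; last exact: measurable_mu_density.
    exact: continuous_measurable_fun cF.
  have -> : (\int[leb]_x `|(EFin \o (fun x : R => nrm (F x%:C) ^+ 2 * mu_density x)%R) x| = \int[leb]_x ((nrm (F x%:C) ^+ 2)%R%:E * (mu_density x)%:E))%E.
    apply: eq_integral => x _; rewrite /= ger0_norm; first by rewrite EFinM.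
    by rewrite mulr_ge0 ?sqr_ge0 ?mu_density_ge0.
  rewrite -(@ge0_integral_mu R (fun x : measurableTypeR R => (nrm (F x%:C) ^+ 2)%:E))//.
  by move=> x; rewrite lee_fin sqr_ge0.
have [A A0 HA] := FA 1 ltr01.
(* bounds F on [-1, 1], where the weight may vanish *)
pose M := A * expR (pi + 1).
have iB := integrableD measurableT (integrableZl measurableT 2 iD)
  (integrableZl measurableT (2 * M ^+ 2) (@integrable_inv1x2 R)).
apply: (dom_integrable (g := fun x => 2 * (nrm (F x%:C) ^+ 2 * mu_density x) + 2 * M ^+ 2 * inv1x2 x)) => //.
move=> x; rewrite ger0_norm ?sqr_ge0//.
have i0 := ltW (inv1x2_gt0 x); have d0 := mu_density_ge0 x.
have f0 := sqr_ge0 (nrm (F x%:C)).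
have [x1|x1] := leP 1 `|x|.
  have := mu_density_ge x1 => d1.
  have : 0 <= 2 * M ^+ 2 * inv1x2 x by rewrite !mulr_ge0// sqr_ge0.
  move: (2 * M ^+ 2 * _) => t t0; nra.
have Mx : nrm (F x%:C) <= M.
  apply: le_trans (HA _) _; rewrite ler_wpM2l// ler_expR nrmC.
  by have := pi_ge0 R; nra.
have Mx2 : nrm (F x%:C) ^+ 2 <= M ^+ 2.
  by rewrite ler_pXn2r// nnegrE ?nrm_ge0// (le_trans (nrm_ge0 _) Mx).
have i1 := inv1x2_ge (ltW x1).
have : 0 <= 2 * (nrm (F x%:C) ^+ 2 * mu_density x) by rewrite mulr_ge0// mulr_ge0.
move: (2 * (_ * _)) => t t0; move: (M ^+ 2) (nrm _ ^+ 2) f0 Mx2 => m f f0 fm; nra.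
Qed.

Lemma B2_kernel k : etype pi k -> kdecay k -> B2 pi mu k.
Proof.
move=> [_ [A A0 HA]] [hk [K K0 kb]]; split; first exact/entire_hol.
  move=> e e0; exists A => z; rewrite !nrmE; apply: le_trans (HA z) _.
  by rewrite ler_wpM2l// ler_expR ler_wpM2r ?nrm_ge0//; lra.
have cF := ccont_nrm2 (ccont_hol_real hk).
under eq_integral do rewrite nrmE.
rewrite ge0_integral_mu//; last 2 first.
- by move=> x; rewrite lee_fin sqr_ge0.
- exact: cont_measT cF.
have := integrableZl measurableT (K ^+ 2) (@integrable_inv1x2 R) => /integrableP[mi].
apply: le_lt_trans; apply: ge0_le_integral => //.
- by move=> x _; rewrite mule_ge0 ?lee_fin ?sqr_ge0 ?mu_density_ge0.
- apply: emeasurable_funM; first exact: cont_measT cF.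
  by apply/measurable_EFinP; exact: measurable_mu_density.
- by apply: measurableT_comp.
move=> x _ /=; rewrite -EFinM lee_fin; apply: le_trans (ler_norm _).
have d1 := mu_density_le1 x; have f0 := sqr_ge0 (nrm (k x%:C)).
apply: (@le_trans _ _ (nrm (k x%:C) ^+ 2)); first by rewrite ler_piMr.
have x0 := normr_ge0 x.
apply: (@le_trans _ _ ((K / (1 + `|x|)) ^+ 2)).
  by rewrite ler_pXn2r// nnegrE ?nrm_ge0// (le_trans (nrm_ge0 _) (kb x)).
rewrite exprMn ler_wpM2l ?sqr_ge0// exprVn lef_pV2 ?posrE ?exprn_gt0 ?ltr_wpDr ?sqr_ge0//.
by rewrite -(real_normK (num_real x)); nra.
Qed.

Lemma etype_shift B F u : 0 <= B -> etype B F -> etype B (fun z => F (z - u)).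
Proof.
move=> B0 [hF [A A0 HA]]; split.
  apply: (hol_comp (F := fun z => z - u)) => //.
  by apply: holB; [exact: hol_id|exact: hol_cst].
exists (A * expR (B * nrm u)) => [|z]; first by rewrite mulr_ge0 ?expR_ge0.
apply: le_trans (HA _) _; rewrite -mulrA ler_wpM2l// -expRD ler_expR -mulrDr [nrm u + _]addrC.
by rewrite ler_wpM2l// nrm_sub.
Qed.

Let etype_lin F u : etype 1 F -> etype pi (fun z => F (pi%:C * (z - u))).
Proof.
move=> eF; apply: (etype_shift (F := fun z => F (pi%:C * z))); first exact: pi_ge0.
have := etype_comp_lin pi%:C ler01 eF.
by rewrite mul1r nrmC (ger0_norm (pi_ge0 R)).
Qed.

Lemma etype_sinck u : etype pi (sinck u).
Proof. exact: etype_lin (@etype_csinc R). Qed.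

Lemma etype_dsinck u : etype pi (dsinck u).
Proof. apply: etypeZ; [exact: pi_ge0|exact: etype_lin (etype_cD ler01 (@etype_csinc R))]. Qed.

(** Kernels that belong to the space and decay fast enough to be paired with
    every member of it. *)
Definition admissible k := etype pi k /\ kdecay k.

Lemma admissibleD k1 k2 : admissible k1 -> admissible k2 -> admissible (fun z => k1 z + k2 z).
Proof. by move=> [e1 d1] [e2 d2]; split; [exact: etypeD|exact: kdecayD]. Qed.

Lemma admissibleZ c k : admissible k -> admissible (fun z => c * k z).
Proof. by move=> [e d]; split; [apply: etypeZ => //; exact: pi_ge0|exact: kdecayZ]. Qed.

Lemma admissible_sinck u : admissible (sinck u).
Proof. by split; [exact: etype_sinck|exact: kdecay_shift]. Qed.

Lemma admissible_dsinck u : admissible (dsinck u).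
Proof. by split; [exact: etype_dsinck|exact: kdecay_dshift]. Qed.

End HilbertSpace.

(** * The reproducing kernel *)

Section Reproducing.
Context {R : realType}.
Notation C := R[i].
Implicit Types (F G k : C -> C) (z w c u : C) (x : R).
Local Notation a := (crit%:C : C).
Local Notation cj := (@conjc R).

(** Without integrability: the parts of a function are nonnegative, so an
    infinite difference is infinite with both signs and [fine] sends it to 0. *)
Lemma RintegralN (nu : {measure set (measurableTypeR R) -> \bar R}) (g : R -> R) :
  \int[nu]_x (- g x) = - \int[nu]_x g x.
Proof.
rewrite /Rintegral.
have -> : (\int[nu]_x (- g x)%:E = \int[nu]_x (EFin \o g)^\- x - \int[nu]_x (EFin \o g)^\+ x)%E.
  rewrite integralE; congr (_ - _)%E; apply: eq_integral => x _.
    by rewrite funeposE funenegE.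
  by rewrite funeposE funenegE/= opprK.
rewrite [in RHS]integralE.
have : (0 <= \int[nu]_x (EFin \o g)^\+ x)%E by apply: integral_ge0 => x _; exact: funepos_ge0.
have : (0 <= \int[nu]_x (EFin \o g)^\- x)%E by apply: integral_ge0 => x _; exact: funeneg_ge0.
by case: (\int[nu]_x _)%E => [s| |]; case: (\int[nu]_x _)%E => [t| |] //= _ _; rewrite ?oppr0// opprB.
Qed.

Lemma B2_innerC (nu : {measure set (measurableTypeR R) -> \bar R}) F G :
  B2_inner nu F G = cj (B2_inner nu G F).
Proof.
rewrite /B2_inner /Cintegral /=; congr (_ +i* _).
  by apply: eq_Rintegral => x _; case: (F _) => p q; case: (G _) => s t /=; ring.
rewrite -RintegralN.
by apply: eq_Rintegral => x _; case: (F _) => p q; case: (G _) => s t /=; ring.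
Qed.

Definition point_kernel w k := B2 pi mu k /\ forall F, B2 pi mu F -> F w = B2_inner mu F k.

(** Evaluate each kernel with the other one: this gives uniqueness, and turns
    the dependence on [w] into the dependence on [z]. *)
Lemma point_kernel_sym w z k l : point_kernel w k -> point_kernel z l -> k z = cj (l w).
Proof. by move=> [k2 kr] [l2 lr]; rewrite (lr k k2) (kr l l2) B2_innerC. Qed.

Lemma admissible_comb (b1 b2 b3 : C) k : admissible k ->
  admissible (fun z => b1 * k z + b2 * sinck a z + b3 * sinck (- a) z).
Proof.
by move=> ak; apply: admissibleD; [apply: admissibleD|]; apply: admissibleZ => //; exact: admissible_sinck.
Qed.

Lemma wpair_comb F k (b1 b2 b3 : C) : PW F -> admissible k ->
  wpair F (fun z => b1 * k z + b2 * sinck a z + b3 * sinck (- a) z) =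
  b1 * wpair F k + b2 * wpair F (sinck a) + b3 * wpair F (sinck (- a)).
Proof.
move=> pF [_ kk]; have ds u b := kdecayZ b (kdecay_shift u).
have dk := kdecayZ b1 kk.
rewrite (wpairD pF (kdecayD dk (ds _ _)) (ds _ _)) (wpairD pF dk (ds _ _)).
by rewrite !wpairZ//; exact: kdecay_shift.
Qed.

(** From a representation of the values at [w] by pairings to a kernel: on the
    real line, [k] has to be the conjugate of the kernel in the pairings. *)
Lemma point_kernel_of w k (b1 b2 b3 c1 c2 c3 : C) h l : admissible h -> admissible l ->
  k = (fun z => c1 * h z + c2 * sinck a z + c3 * sinck (- a) z) ->
  (forall x, cj (k x%:C) = b1 * l x%:C + b2 * sinck a x%:C + b3 * sinck (- a) x%:C) ->
  (forall F, PW F -> F w = b1 * wpair F l + b2 * wpair F (sinck a) + b3 * wpair F (sinck (- a))) ->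
  point_kernel w k.
Proof.
move=> ah al kE kJ rep; split.
  by rewrite kE; have [e d] := admissible_comb c1 c2 c3 ah; exact: B2_kernel.
move=> F /[dup] FB /B2_PW pF; rewrite rep// -wpair_comb//.
have [hF _ _] := pF; have [[hl _] _] := admissible_comb b1 b2 b3 al.
by rewrite (B2_inner_wpair (k := fun z => b1 * l z + b2 * sinck a z + b3 * sinck (- a) z)).
Qed.

Lemma kernel_formula_point w : ~~ exceptional w -> point_kernel w (kernel_formula w).
Proof.
move=> ne; apply: (point_kernel_of (b1 := coef_shift w) (b2 := coef_crit w) (b3 := coef_critN w)
  (c1 := coef_shift (cj w)) (c2 := coef_crit (cj w)) (c3 := coef_critN (cj w))
  (admissible_sinck (cj w)) (admissible_sinck w)).
- by apply/funext => z; exact: kernel_formulaE.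
- by move=> x; exact: kernel_formula_conj.
- by move=> F pF; exact: representation.
Qed.

Lemma exceptional_real w : exceptional w -> cj w = w.
Proof. by rewrite /exceptional => /orP[] /eqP ->; apply: complexP; rewrite //= !oppr0. Qed.

Lemma exists_point_kernel w : exists k, point_kernel w k.
Proof.
have [ew|ne] := boolP (exceptional w); last by exists (kernel_formula w); exact: kernel_formula_point.
have [[[b1 b2] b3] /= rep] := representation_exceptional ew.
exists (fun z => cj b1 * dsinck w z + cj b2 * sinck a z + cj b3 * sinck (- a) z).
apply: (point_kernel_of (admissible_dsinck w) (admissible_dsinck w) _ _ rep); first by [].
have cs p q x : cj (cj p * sinck q%:C x%:C) = p * sinck q%:C x%:C.
  by rewrite [LHS]rmorphM /= conjcK -sinckJ !conjc_real.
move=> x; rewrite [LHS]rmorphD [X in X + _]rmorphD /= -rmorphN !cs; congr (_ + _ + _).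
by rewrite [LHS]rmorphM /= conjcK -dsinckJ (exceptional_real ew) conjc_real.
Qed.

End Reproducing.

Theorem theorem3 (R : realType) :
  (exists K : R[i] -> R[i] -> R[i], is_reproducing_kernel pi mu K) /\
  (forall K : R[i] -> R[i] -> R[i], is_reproducing_kernel pi mu K ->
     forall w z : R[i],
       (~~ exceptional w -> K w z = kernel_formula w z) /\
       (exceptional w ->
          (kernel_formula v z : R[i]^o) @[v --> (w : R[i]^o)^'] -->
          (K w z : R[i]^o))).
Proof.
split.
  have [K HK] := choice (@exists_point_kernel R).
  by exists K; split=> [w|F FB w]; have [h1 h2] := HK w; [exact: h1|exact: h2].
move=> K [K2 Kr] w z.
have pk u : point_kernel u (K u) by split=> // F FB; exact: Kr.
have KE u : ~~ exceptional u -> K u z = kernel_formula u z.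
  by move=> /kernel_formula_point pu; rewrite (point_kernel_sym (pk u) (pk z)) -(point_kernel_sym pu (pk z)).
split=> [|ew]; first exact: KE.
(* the limit is taken in the second argument of K z, by symmetry *)
have [/entire_hol hK _ _] := K2 z.
have /cvg_dnbhs cK := hol_cvg (z := w) hK.
apply/cvg_dnbhs => e e0; have [d d0 H] := cK e e0.
exists (Num.min d crit) => [|h]; first by rewrite lt_min d0 crit_gt0.
rewrite lt_min => /and3P[h0 hd hc].
rewrite -KE; last by apply: near_nonexceptional => //; rewrite h0.
rewrite !(point_kernel_sym (pk _) (pk z)).
have -> : conjc (K z (w + h)) - conjc (K z w) = conjc (K z (w + h) - K z w).
  by rewrite rmorphB.
by rewrite nrm_conj; apply: H; rewrite h0.
Qed.
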